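(* Let $M$ be the closed Möbius band with its standard density form $\omega$. The group $\mathrm{Diff}_{\omega}(M,\partial M)_0$ admits countably infinitely many homogeneous quasimorphisms which are linearly independent; that is, the real vector space of homogeneous quasimorphisms $\mathrm{Diff}_{\omega}(M,\partial M)_0\to\mathbb{R}$ contains a countably infinite linearly independent family.
   Context: Möbius band: let $I=[-1/2,1/2]$, $\widetilde M=\mathbb{R}\times I$, $\tau:\widetilde M\to\widetilde M$, $\tau(z,w)=(z+1,-w)$, and $M=\widetilde M/\langle\tau\rangle$. Density form: a density form on a smooth $n$-manifold $N$ (possibly non-orientable, possibly with boundary) is a nowhere vanishing $n$-form with values in the orientation line bundle $L_N$ (a twisted $n$-form, or $n$-form of odd type). A diffeomorphism $h$ of $N$ acts on twisted forms by pullback, using the canonical bundle map $L_N\to L_N$ covering $h$, which sends the standard local section of $L_N$ in a chart to the standard local section in the target chart whenever the Jacobian determinant of $h$ in these charts is positive. The standard density form $\omega$ on $M$ is the one whose lift to $\widetilde M\subset\mathbb{R}^2$ is $dx\wedge dy$ (tensored with the standard section of the orientation bundle of $\widetilde M$), i.e. the one inducing the measure descended from Lebesgue measure. A diffeomorphism $h$ is density-preserving if $h^*\omega=\omega$. $\mathrm{Diff}_\omega(M,\partial M)_0$ is the identity component of the group of smooth density-preserving diffeomorphisms of $M$ which are the identity on $\partial M$. Quasimorphism: a function $\mu:G\to\mathbb{R}$ on a group $G$ is a quasimorphism if there is $D\ge 0$ with $|\mu(gh)-\mu(g)-\mu(h)|\le D$ for all $g,h\in G$; it is homogeneous if $\mu(g^k)=k\mu(g)$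 for all $g\in G$, $k\in\mathbb{Z}$. *)

(* Defs.v *)
From HB Require Import structures.
From mathcomp Require Import all_boot all_order all_algebra.
From mathcomp Require Import generic_quotient.
From mathcomp Require Import all_classical all_reals all_analysis.
From mathcomp Require Import ring lra.
Set Implicit Arguments.
Unset Strict Implicit.
Unset Printing Implicit Defensive.
Import Order.TTheory GRing.Theory Num.Theory numFieldNormedType.Exports.
Local Open Scope classical_set_scope.
Local Open Scope ring_scope.
Local Open Scope quotient_scope.

Lemma near_eq_differentiable (R : realType) (V W : normedModType R) (f g : V -> W) p :
  {near p, f =1 g} -> differentiable f p -> differentiable g p.
Proof.
move=> fg df.
suff dh : differentiable (g - f) p.
  have -> : g = f + (g - f) by apply/funext => q /=; rewrite addrC subrK.
  exact: differentiableD.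
pose z : {linear V -> W} := \0.
pose k := g - f.
have h0 : k \o shift p = cst (k p) + z +o_ 0 id.
  apply/eqaddoP => _ /posnumP[e].
  have fgp : f p = g p := nbhs_singleton fg.
  have : \forall h \near 0, f (h + p) = g (h + p).
    by have := fg; rewrite (near_shift (0 : V) p (fun q => f q = g q)) subr0.
  apply: filterS => h fgh.
  rewrite /= !fctE /= /k !fctE fgp fgh !subrr addr0 subr0 normr0.
  by rewrite mulr_ge0.
have c0 : continuous z by move=> q; exact: cvg_cst.
by apply/diff_locallyP; rewrite (diff_unique c0 h0); split.
Qed.

Section Smooth.
Variable R : realType.
Implicit Types (f g : R * R -> R) (U V : set (R * R)) (s : seq bool).
Implicit Types (p v : R * R) (F G : R * R -> R * R).

Definition dir (b : bool) : R * R := if b then (0, 1) else (1, 0).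

(* [partial [:: b1; ...; bk] f] is the iterated partial derivative
   d_{bk} ... d_{b1} f, where d_false is d/dx and d_true is d/dy; on an open
   set, f is C^oo iff all of them exist and are differentiable. *)
Definition partial s f : R * R -> R := foldl (fun g b => 'D_(dir b) g) f s.

Definition smooth_on U f : Prop :=
  forall s p, U p -> differentiable (partial s f) p.

Definition smooth_on2 U F : Prop :=
  smooth_on U (fun p => (F p).1) /\ smooth_on U (fun p => (F p).2).

Let Ck n U f := forall s p, (size s <= n)%N -> U p -> differentiable (partial s f) p.

Let smooth_onP U f : smooth_on U f <-> forall n, Ck n U f.
Proof. by split=> [h n s p _|h s p]; [exact: h|exact: (h (size s))]. Qed.

Let CkS n U f :
  Ck n.+1 U f <-> (forall p, U p -> differentiable f p) /\ forall b, Ck n U ('D_(dir b) f).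
Proof.
split=> [h|[h1 h2] [|b s] p /= sn Up]; last 2 first.
- exact: h1.
- exact: h2.
- split=> [p|b s p sn]; first exact: (h [::]).
  exact: (h (b :: s)).
Qed.

Let CkW n U f : Ck n.+1 U f -> Ck n U f.
Proof. by move=> h s p sn; apply: h; exact: leqW. Qed.

Lemma partial_near s f g p :
  {near p, f =1 g} -> {near p, partial s f =1 partial s g}.
Proof.
elim: s f g => //= b s IH f g fg; apply: IH.
have := near_join fg; apply: filterS => q fgq.
exact: near_eq_derive fgq.
Qed.

Let CkE n U f g : open U -> (forall p, U p -> f p = g p) -> Ck n U f -> Ck n U g.
Proof.
move=> oU fg fC s p sn Up.
apply: (@near_eq_differentiable _ _ _ (partial s f)); last exact: fC.
apply: partial_near.
have : \near p, U p by exact: open_nbhs_nbhs.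
exact: filterS.
Qed.

Let CkD n U f g : open U -> Ck n U f -> Ck n U g -> Ck n U (f \+ g).
Proof.
move=> oU; elim: n f g => [|n IH] f g.
  move=> fC gC [|//] p _ Up /=.
  by apply: differentiableD; [exact: (fC [::])|exact: (gC [::])].
move=> /CkS[df fC] /CkS[dg gC]; apply/CkS; split=> [p Up|b].
  by apply: differentiableD; [exact: df|exact: dg].
apply: (CkE oU _ (IH _ _ (fC b) (gC b))) => p Up /=.
by rewrite deriveD//; apply: diff_derivable; [exact: df|exact: dg].
Qed.

Let CkM n U f g : open U -> Ck n U f -> Ck n U g -> Ck n U (f \* g).
Proof.
move=> oU; elim: n f g => [|n IH] f g.
  move=> fC gC [|//] p _ Up /=.
  by apply: differentiableM; [exact: (fC [::])|exact: (gC [::])].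
move=> fC0 gC0; have [df fC] := (CkS _ _ _).1 fC0.
have [dg gC] := (CkS _ _ _).1 gC0; apply/CkS; split=> [p Up|b].
  by apply: differentiableM; [exact: df|exact: dg].
apply: (CkE oU _ (CkD oU (IH _ _ (CkW fC0) (gC b)) (IH _ _ (CkW gC0) (fC b)))).
move=> p Up /=.
by rewrite deriveM//; apply: diff_derivable; [exact: df|exact: dg].
Qed.

Lemma diff_coord F p :
  differentiable (fun q => (F q).1) p -> differentiable (fun q => (F q).2) p ->
  differentiable F p /\
  forall v, 'd F p v = ('D_v (fun q => (F q).1) p, 'D_v (fun q => (F q).2) p).
Proof.
move=> d1 d2.
have FE : F = (fun q => ((F q).1, (F q).2)) by apply/funext => q; case: (F q).
split; first by rewrite FE; exact: differentiable_pair.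
by move=> v; rewrite [in LHS]FE diff_pair//= !deriveE.
Qed.

Lemma dir_decomp v : v = v.1 *: dir false + v.2 *: dir true.
Proof.
case: v => a b; rewrite /dir; congr pair => /=; rewrite /GRing.scale/=; ring.
Qed.

Lemma derive_comp f F p v :
  differentiable f (F p) ->
  differentiable (fun q => (F q).1) p -> differentiable (fun q => (F q).2) p ->
  'D_v (f \o F) p = 'D_(dir false) f (F p) * 'D_v (fun q => (F q).1) p
                  + 'D_(dir true) f (F p) * 'D_v (fun q => (F q).2) p.
Proof.
move=> df d1 d2; have [dF dFE] := diff_coord d1 d2.
rewrite deriveE; last exact: differentiable_comp.
rewrite diff_comp//= dFE.
set a := 'D_v _ p; set b := 'D_v _ p.
rewrite [X in 'd f (F p) X]dir_decomp linearD !linearZ/= -!deriveE//.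
by rewrite /GRing.scale/= mulrC [b * _]mulrC.
Qed.

Let Ck_comp n U V f F : open U -> open V -> (forall p, U p -> V (F p)) ->
  Ck n V f -> Ck n U (fun p => (F p).1) -> Ck n U (fun p => (F p).2) ->
  Ck n U (f \o F).
Proof.
move=> oU oV UV; elim: n f => [|n IH] f fC0 C1 C2.
  move=> [|//] p _ Up /=; apply: differentiable_comp.
    by have [] := @diff_coord F p (C1 [::] p isT Up) (C2 [::] p isT Up).
  by apply: (fC0 [::]) => //; exact: UV.
have [df fC] := (CkS _ _ _).1 fC0.
have [d1 D1] := (CkS _ _ _).1 C1; have [d2 D2] := (CkS _ _ _).1 C2.
apply/CkS; split=> [p Up|b].
  apply: differentiable_comp; last by apply: df; exact: UV.
  by have [] := @diff_coord F p (d1 _ Up) (d2 _ Up).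
apply: (CkE oU _ (CkD oU (CkM oU (IH _ (fC false) (CkW C1) (CkW C2)) (D1 b))
  (CkM oU (IH _ (fC true) (CkW C1) (CkW C2)) (D2 b)))) => p Up /=.
by rewrite derive_comp//; [exact/df/UV|exact: d1|exact: d2].
Qed.

Lemma smooth_on_comp U V F G : open U -> open V -> (forall p, U p -> V (F p)) ->
  smooth_on2 U F -> smooth_on2 V G -> smooth_on2 U (G \o F).
Proof.
move=> oU oV UV [/smooth_onP F1 /smooth_onP F2] [/smooth_onP G1 /smooth_onP G2].
by split; apply/smooth_onP => n; [apply: (Ck_comp oU oV UV (G1 n))|
  apply: (Ck_comp oU oV UV (G2 n))].
Qed.

Lemma smooth_on_comp1 U V F f : open U -> open V -> (forall p, U p -> V (F p)) ->
  smooth_on2 U F -> smooth_on V f -> smooth_on U (f \o F).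
Proof.
move=> oU oV UV [/smooth_onP F1 /smooth_onP F2] /smooth_onP sf.
by apply/smooth_onP => n; apply: (Ck_comp oU oV UV (sf n)).
Qed.

Lemma smooth_onD U f g : open U -> smooth_on U f -> smooth_on U g ->
  smooth_on U (f \+ g).
Proof.
by move=> oU /smooth_onP sf /smooth_onP sg; apply/smooth_onP => n; exact: CkD.
Qed.

Lemma smooth_onM U f g : open U -> smooth_on U f -> smooth_on U g ->
  smooth_on U (f \* g).
Proof.
by move=> oU /smooth_onP sf /smooth_onP sg; apply/smooth_onP => n; exact: CkM.
Qed.

Lemma smooth_onW U V f : U `<=` V -> smooth_on V f -> smooth_on U f.
Proof. by move=> UV h s p /UV; exact: h. Qed.

Let jetb n (A : R) f p := forall s, (size s <= n)%N -> `|partial s f p| <= A.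

Let jetbS n A f p : jetb n.+1 A f p -> forall b, jetb n A ('D_(dir b) f) p.
Proof. by move=> h b s sn; exact: (h (b :: s)). Qed.

Lemma smooth_on_derive b U f : smooth_on U f -> smooth_on U ('D_(dir b) f).
Proof. by move=> sf s; exact: (sf (b :: s)). Qed.

Lemma partial_on s U f g p : open U -> U p -> (forall q, U q -> f q = g q) ->
  partial s f p = partial s g p.
Proof.
move=> oU Up fg.
apply: (@nbhs_singleton _ p (fun q => partial s f q = partial s g q)).
apply: partial_near.
have : \near p, U p by exact: open_nbhs_nbhs.
exact: filterS.
Qed.

Lemma partialD s U f g p : open U -> smooth_on U f -> smooth_on U g -> U p ->
  partial s (f \+ g) p = partial s f p + partial s g p.
Proof.
move=> oU; elim: s f g => //= b s IH f g sf sg Up.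
rewrite (@partial_on s U _ ('D_(dir b) f \+ 'D_(dir b) g))//; last first.
  by move=> q Uq /=; rewrite deriveD//; apply: diff_derivable;
    [exact: (sf [::])|exact: (sg [::])].
by rewrite IH//; exact: smooth_on_derive.
Qed.

Lemma partial_cst s (c : R) :
  partial s (cst c : R * R -> R) = cst (if s is [::] then c else 0).
Proof.
elim: s c => // b s IH c /=.
have -> : 'D_(dir b) (cst c : R * R -> R) = cst 0.
  by apply/funext => p; rewrite derive_cst.
by rewrite IH; case: s {IH}.
Qed.

Lemma smooth_cst U (c : R) : smooth_on U (cst c : R * R -> R).
Proof. by move=> s p _; rewrite partial_cst; exact: differentiable_cst. Qed.

Lemma smooth_onB U f g : open U -> smooth_on U f -> smooth_on U g ->
  smooth_on U (f \- g).
Proof.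
move=> oU sf sg.
have -> : f \- g = f \+ (cst (-1) \* g) by apply/funext => q /=; rewrite mulN1r.
by apply: smooth_onD => //; apply: smooth_onM => //; exact: smooth_cst.
Qed.

Lemma partialB s U f g p : open U -> smooth_on U f -> smooth_on U g -> U p ->
  partial s (f \- g) p = partial s f p - partial s g p.
Proof.
move=> oU sf sg Up.
have E : (f \- g) \+ g = f by apply/funext => q /=; rewrite subrK.
have := partialD s oU (smooth_onB oU sf sg) sg Up.
by rewrite E => ->; rewrite addrK.
Qed.

Let jetbM n U f g p A B : open U -> smooth_on U f -> smooth_on U g -> U p ->
  jetb n A f p -> jetb n B g p -> jetb n (2 ^+ n * (A * B)) (f \* g) p.
Proof.
move=> oU; elim: n f g A B => [|n IH] f g A B sf sg Up fA gB.
  move=> [|//] _ /=; rewrite expr0 mul1r normrM.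
  by apply: ler_pM => //; [exact: (fA [::])|exact: (gB [::])].
have A0 : 0 <= A by rewrite (le_trans _ (fA [::] isT)).
have B0 : 0 <= B by rewrite (le_trans _ (gB [::] isT)).
have fA' : jetb n A f p by move=> s sn; apply: fA; exact: leqW.
have gB' : jetb n B g p by move=> s sn; apply: gB; exact: leqW.
move=> [_|b s sn] /=.
  apply: (@le_trans _ _ (A * B)).
    by rewrite normrM; apply: ler_pM => //; [exact: (fA [::])|exact: (gB [::])].
  by rewrite ler_peMl ?mulr_ge0// exprn_ege1// ler1n.
rewrite (@partial_on s U _ ((f \* 'D_(dir b) g) \+ (g \* 'D_(dir b) f)))//; last first.
  by move=> q Uq /=; rewrite deriveM//; apply: diff_derivable;
    [exact: (sf [::])|exact: (sg [::])].
rewrite (partialD _ oU)//; try by apply: smooth_onM => //; exact: smooth_on_derive.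
apply: (le_trans (ler_normD _ _)).
rewrite exprS -mulrA mulr_natl mulr2n; apply: lerD.
  by apply: IH => //; [exact: smooth_on_derive|exact: jetbS].
rewrite [A * B]mulrC.
by apply: IH => //; [exact: smooth_on_derive|exact: jetbS].
Qed.

Lemma jet_comp n (B : R) : exists C : R, 0 <= C /\ forall U V F f p d,
  open U -> open V -> (forall q, U q -> V (F q)) ->
  smooth_on2 U F -> smooth_on V f -> U p ->
  jetb n B (fun q => (F q).1) p -> jetb n B (fun q => (F q).2) p ->
  jetb n d f (F p) -> jetb n (C * d) (f \o F) p.
Proof.
elim: n => [|n [C [C0 IH]]].
  exists 1; split => // U V F f p d oU oV UV sF sf Up _ _ fd [|//] _ /=.
  by rewrite mul1r; exact: (fd [::]).
exists (1 + 2 ^+ n.+1 * (C * `|B|)); split.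
  by rewrite addr_ge0// !mulr_ge0// exprn_ge0.
move=> U V F f p d oU oV UV sF sf Up F1 F2 fd.
have d0 : 0 <= d by rewrite (le_trans _ (fd [::] isT)).
move=> [_|b s sn] /=.
  apply: (@le_trans _ _ d); first exact: (fd [::]).
  by rewrite ler_peMl// lerDl !mulr_ge0// exprn_ge0.
pose f0 := 'D_(dir false) f; pose f1 := 'D_(dir true) f.
pose F1' := 'D_(dir b) (fun q => (F q).1); pose F2' := 'D_(dir b) (fun q => (F q).2).
rewrite (@partial_on s U _ (((f0 \o F) \* F1') \+ ((f1 \o F) \* F2')))//; last first.
  move=> q Uq /=; rewrite derive_comp//; first by apply: (sf [::]); exact: UV.
    exact: (sF.1 [::]).
  exact: (sF.2 [::]).
have sF1 : smooth_on U F1' by apply: smooth_on_derive; exact: sF.1.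
have sF2 : smooth_on U F2' by apply: smooth_on_derive; exact: sF.2.
have sf0 : smooth_on V f0 by exact: smooth_on_derive.
have sf1 : smooth_on V f1 by exact: smooth_on_derive.
have s0 := smooth_on_comp1 oU oV UV sF sf0.
have s1 := smooth_on_comp1 oU oV UV sF sf1.
rewrite (partialD _ oU)//; [|exact: smooth_onM..].
have W A h q : jetb n.+1 A h q -> jetb n A h q.
  by move=> hA t tn; apply: hA; exact: leqW.
have N h q : jetb n B h q -> jetb n `|B| h q.
  by move=> hB t tn; rewrite (le_trans (hB _ tn))// ler_norm.
have J0 : jetb n (C * d) (f0 \o F) p.
  apply: (IH U V) => //; [exact: (W _ _ _ F1)|exact: (W _ _ _ F2)|exact: jetbS].
have J1 : jetb n (C * d) (f1 \o F) p.
  apply: (IH U V) => //; [exact: (W _ _ _ F1)|exact: (W _ _ _ F2)|exact: jetbS].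
apply: (le_trans (ler_normD _ _)).
apply: (@le_trans _ _ (2 ^+ n * (C * d * `|B|) + 2 ^+ n * (C * d * `|B|))).
  apply: lerD.
    by apply: (jetbM oU) => //; apply: N; exact: jetbS.
  by apply: (jetbM oU) => //; apply: N; exact: jetbS.
rewrite mulrDl mul1r [2 ^+ n.+1]exprS.
have -> : 2 * 2 ^+ n * (C * `|B|) * d = 2 ^+ n * (C * d * `|B|) + 2 ^+ n * (C * d * `|B|).
  by ring.
by rewrite lerDr.
Qed.
End Smooth.

Section Mobius.
Variable R : realType.
Implicit Types (p q u v : R * R) (F G H : R * R -> R * R).

Definition in_strip p : bool := - 2^-1 <= p.2 <= 2^-1.
Definition strip : Type := {p : R * R | in_strip p}.
HB.instance Definition _ := Choice.on strip.
Implicit Types x y z : strip.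

Definition tau p : R * R := (p.1 + 1, - p.2).

(* x and y are in the same orbit of the group generated by [tau]. *)
Definition tau_orbit : rel strip := fun x y =>
  `[< exists n, iter n tau (val x) = val y \/ iter n tau (val y) = val x >].

Let itau n p : iter n tau p = (p.1 + n%:R, (-1) ^+ n * p.2).
Proof.
elim: n => [|n IH]; first by case: p => a b; rewrite /= expr0 addr0 mul1r.
by rewrite iterS IH /tau/= exprS -natr1 addrA mulN1r mulNr.
Qed.

Let tau_inj : injective tau.
Proof. by move=> [a b] [c d] [/addIr -> /oppr_inj ->]. Qed.

Let itau_inj n : injective (iter n tau).
Proof. by elim: n => // n IH p q /tau_inj /IH. Qed.

Let itau_cancel m n p q r :
  iter m tau p = r -> iter n tau q = r -> exists k, iter k tau p = q \/ iter k tau q = p.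
Proof.
move=> pr qr; have [mn|/ltnW nm] := leqP m n.
  exists (n - m)%N; right; apply: (@itau_inj m).
  by rewrite pr -qr -iterD subnKC.
exists (m - n)%N; left; apply: (@itau_inj n).
by rewrite qr -pr -iterD subnKC.
Qed.

Let itau_fork m n p q r :
  iter m tau r = p -> iter n tau r = q -> exists k, iter k tau p = q \/ iter k tau q = p.
Proof.
move=> <- <-; have [mn|/ltnW nm] := leqP m n.
  by exists (n - m)%N; left; rewrite -iterD subnK.
by exists (m - n)%N; right; rewrite -iterD subnK.
Qed.

Lemma tau_orbit_equiv : equiv_class_of tau_orbit.
Proof.
split=> [x|x y|y x z].
- by apply/asboolP; exists 0%N; left.
- by apply/asboolP/asboolP => -[n [h|h]]; exists n; [right|left|right|left].
- move=> /asboolP[m xy] /asboolP[n yz]; apply/asboolP.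
  case: xy yz => [xy|yx] [yz|zy].
  + by exists (n + m)%N; left; rewrite iterD xy.
  + exact: itau_cancel xy zy.
  + exact: itau_fork yx yz.
  + by exists (m + n)%N; right; rewrite iterD zy.
Qed.
Canonical tau_orbit_equivRel := EquivRelPack tau_orbit_equiv.

Definition mobius : Type := {eq_quot tau_orbit}.
HB.instance Definition _ := Choice.on mobius.
HB.instance Definition _ := Quotient.on mobius.
Implicit Types f g h : mobius -> mobius.

Definition proj x : mobius := \pi_mobius x.

(* The projection [proj] is a local diffeomorphism, so that its local inverses
   are the charts of the smooth manifold with boundary [mobius], and a map
   read in these charts is a local lift to the strip. Near boundary points, smoothness
   means, as usual, having a smooth extension to an open subset of the plane;
   [F] is such an extension, and only its values on the strip are
   constrained. *)
Definition local_lift h x F : Prop :=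
  exists U : set (R * R), [/\ open U, U (val x), smooth_on2 U F &
    forall y, U (val y) -> exists z, val z = F (val y) /\ h (proj y) = proj z].

Definition smooth_map h : Prop := forall x, exists F, local_lift h x F.

Definition diffeo h : Prop :=
  exists h', [/\ cancel h h', cancel h' h, smooth_map h & smooth_map h'].

Definition id_on_boundary h : Prop :=
  forall x, `|(val x).2| = 2^-1 -> h (proj x) = proj x.

(* In a chart, a 2-form with values in the orientation line bundle L is
   eta (x) o, where o is the standard local section of L: [form] is the type
   of the coefficients eta. The canonical bundle map of L covering a local
   diffeomorphism F sends o to o or to -o according to the sign of the
   Jacobian determinant [jac F], hence the sign in [pullback]. *)
Definition form : Type := R * R -> R * R -> R * R -> R.

Definition dxdy u v : R := u.1 * v.2 - u.2 * v.1.

(* This is the lift to the strip of the standard density form; it descends to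
   the quotient by [preserves_omega_id], as [tau] is a lift of the identity. *)
Definition omega : form := fun=> dxdy.

Definition jac F p : R := dxdy ('d F p (dir R false)) ('d F p (dir R true)).

Definition pullback F (eta : form) : form :=
  fun p u v => Num.sg (jac F p) * eta (F p) ('d F p u) ('d F p v).

(* h^* omega = omega, read in arbitrary charts of the source and target. *)
Definition preserves_omega h : Prop :=
  forall x F, local_lift h x F -> pullback F omega (val x) = omega (val x).

Lemma proj_eq x y : proj x = proj y -> exists k : int,
  val x = ((val y).1 + k%:~R, (-1) ^+ `|k|%N * (val y).2).
Proof.
move=> /eqmodP /asboolP[n [|]]; rewrite itau => h.
  exists (- n%:Z); rewrite -h/= mulrNz addrK abszN absz_nat mulrA -exprMn.
  by rewrite mulrNN mulr1 expr1n mul1r; case: (val x).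
by exists n%:Z; rewrite -h absz_nat.
Qed.

Let smooth2_cont U F p : U p -> smooth_on2 U F -> {for p, continuous F}.
Proof.
move=> Up [s1 s2]; apply: differentiable_continuous.
by have [] := @diff_coord R F p (s1 [::] p Up) (s2 [::] p Up).
Qed.

Lemma open_preimage U V F : open U -> open V -> smooth_on2 U F -> open (U `&` F @^-1` V).
Proof.
move=> oU oV sF; rewrite openE => p [Up VFp].
apply: filterI; first exact: open_nbhs_nbhs.
apply: (smooth2_cont Up sF); exact: open_nbhs_nbhs.
Qed.

Lemma local_lift_comp f g x y F G :
  local_lift f x F -> local_lift g y G -> val y = F (val x) ->
  local_lift (g \o f) x (G \o F).
Proof.
move=> [U [oU Ux sF FU]] [V [oV Vy sG GV]] yFx.
exists (U `&` F @^-1` V); split.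
- exact: open_preimage.
- by split => //=; rewrite -yFx.
- apply: (@smooth_on_comp R _ V) => //; first exact: open_preimage.
    by move=> p [].
  by split; apply: (@smooth_onW R _ U) => [p []//|]; case: sF.
- move=> a [Ua VFa]; have [b [bFa fa]] := FU _ Ua.
  have [|c [cGb gb]] := GV b; first by rewrite bFa.
  by exists c; rewrite cGb bFa /= fa gb.
Qed.

Lemma smooth_map_comp f g : smooth_map f -> smooth_map g -> smooth_map (g \o f).
Proof.
move=> sf sg x; have [F lF] := sf x.
have [y [yFx _]] : exists z, val z = F (val x) /\ f (proj x) = proj z.
  by case: lF => U [_ Ux _]; exact.
have [G lG] := sg y.
by exists (G \o F); exact: local_lift_comp lG yFx.
Qed.

Lemma smooth_linear U (l : {linear (R * R)%type -> R^o}) : continuous l -> smooth_on U l.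
Proof.
move=> cl [|b s] p _ /=; first exact: linear_differentiable.
have -> : 'D_(dir R b) l = cst (l (dir R b)).
  by apply/funext => q; rewrite deriveE ?diff_lin//; exact: linear_differentiable.
by rewrite partial_cst; exact: differentiable_cst.
Qed.

Lemma smooth_id U : smooth_on2 U (id : R * R -> R * R).
Proof.
split.
  apply: (@smooth_linear U (@fst R R)); move=> ?; exact: cvg_fst.
apply: (@smooth_linear U (@snd R R)); move=> ?; exact: cvg_snd.
Qed.

Lemma local_lift_id x : local_lift id x id.
Proof.
exists setT; split => //; [exact: openT|exact: smooth_id|].
by move=> y _; exists y.
Qed.

Lemma lift_uniq h x F H : local_lift h x F -> local_lift h x H ->
  exists k : int, \forall p \near val x, in_strip p ->
    F p = ((H p).1 + k%:~R, (-1) ^+ `|k|%N * (H p).2).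
Proof.
move=> [U [oU Ux sF FU]] [V [oV Vx sH HV]].
have E y : U (val y) -> V (val y) -> exists k : int,
   F (val y) = ((H (val y)).1 + k%:~R, (-1) ^+ `|k|%N * (H (val y)).2).
  move=> Uy Vy; have [a [<- hy]] := FU y Uy; have [b [<- hy']] := HV y Vy.
  by apply: proj_eq; rewrite -hy.
have [k kx] := E x Ux Vx; exists k.
have cF : {for val x, continuous (fun q => (F q).1)}.
  by apply: differentiable_continuous; exact: (sF.1 [::]).
have cH : {for val x, continuous (fun q => (H q).1)}.
  by apply: differentiable_continuous; exact: (sH.1 [::]).
have e0 : 0 < 2^-1 :> R by [].
near=> p; move=> sp.
have Up : U p by near: p; exact: open_nbhs_nbhs.
have Vp : V p by near: p; exact: open_nbhs_nbhs.
have F1 : `|(F (val x)).1 - (F p).1| < 2^-1.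
  by near: p; exact: (proj1 (cvgrPdist_lt _ _) cF _ e0).
have H1 : `|(H (val x)).1 - (H p).1| < 2^-1.
  by near: p; exact: (proj1 (cvgrPdist_lt _ _) cH _ e0).
have [k' kp] := E (exist _ p sp) Up Vp; rewrite /= in kp.
suff -> : k = k' by [].
have : `|(k' - k)%:~R| < 1 :> R.
  rewrite intrB; move: F1 H1; rewrite kx kp/= !ltr_norml; lra.
rewrite -intr_norm -[1]/(1%:~R) ltr_int => kk.
by apply/eqP; rewrite eq_sym -subr_eq0 -normr_le0 -ltzD1 add0r.
Unshelve. all: by end_near. Qed.


Let strip_derive0 (h : R * R -> R^o) p w : differentiable h p -> in_strip p ->
  (forall t, 0 < t < 2^-1 -> in_strip (t *: w + p)) ->
  (\forall q \near p, in_strip q -> h q = 0) -> 'D_w h p = 0.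
Proof.
move=> dh sp wp h0.
have /cvg_dnbhs_at_right D := @diff_derivable _ _ _ h p w dh.
have hp : h p = 0 by exact: (nbhs_singleton h0).
apply: (cvg_unique (@norm_hausdorff _ _) D) => /=.
apply: cvg_trans; last exact: (@cvg_cst R^o 0 R 0^'+ _).
apply: near_eq_cvg => /=.
have cl : (fun t : R => t *: w + p) @ 0^'+ --> p.
  rewrite -[X in _ --> X]add0r -(scale0r w); apply: cvgD; last exact: cvg_cst.
  by apply: cvgZr_tmp; apply: cvg_at_right_filter; exact: cvg_id.
have H0 : \forall t \near 0^'+, in_strip (t *: w + p) -> h (t *: w + p) = 0 := cl _ h0.
near=> t.
have st : in_strip (t *: w + p).
  apply: wp; apply/andP; split; first by near: t; exact: nbhs_right_gt.
  by near: t; exact: nbhs_right_lt.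
rewrite /= hp subr0.
have -> : h (t *: w + p) = 0 by move: st; near: t.
by rewrite scaler0.
Unshelve. all: by end_near. Qed.

Lemma strip_derive (f g : R * R -> R) x b : differentiable f (val x) ->
  differentiable g (val x) ->
  (\forall p \near val x, in_strip p -> f p = g p) ->
  'D_(dir R b) f (val x) = 'D_(dir R b) g (val x).
Proof.
move: (valP x); set p := val x => sp df dg fg.
pose h : R * R -> R^o := f \- g.
have dh : differentiable h p by exact: differentiableB.
have h0 : \forall q \near p, in_strip q -> h q = 0.
  by move: fg; apply: filterS => q fgq /fgq; rewrite /h/= => ->; rewrite subrr.
suff : 'D_(dir R b) h p = 0.
  rewrite /h deriveB; [|exact: diff_derivable..].
  by move/eqP; rewrite subr_eq0 => /eqP.
have [ws|ws] : (forall t, 0 < t < 2^-1 -> in_strip (t *: dir R b + p)) \/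
               (forall t, 0 < t < 2^-1 -> in_strip (t *: - dir R b + p)).
  move: sp; rewrite /in_strip /dir => /andP[]; case: b.
    have [p0|p0] := lerP p.2 0.
      by left => t /= /andP[]; rewrite /GRing.scale/= => ? ?; apply/andP; split; lra.
    by right => t /= /andP[]; rewrite /GRing.scale/= => ? ?; apply/andP; split; lra.
  by left => t /= /andP[]; rewrite /GRing.scale/= => ? ?; apply/andP; split; lra.
- exact: strip_derive0.
- have := strip_derive0 dh sp ws h0.
  by rewrite !deriveE// linearN => /eqP; rewrite oppr_eq0 => /eqP.
Qed.

Let jacE U F p : smooth_on2 U F -> U p ->
  jac F p = 'D_(dir R false) (fun q => (F q).1) p * 'D_(dir R true) (fun q => (F q).2) p
   - 'D_(dir R false) (fun q => (F q).2) p * 'D_(dir R true) (fun q => (F q).1) p.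
Proof.
move=> [s1 s2] Up.
have [_ E] := diff_coord (s1 [::] p Up) (s2 [::] p Up).
by rewrite /jac !E.
Qed.

Lemma jac_lift h x F H : local_lift h x F -> local_lift h x H ->
  `|jac F (val x)| = `|jac H (val x)|.
Proof.
move=> lF lH; have [k kp] := lift_uniq lF lH.
case: lF lH => [U [oU Ux sF FU]] [V [oV Vx sH HV]].
rewrite (jacE sF Ux) (jacE sH Vx).
have F1 := sF.1 [::] _ Ux; have F2 := sF.2 [::] _ Ux.
have H1 := sH.1 [::] _ Vx; have H2 := sH.2 [::] _ Vx; rewrite /= in F1 F2 H1 H2.
set s : R := (-1) ^+ `|k|%N in kp.
have D1 b : 'D_(dir R b) (fun q => (F q).1) (val x) = 'D_(dir R b) (fun q => (H q).1) (val x).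
  rewrite (@strip_derive _ ((fun q => (H q).1) \+ cst (k%:~R)) x)//.
  - by rewrite deriveD ?derive_cst ?addr0//; exact: diff_derivable.
  - exact: differentiableD.
  - by move: kp; apply: filterS => q Fq /Fq ->.
have D2 b : 'D_(dir R b) (fun q => (F q).2) (val x) = s * 'D_(dir R b) (fun q => (H q).2) (val x).
  rewrite (@strip_derive _ (cst s \* (fun q => (H q).2)) x)//.
  - by rewrite deriveM ?derive_cst ?scaler0 ?addr0//; exact: diff_derivable.
  - exact: differentiableM.
  - by move: kp; apply: filterS => q Fq /Fq ->.
rewrite !D1 !D2 mulrCA -mulrA -mulrBr normrM.
by rewrite /s normrX normrN1 expr1n mul1r.
Qed.

Lemma dxdy_diff U F p u v : smooth_on2 U F -> U p ->
  dxdy ('d F p u) ('d F p v) = jac F p * dxdy u v.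
Proof.
move=> [s1 s2] Up; have [dF _] := diff_coord (s1 [::] p Up) (s2 [::] p Up).
rewrite (dir_decomp u) (dir_decomp v) !linearD !linearZ /jac /dxdy /dir/=.
rewrite /GRing.scale/=; ring.
Qed.

Lemma pullback_omega h x F : local_lift h x F ->
  pullback F omega (val x) = omega (val x) <-> `|jac F (val x)| = 1.
Proof.
move=> [U [oU Ux sF _]]; split=> [E|E].
  have := congr1 (fun w => w (dir R false) (dir R true)) E.
  rewrite /pullback /omega (dxdy_diff _ _ sF Ux) mulrA -normrEsg.
  by rewrite /dxdy/= !mulr1 mul0r subr0 mulr1.
apply/funext => u; apply/funext => v.
by rewrite /pullback /omega (dxdy_diff _ _ sF Ux) mulrA -normrEsg E mul1r.
Qed.

Lemma jac_comp U V F G p : smooth_on2 U F -> smooth_on2 V G -> U p -> V (F p) ->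
  jac (G \o F) p = jac G (F p) * jac F p.
Proof.
move=> sF sG Up VFp.
have [dF _] := diff_coord (sF.1 [::] p Up) (sF.2 [::] p Up).
have [dG _] := diff_coord (sG.1 [::] _ VFp) (sG.2 [::] _ VFp).
have E w : 'd (G \o F) p w = 'd G (F p) ('d F p w).
  exact: (congr1 (fun k => k w) (diff_comp dF dG)).
apply: (etrans (congr2 dxdy (E (dir R false)) (E (dir R true)))).
exact: (dxdy_diff _ _ sG VFp).
Qed.

Let jac_id p : jac id p = 1.
Proof.
have E : 'd id p = id :> (R * R -> R * R).
  by rewrite (@diff_lin _ _ _ idfun)//; move=> ?; exact: cvg_id.
by rewrite /jac E /dxdy/= mulr1 mul0r subr0.
Qed.

Local Opaque jac.

Lemma preserves_omegaP h : smooth_map h ->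
  preserves_omega h <-> forall x F, local_lift h x F -> `|jac F (val x)| = 1.
Proof.
move=> sh; split=> P x F lF; first by apply/(pullback_omega lF); exact: P.
by apply/(pullback_omega lF); exact: P.
Qed.

Lemma local_lift_val h x F : local_lift h x F ->
  exists z, val z = F (val x) /\ h (proj x) = proj z.
Proof. by move=> [U [oU Ux sF]]; exact. Qed.

Let jac_lift_comp f g x y F G : local_lift f x F -> local_lift g y G ->
  val y = F (val x) -> jac (G \o F) (val x) = jac G (val y) * jac F (val x).
Proof.
move=> [U [oU Ux sF FU]] [V [oV Vy sG GV]] yFx.
by rewrite (jac_comp sF sG) -?yFx.
Qed.

Let norm1M (a b : R) : `|a| = 1 -> `|b| = 1 -> `|a * b| = 1.
Proof. by rewrite normrM => -> ->; rewrite mulr1. Qed.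

Let norm1MK (a b : R) : `|a| = 1 -> `|a * b| = 1 -> `|b| = 1.
Proof. by rewrite normrM => ->; rewrite mul1r. Qed.

Lemma preserves_omega_comp f g : smooth_map f -> smooth_map g ->
  preserves_omega f -> preserves_omega g -> preserves_omega (g \o f).
Proof.
move=> sf sg /(preserves_omegaP sf) pf /(preserves_omegaP sg) pg.
apply/(preserves_omegaP (smooth_map_comp sf sg)) => x H lH.
have [F lF] := sf x; have [y [yFx _]] := local_lift_val lF; have [G lG] := sg y.
rewrite (jac_lift lH (local_lift_comp lF lG yFx)) (jac_lift_comp lF lG yFx).
exact: norm1M (pg _ _ lG) (pf _ _ lF).
Qed.

Lemma smooth_map_id : smooth_map id.
Proof. by move=> x; exists id; exact: local_lift_id. Qed.

Lemma preserves_omega_id : preserves_omega id.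
Proof.
apply/(preserves_omegaP smooth_map_id) => x F lF.
by rewrite (jac_lift lF (local_lift_id x)) jac_id normr1.
Qed.

Lemma preserves_omega_inv f g : cancel f g -> cancel g f -> smooth_map f ->
  smooth_map g -> preserves_omega f -> preserves_omega g.
Proof.
move=> fg gf sf sg /(preserves_omegaP sf) pf; apply/(preserves_omegaP sg) => x G lG.
have [y [yGx _]] := local_lift_val lG; have [F lF] := sf y.
have E : f \o g = id by apply/funext => m; exact: gf.
have := local_lift_comp lG lF yGx; rewrite E => lid.
have := (preserves_omegaP smooth_map_id).1 preserves_omega_id x _ lid.
rewrite (jac_lift_comp lG lF yGx); exact: norm1MK (pf _ _ lF).
Qed.

Definition diff_omega_rel : set (mobius -> mobius) :=
  [set h | [/\ diffeo h, id_on_boundary h & preserves_omega h]].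

Lemma diff_omega_rel_id : diff_omega_rel id.
Proof.
split=> //; last exact: preserves_omega_id.
by exists id; split=> //; exact: smooth_map_id.
Qed.

Lemma diff_omega_rel_comp f g :
  diff_omega_rel f -> diff_omega_rel g -> diff_omega_rel (f \o g).
Proof.
move=> [[f' [fK f'K sf sf']] bf pf] [[g' [gK g'K sg sg']] bg pg]; split.
- exists (g' \o f'); split; [exact: can_comp|exact: can_comp|..];
    exact: smooth_map_comp.
- by move=> x xb /=; rewrite bg// bf.
- exact: preserves_omega_comp.
Qed.

Lemma diff_omega_rel_inv f : diff_omega_rel f ->
  exists g, [/\ cancel f g, cancel g f & diff_omega_rel g].
Proof.
move=> [[g [fK gK sf sg]] bf pf]; exists g; split => //; split.
- by exists f.
- by move=> x xb; rewrite -{1}(bf x xb) fK.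
- exact: preserves_omega_inv pf.
Qed.
End Mobius.

Section DiffGroup.
Variable R : realType.
Local Notation mobius := (mobius R).
Local Notation strip := (strip R).
Implicit Types (n : nat) (e : R) (K : set (R * R)) (x : strip).

Definition diffOmega : Type := set_type (@diff_omega_rel R).
HB.instance Definition _ := SubChoice.on diffOmega.
Implicit Types f g h : diffOmega.

Let mkD (f : mobius -> mobius) (Hf : diff_omega_rel f) : diffOmega :=
  exist _ f (mem_set Hf).

Let relP f : diff_omega_rel (val f) := set_mem (valP f).

Let inv_ex f := cid (diff_omega_rel_inv (relP f)).

Definition diff_one : diffOmega := mkD (@diff_omega_rel_id R).
Definition diff_mul f g : diffOmega := mkD (diff_omega_rel_comp (relP f) (relP g)).
Definition diff_inv f : diffOmega :=
  mkD (let: And3 _ _ H := projT2 (inv_ex f) in H).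

Let diff_mulA : associative diff_mul.
Proof. by move=> f g h; apply: val_inj. Qed.
Let diff_mul1 : left_id diff_one diff_mul.
Proof. by move=> f; apply: val_inj. Qed.
Let diff_mul1r : right_id diff_one diff_mul.
Proof. by move=> f; apply: val_inj. Qed.
Let diff_mulV : left_inverse diff_one diff_inv diff_mul.
Proof.
move=> f; apply: val_inj; apply/funext => m /=.
by case: (inv_ex f) => g [/= fK gK Hg]; rewrite fK.
Qed.
Let diff_mulVr : right_inverse diff_one diff_inv diff_mul.
Proof.
move=> f; apply: val_inj; apply/funext => m /=.
by case: (inv_ex f) => g [/= fK gK Hg]; rewrite gK.
Qed.

HB.instance Definition _ := isGroup.Build diffOmega
  diff_mulA diff_mul1 diff_mul1r diff_mulV diff_mulVr.

(* The C^oo topology (uniform convergence on compact sets, in charts, of the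
   partial derivatives of all orders) is generated by the sets of the [g] such
   that [jets_close K n e f g], for [K] compact, [n : nat] and [e > 0]. *)
Definition jets_close K n e (f g : mobius -> mobius) : Prop :=
  forall x, K (val x) -> exists F G, [/\ local_lift f x F, local_lift g x G &
    forall s, (size s <= n)%N ->
      `|partial s (fun p => (F p).1) (val x) - partial s (fun p => (G p).1) (val x)| < e /\
      `|partial s (fun p => (F p).2) (val x) - partial s (fun p => (G p).2) (val x)| < e].

Definition cinfty_open (O : set diffOmega) : Prop :=
  forall f, O f -> exists K n e, [/\ compact K, 0 < e &
    forall g, jets_close K n e (val f) (val g) -> O g].

Let cinfty_openT : cinfty_open setT.
Proof. by move=> f _; exists set0, 0%N, 1; split => //; exact: compact0. Qed.

Let jets_closeW K K' n n' e e' (f g : mobius -> mobius) :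
  K `<=` K' -> (n <= n')%N -> e' <= e ->
  jets_close K' n' e' f g -> jets_close K n e f g.
Proof.
move=> KK nn ee h x /KK /h [F [G [lF lG FG]]]; exists F, G; split => // s sn.
have [h1 h2] := FG s (leq_trans sn nn).
by split; exact: lt_le_trans ee.
Qed.

Let cinfty_openI : setI_closed cinfty_open.
Proof.
move=> A B oA oB f [/oA [K [n [e [cK e0 KA]]]] /oB [K' [n' [e' [cK' e'0 KB]]]]].
exists (K `|` K'), (maxn n n'), (Num.min e e'); split.
- exact: compactU.
- by rewrite lt_min e0.
- move=> g fg; split.
    apply: KA; apply: jets_closeW fg; [exact: subsetUl|exact: leq_maxl|].
    by rewrite ge_min lexx.
  apply: KB; apply: jets_closeW fg; [exact: subsetUr|exact: leq_maxr|].
  by rewrite ge_min lexx orbT.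
Qed.

Let cinfty_open_bigU (I : Type) (A : I -> set diffOmega) :
  (forall i, cinfty_open (A i)) -> cinfty_open (\bigcup_i A i).
Proof.
move=> oA f [i _ /oA [K [n [e [cK e0 KA]]]]].
by exists K, n, e; split => // g /KA; exists i.
Qed.

HB.instance Definition _ := isOpenTopological.Build diffOmega
  cinfty_openT cinfty_openI cinfty_open_bigU.

Definition identity_component : set diffOmega := connected_component setT (1%g : diffOmega).

Let jetb n (A : R) (k : R * R -> R) p := forall s, (size s <= n)%N -> `|partial s k p| <= A.

Let jetb_near n U k p : open U -> U p -> smooth_on U k ->
  exists B, \forall q \near p, jetb n B k q.
Proof.
move=> oU Up; elim: n k => [|n IH] k sk.
  exists (`|k p| + 1).
  have ck : {for p, continuous k} by apply: differentiable_continuous; exact: (sk [::]).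
  have ck1 := proj1 (cvgrPdist_lt _ _) ck 1 ltr01.
  near=> q; move=> [|//] _ /=.
  have kq : `|k p - k q| < 1 by near: q; exact: ck1.
  have -> : k q = k p - (k p - k q) by rewrite opprB addrC subrK.
  by apply: (le_trans (ler_normB _ _)); rewrite lerD2l ltW.
have [B0 H0] := IH _ sk.
have [B1 H1] := IH _ (smooth_on_derive false sk).
have [B2 H2] := IH _ (smooth_on_derive true sk).
exists (Num.max B0 (Num.max B1 B2)).
near=> q.
have h0 : jetb n B0 k q by near: q.
have h1 : jetb n B1 ('D_(dir R false) k) q by near: q.
have h2 : jetb n B2 ('D_(dir R true) k) q by near: q.
move=> [|b s] sn; first by rewrite le_max (h0 [::]).
by move: sn; case: b => /= sn; rewrite !le_max ?(h1 s sn) ?(h2 s sn) ?orbT.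
Unshelve. all: by end_near. Qed.

Let strip_closed : closed [set p : R * R | in_strip p].
Proof.
have -> : [set p : R * R | in_strip p] = snd @^-1` `[- 2^-1, 2^-1]%classic.
  by apply/seteqP; split => p /=; rewrite in_itv.
apply: closed_comp; last exact: itv_closed.
by move=> p _; exact: cvg_snd.
Qed.

Let lift_bound K n (g : mobius -> mobius) : compact K -> smooth_map g ->
  exists B : R, forall x, K (val x) -> exists G, [/\ local_lift g x G,
    jetb n B (fun p => (G p).1) (val x) & jetb n B (fun p => (G p).2) (val x)].
Proof.
move=> cK sg.
pose P (B : R) p := forall x, val x = p -> exists G, [/\ local_lift g x G,
    jetb n B (fun p => (G p).1) (val x) & jetb n B (fun p => (G p).2) (val x)].
have : \forall B \near +oo, K `<=` P B.
  move/compact_near_coveringP : cK; apply => p Kp.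
  have [sp|nsp] := boolP (in_strip p); last first.
    have : \forall q \near p, ~ in_strip q.
      apply: open_nbhs_nbhs; split; last exact/negP.
      by apply: closed_openC; exact: strip_closed.
    move=> ns; near=> q B; move=> x xq0; have {xq0} xq : val x = q := xq0; exfalso.
    have : ~ in_strip q by near: q.
    by apply; rewrite -xq; exact: (valP x).
  have [G lG] := sg (exist _ p sp); case: lG => U [oU Ux sG GU].
  have [B1 H1] := jetb_near n oU Ux sG.1.
  have [B2 H2] := jetb_near n oU Ux sG.2.
  pose Q q := [/\ U q, jetb n B1 (fun p => (G p).1) q & jetb n B2 (fun p => (G p).2) q].
  have HQ : \forall q \near p, Q q.
    have H0 : \forall q \near p, U q by exact: open_nbhs_nbhs.
    by near=> q; split; near: q.
  exists (Q, [set B | B1 <= B /\ B2 <= B]) => /=.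
    split => //; near=> B; split; near: B; apply: nbhs_pinfty_ge; exact: num_real.
  move=> [q B] /= [[Uq q1 q2] [b1 b2]] x xq0; have {xq0} xq : val x = q := xq0.
  exists G; split; first by exists U; split => //; rewrite xq.
    by move=> s sn; rewrite xq; exact: le_trans (q1 _ sn) b1.
  by move=> s sn; rewrite xq; exact: le_trans (q2 _ sn) b2.
move=> [M [_ /(_ (M + 1))]] PM; exists (M + 1) => x Kx.
by apply: (PM _ _ Kx) => //; rewrite ltrDl.
Unshelve. all: by end_near. Qed.

Lemma diff_mulr_continuous g : continuous (fun f : diffOmega => (f * g)%g).
Proof.
apply/continuousP => A oA.
suff : cinfty_open ((fun f : diffOmega => (f * g)%g) @^-1` A) by [].
have {}oA : cinfty_open A := oA.
move=> f Afg.
have [K [n [e [cK e0 KA]]]] : exists K n e, [/\ compact K, 0 < e &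
    forall h, jets_close K n e (val (f * g)%g) (val h) -> A h].
  exact: oA.
have sg : smooth_map (val g) by have [[? []]] := relP g.
have [B HB] := lift_bound n cK sg.
have [C [C0 HC]] := jet_comp n B.
pose K' : set (R * R) := `[- B, B] `*` `[- 2^-1, 2^-1].
exists K', n, (e / (C + 1)); split.
- by apply: compact_setX; exact: segment_compact.
- by rewrite divr_gt0// ltr_wpDl.
move=> h fh; apply: KA => x Kx.
have [G [lG G1 G2]] := HB x Kx.
have [z [zG gz]] := local_lift_val lG.
have [|F [H [lF lH FH]]] := fh z.
  rewrite zG; split => /=; rewrite in_itv/=.
    by rewrite -ler_norml; exact: (G1 [::]).
  by rewrite -zG; exact: (valP z).
exists (F \o G), (H \o G); split; [exact: local_lift_comp lF zG|exact: local_lift_comp lH zG|].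
case: lG => U [oU Ux sG _]; case: lF => V [oV Vz sF _]; case: lH => W [oW Wz sH _].
have est (k l : R * R -> R) s : smooth_on V k -> smooth_on W l -> (size s <= n)%N ->
    (forall t, (size t <= n)%N ->
      `|partial t k (val z) - partial t l (val z)| < e / (C + 1)) ->
    `|partial s (k \o G) (val x) - partial s (l \o G) (val x)| < e.
  move=> sk sl sn kl; pose Y := V `&` W; pose X := U `&` G @^-1` Y.
  have oY : open Y by exact: openI.
  have oX : open X by exact: open_preimage.
  have Yz : Y (G (val x)) by rewrite -zG.
  have Xx : X (val x) by [].
  have XY q : X q -> Y (G q) by case.
  have sG' : smooth_on2 X G by split; apply: smooth_onW (sG.1) || apply: smooth_onW (sG.2); move=> q [].
  have sk' : smooth_on Y k by apply: smooth_onW sk => q [].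
  have sl' : smooth_on Y l by apply: smooth_onW sl => q [].
  have [skG slG] := (smooth_on_comp1 oX oY XY sG' sk', smooth_on_comp1 oX oY XY sG' sl').
  rewrite -(partialB s oX skG slG Xx).
  have d0 : 0 <= e / (C + 1) by rewrite divr_ge0 ?addr_ge0// ltW.
  apply: (@le_lt_trans _ _ (C * (e / (C + 1)))).
    apply: (HC X Y G (k \- l) (val x)) => //; first exact: smooth_onB.
    move=> t tn; rewrite (partialB t oY sk' sl' Yz) -zG.
    exact/ltW/kl.
  rewrite mulrCA gtr_pMr// ltr_pdivrMr ?ltr_wpDl// mul1r ltrDl.
  exact: ltr01.
move=> s sn; split.
  by apply: (est _ _ s sF.1 sH.1 sn) => t /FH[].
by apply: (est _ _ s sF.2 sH.2 sn) => t /FH[].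
Qed.

Lemma diffOmega0_closed : group_closed [pred h : diffOmega | h \in identity_component].
Proof.
split; first by apply/mem_set; exact: connected_component_refl.
move=> f g /set_mem fG /set_mem gG; apply/mem_set.
pose r (h : diffOmega) := (h * g^-1)%g.
have : r @` identity_component `<=` identity_component.
  apply: connected_component_max => //.
    by exists g; rewrite // /r mulgV.
  apply: connected_continuous_connected; first exact: component_connected.
  apply: continuous_subspaceT => ?; exact: diff_mulr_continuous.
by apply; exists f.
Qed.

Definition diffOmega0 : Type := set_type identity_component.
HB.instance Definition _ := SubChoice.on diffOmega0.
HB.instance Definition _ := SubChoice_isSubGroup.Build diffOmega _ diffOmega0 diffOmega0_closed.
End DiffGroup.

Section Quasimorphisms.
Variables (R : realType) (G : groupType).
Implicit Types mu : G -> R.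

Definition quasimorphism mu : Prop :=
  exists D : R, 0 <= D /\ forall g h, `|mu (g * h)%g - mu g - mu h| <= D.

Definition expgz (g : G) (k : int) : G :=
  match k with Posz n => (g ^+ n)%g | Negz n => (g ^- n.+1)%g end.

Definition homogeneous mu : Prop :=
  forall g k, mu (expgz g k) = k%:~R * mu g.

Definition homogeneous_quasimorphism mu : Prop :=
  quasimorphism mu /\ homogeneous mu.

Definition linearly_independent (mu : nat -> G -> R) : Prop :=
  forall n (a : 'I_n -> R), (forall g, \sum_(i < n) a i * mu i g = 0) ->
    forall i, a i = 0.

End Quasimorphisms.

(* Main.v *)
From HB Require Import structures.
From mathcomp Require Import all_boot all_order all_algebra.
From mathcomp Require Import generic_quotient.
From mathcomp Require Import all_classical all_reals all_analysis measurable_realfun.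
From mathcomp Require Import ring lra zify.
Require Import Defs.
Set Implicit Arguments.
Unset Strict Implicit.
Unset Printing Implicit Defensive.
Import Order.TTheory GRing.Theory Num.Theory numFieldNormedType.Exports.
Local Open Scope classical_set_scope.
Local Open Scope ring_scope.

Section SL2.
Definition is_sl2 (m : int * int * int * int) : bool :=
  m.1.1.1 * m.2 - m.1.1.2 * m.1.2 == 1.
Definition sl2 : Type := {m : int * int * int * int | is_sl2 m}.
HB.instance Definition _ := Countable.on sl2.
Implicit Types (g h : sl2) (u v p q : int * int).

Let sl2P g : (val g).1.1.1 * (val g).2 - (val g).1.1.2 * (val g).1.2 = 1.
Proof. exact/eqP/(valP g). Qed.

Definition mk_sl2 (a b c d : int) (h : a * d - b * c = 1) : sl2 :=
  exist _ (a, b, c, d) (introT eqP h).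

Fact sl2_one_subproof : 1 * 1 - 0 * 0 = 1 :> int. Proof. by []. Qed.
Definition sl2_one := mk_sl2 sl2_one_subproof.

Fact sl2_mul_subproof g h :
  let: (a, b, c, d) := val g in let: (a', b', c', d') := val h in
  (a * a' + b * c') * (c * b' + d * d') - (a * b' + b * d') * (c * a' + d * c') = 1.
Proof.
move: (sl2P g) (sl2P h); case: (val g) => [[[a b] c] d]; case: (val h) => [[[a' b'] c'] d'] /=.
move=> H H'; rewrite -[RHS](mulr1 1) -{1}H -H'; ring.
Qed.

Definition sl2_mul g h : sl2 :=
  let m := val g in let n := val h in
  insubd sl2_one (m.1.1.1 * n.1.1.1 + m.1.1.2 * n.1.2, m.1.1.1 * n.1.1.2 + m.1.1.2 * n.2,
    m.1.2 * n.1.1.1 + m.2 * n.1.2, m.1.2 * n.1.1.2 + m.2 * n.2).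

Let sl2_mulE g h : val (sl2_mul g h) = let m := val g in let n := val h in
  (m.1.1.1 * n.1.1.1 + m.1.1.2 * n.1.2, m.1.1.1 * n.1.1.2 + m.1.1.2 * n.2,
    m.1.2 * n.1.1.1 + m.2 * n.1.2, m.1.2 * n.1.1.2 + m.2 * n.2).
Proof.
rewrite /sl2_mul insubdK// unfold_in /is_sl2; have := sl2_mul_subproof g h.
case: (val g) => [[[a b] c] d]; case: (val h) => [[[a' b'] c'] d'] /= H.
exact/eqP.
Qed.

Definition sl2_inv g : sl2 :=
  let m := val g in insubd sl2_one (m.2, - m.1.1.2, - m.1.2, m.1.1.1).

Let sl2_invE g : val (sl2_inv g) =
  let m := val g in (m.2, - m.1.1.2, - m.1.2, m.1.1.1).
Proof.
rewrite /sl2_inv insubdK// unfold_in /is_sl2; apply/eqP => /=; rewrite -[RHS](sl2P g); ring.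
Qed.

Let sl2_oneE : val sl2_one = (1, 0, 0, 1). Proof. by []. Qed.
Let sl2_mulA : associative sl2_mul.
Proof.
move=> x y z; apply: val_inj; rewrite !sl2_mulE /=.
by congr (_, _, _, _); ring.
Qed.
Let sl2_mul1 : left_id sl2_one sl2_mul.
Proof.
move=> x; apply: val_inj; rewrite !sl2_mulE ?sl2_oneE /=; case: (val x) => [[[a b] c] d] /=.
by congr (_, _, _, _); ring.
Qed.
Let sl2_mul1r : right_id sl2_one sl2_mul.
Proof.
move=> x; apply: val_inj; rewrite !sl2_mulE ?sl2_oneE /=; case: (val x) => [[[a b] c] d] /=.
by congr (_, _, _, _); ring.
Qed.
Let sl2_mulV : left_inverse sl2_one sl2_inv sl2_mul.
Proof.
move=> x; apply: val_inj; rewrite !sl2_mulE sl2_invE sl2_oneE.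
by congr (_, _, _, _); rewrite -?[in RHS](sl2P x) /=; ring.
Qed.
Let sl2_mulVr : right_inverse sl2_one sl2_inv sl2_mul.
Proof.
move=> x; apply: val_inj; rewrite !sl2_mulE sl2_invE sl2_oneE.
by congr (_, _, _, _); rewrite -?[in RHS](sl2P x) /=; ring.
Qed.
HB.instance Definition _ := isGroup.Build sl2
  sl2_mulA sl2_mul1 sl2_mul1r sl2_mulV sl2_mulVr.

Definition act g v : int * int :=
  ((val g).1.1.1 * v.1 + (val g).1.1.2 * v.2, (val g).1.2 * v.1 + (val g).2 * v.2).

Definition det u v : int := u.1 * v.2 - u.2 * v.1.

Let sl2_mulgE g h : val (g * h)%g = let m := val g in let n := val h in
  (m.1.1.1 * n.1.1.1 + m.1.1.2 * n.1.2, m.1.1.1 * n.1.1.2 + m.1.1.2 * n.2,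
    m.1.2 * n.1.1.1 + m.2 * n.1.2, m.1.2 * n.1.1.2 + m.2 * n.2).
Proof. exact: sl2_mulE. Qed.
Let sl2_invgE g : val (g^-1)%g =
  let m := val g in (m.2, - m.1.1.2, - m.1.2, m.1.1.1).
Proof. exact: sl2_invE. Qed.

Lemma actM g h v : act (g * h)%g v = act g (act h v).
Proof. rewrite /act sl2_mulgE; congr pair => /=; ring. Qed.
Lemma act1 v : act 1%g v = v.
Proof. rewrite /act /=; case: v => a b /=; congr pair; ring. Qed.
Lemma actN g v : act g (- v) = - act g v.
Proof. rewrite /act /=; congr pair => /=; ring. Qed.
Lemma actVK g v : act g^-1%g (act g v) = v.
Proof. by rewrite -actM mulVg act1. Qed.
Lemma actKV g v : act g (act g^-1%g v) = v.
Proof. by rewrite -actM mulgV act1. Qed.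
Lemma det_act g u v : det (act g u) (act g v) = det u v.
Proof. rewrite /det /act -[RHS]mul1r -(sl2P g) /=; ring. Qed.

(* an element of order 4: a half-turn of the hyperbolic plane *)
Definition half_turn g : Prop := forall v, act g (act g v) = - v.

Lemma half_turnV g v : half_turn g -> act g^-1%g v = - act g v.
Proof. by move=> H; rewrite -{1}[v](opprK) -(H v) actN actVK. Qed.

Lemma half_turn_inv g : half_turn g -> half_turn g^-1%g.
Proof. by move=> H v; rewrite !half_turnV// actN opprK. Qed.

Lemma half_turn_conj g h : half_turn g -> half_turn (h * g * h^-1)%g.
Proof. by move=> H v; rewrite !actM actVK H actN actKV. Qed.

Definition slope v : rat := v.1%:~R / v.2%:~R.

Lemma slopeN v : slope (- v) = slope v.
Proof. by rewrite /slope /= !rmorphN/= invrN mulrNN. Qed.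

Definition same u v : Prop := u = v \/ u = - v.
Lemma same_refl u : same u u. Proof. by left. Qed.
Lemma same_sym u v : same u v -> same v u.
Proof. by case=> ->; [left|right; rewrite opprK]. Qed.
Lemma same_trans u v w : same u v -> same v w -> same u w.
Proof. by move=> [->|->] [->|->]; rewrite ?opprK; [left|right|right|left]. Qed.
Lemma same_act g u v : same u v -> same (act g u) (act g v).
Proof. by case=> ->; rewrite ?actN; [left|right]. Qed.
Lemma same_slope u v : same u v -> slope u = slope v.
Proof. by case=> -> //; rewrite slopeN. Qed.
Lemma same_fin u v : same u v -> (u.2 != 0) = (v.2 != 0).
Proof. by case=> -> //=; rewrite oppr_eq0. Qed.

Let quad p q v : int := det v p * det v q * (p.2 * q.2).

Let quadE p q v : p.2 != 0 -> q.2 != 0 -> v.2 != 0 ->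
  (quad p q v)%:~R = (v.2 * p.2 * q.2)%:~R ^+ 2 * ((slope v - slope p) * (slope v - slope q)).
Proof.
rewrite -(intr_eq0 rat) -(intr_eq0 rat q.2) -(intr_eq0 rat v.2) /quad /det /slope.
rewrite !(rmorphM, rmorphB)/=.
move: p.1%:~R p.2%:~R q.1%:~R q.2%:~R v.1%:~R v.2%:~R => p1 p2 q1 q2 v1 v2 p0 q0 v0.
by field; apply/and3P.
Qed.

Let quad_inf p q v : p.2 != 0 -> q.2 != 0 -> v != 0 -> v.2 = 0 -> 0 < quad p q v.
Proof.
move=> p0 q0 v0 v20; rewrite /quad /det v20 !mul0r !subr0.
have v1 : v.1 != 0.
  by apply: contraNneq v0 => v10; case: (v) v10 v20 => /= a b -> ->.
have -> : v.1 * p.2 * (v.1 * q.2) * (p.2 * q.2) = (v.1 * p.2 * q.2) ^+ 2 by ring.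
by rewrite lt_neqAle sqr_ge0 eq_sym expf_neq0 ?mulf_neq0.
Qed.

Let quad_turn g p v : half_turn g -> quad p (act g p) (act g v) = - quad p (act g p) v.
Proof.
move=> H; rewrite /quad.
have -> : det (act g v) (act g p) = det v p by exact: det_act.
have -> : det (act g v) p = - det v (act g p).
  rewrite -[p in LHS](opprK p) -(H p) -(det_act g v (act g p)) /det/=; ring.
ring.
Qed.

Lemma act_neq0 g v : v != 0 -> act g v != 0.
Proof.
apply: contraNneq => E; rewrite -(actVK g v) E /act/=; apply/eqP; congr pair; ring.
Qed.

Let quad_ltP p q v : p.2 != 0 -> q.2 != 0 -> slope p < slope q -> v != 0 ->
  quad p q v < 0 -> v.2 != 0 /\ slope p < slope v < slope q.
Proof.
move=> p0 q0 pq v0 H; have v20 : v.2 != 0.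
  by apply/eqP => v20; move: (quad_inf p0 q0 v0 v20); rewrite ltNge ltW.
split=> //; move: H; rewrite -(ltrz0 rat) quadE// pmulr_rlt0; last first.
  by rewrite lt_neqAle sqr_ge0 eq_sym expf_neq0// intr_eq0 !mulf_neq0.
move=> H; apply/andP; split; nra.
Qed.

Let quad_leP p q v : p.2 != 0 -> q.2 != 0 -> slope p < slope q -> v != 0 ->
  quad p q v <= 0 -> v.2 != 0 /\ slope p <= slope v <= slope q.
Proof.
move=> p0 q0 pq v0 H; have v20 : v.2 != 0.
  by apply/eqP => v20; move: (quad_inf p0 q0 v0 v20); rewrite ltNge H.
split=> //; move: H; rewrite -(lerz0 rat) quadE// pmulr_rle0; last first.
  by rewrite lt_neqAle sqr_ge0 eq_sym expf_neq0// intr_eq0 !mulf_neq0.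
move=> H; apply/andP; split; nra.
Qed.

(* A half-turn exchanging two boundary points exchanges the two arcs that
   they bound. *)
Lemma turn_lt g p v : half_turn g -> p.2 != 0 -> (act g p).2 != 0 ->
  slope p < slope (act g p) -> v != 0 ->
  (v.2 != 0 -> slope v < slope p \/ slope (act g p) < slope v) ->
  (act g v).2 != 0 /\ slope p < slope (act g v) < slope (act g p).
Proof.
move=> H p0 q0 pq v0 out; apply: quad_ltP => //; first exact: act_neq0.
rewrite quad_turn// oppr_lt0.
have [v20|v20] := eqVneq v.2 0; first exact: quad_inf.
rewrite -(ltr0z rat) quadE// pmulr_rgt0; last first.
  by rewrite lt_neqAle sqr_ge0 eq_sym expf_neq0// intr_eq0 !mulf_neq0.
by case: (out v20) => ?; nra.
Qed.

Lemma turn_le g p v : half_turn g -> p.2 != 0 -> (act g p).2 != 0 ->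
  slope p < slope (act g p) -> v != 0 ->
  (v.2 != 0 -> slope v <= slope p \/ slope (act g p) <= slope v) ->
  (act g v).2 != 0 /\ slope p <= slope (act g v) <= slope (act g p).
Proof.
move=> H p0 q0 pq v0 out; apply: quad_leP => //; first exact: act_neq0.
rewrite quad_turn// oppr_le0.
have [v20|v20] := eqVneq v.2 0; first exact/ltW/quad_inf.
rewrite -(ler0z rat) quadE// pmulr_rge0; last first.
  by rewrite lt_neqAle sqr_ge0 eq_sym expf_neq0// intr_eq0 !mulf_neq0.
by case: (out v20) => ?; nra.
Qed.

(* translation by k and the half-turn exchanging k and k+1 *)
Fact trans_subproof (k : int) : 1 * 1 - k * 0 = 1. Proof. by rewrite mulr0 subr0. Qed.
Definition trans k : sl2 := mk_sl2 (trans_subproof k).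

Lemma act_trans k v : act (trans k) v = (v.1 + k * v.2, v.2).
Proof. by rewrite /act/=; congr pair; ring. Qed.

Lemma slope_trans k v : v.2 != 0 -> slope (act (trans k) v) = slope v + k%:~R.
Proof.
move=> v0; rewrite act_trans /slope/= rmorphD rmorphM/=.
move: v0; rewrite -(intr_eq0 rat); move: v.1%:~R v.2%:~R => a b b0.
by field.
Qed.

Fact turn_subproof (k : int) :
  (- (2 * k + 1)) * (2 * k + 1) - (2 * (k * k) + 2 * k + 1) * (- 2) = 1.
Proof. ring. Qed.
Definition turn k : sl2 := mk_sl2 (turn_subproof k).

Lemma half_turn_turn k : half_turn (turn k).
Proof. by move=> v; rewrite /act/=; congr pair => /=; ring. Qed.
Lemma act_turn k : act (turn k) (k, 1) = (k + 1, 1).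
Proof. by rewrite /act/=; congr pair => /=; ring. Qed.

Lemma turn_trans k d : turn (k + d) = (trans d * turn k * (trans d)^-1)%g.
Proof.
apply: val_inj; rewrite !sl2_mulgE !sl2_invgE /=.
by congr (_, _, _, _); ring.
Qed.
End SL2.

Section QProd.
Variable G : groupType.
Implicit Types (f : int -> G) (m : int) (k : nat).
Fixpoint qpos f k : G := if k is k'.+1 then (qpos f k' * f k')%g else 1%g.
Fixpoint qneg f k : G :=
  if k is k'.+1 then (qneg f k' * (f (Negz k'))^-1)%g else 1%g.
Definition qprod f m := match m with Posz k => qpos f k | Negz k => qneg f k.+1 end.

Lemma qprodS f m : qprod f (m + 1) = (qprod f m * f m)%g.
Proof.
case: m => [k|[|k]].
- by rewrite (_ : Posz k + 1 = Posz k.+1)//; lia.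
- by rewrite /= mul1g mulVg.
- rewrite (_ : Negz k.+1 + 1 = Negz k); last by lia.
  by rewrite /= mulgVK.
Qed.

Lemma qprod_uniq f (t : int -> G) : (forall m, t (m + 1) = (t m * f m)%g) ->
  forall m, t m = (t 0 * qprod f m)%g.
Proof.
move=> tS; elim/int_rect => [|k IH|k IH]; first by rewrite mulg1.
  by rewrite (_ : Posz k.+1 = Posz k + 1) ?tS ?IH ?qprodS ?mulgA//; lia.
have := tS (- (k.+1)%:Z); have := qprodS f (- (k.+1)%:Z).
rewrite (_ : - (k.+1)%:Z + 1 = - k%:Z); last by lia.
move=> E1; rewrite IH E1 mulgA => E2; symmetry.
exact: mulIg E2.
Qed.
End QProd.

Section Rows.
Variables (G : groupType) (n : nat).
Notation row := 'I_n.
Notation vec := (row -> int).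
Notation rep := (row -> int -> G).
Implicit Types (a b : row) (s t w : seq row) (v : vec) (R rho : rep).

Definition raise v a : vec := fun b => v b + (b == a)%:Z.

Lemma raiseC v a b : raise (raise v a) b = raise (raise v b) a.
Proof. by apply/funext => c; rewrite /raise addrAC. Qed.

Fixpoint transport s R v : G :=
  if s is a :: s' then (qprod (R a) (v a) * transport s' R v)%g else 1%g.

Fixpoint lower a s : seq row :=
  if s is b :: s' then if a == b then s' else lower a s' else [::].

Lemma transport_ext s R R' v v' : {in s, forall a, R a = R' a} ->
  {in s, forall a, v a = v' a} -> transport s R v = transport s R' v'.
Proof.
elim: s => //= a s IH HR Hv; rewrite (HR a) ?mem_head// (Hv a) ?mem_head// IH//.
  by move=> b bs; apply: HR; rewrite inE bs orbT.
by move=> b bs; apply: Hv; rewrite inE bs orbT.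
Qed.

Lemma lower_sub a s b : b \in lower a s -> b \in s.
Proof.
elim: s => //= c s IH; case: ifP => _; first by rewrite inE => ->; rewrite orbT.
by move=> /IH; rewrite inE => ->; rewrite orbT.
Qed.

Lemma lower_notin a s : uniq s -> a \notin lower a s.
Proof.
elim: s => //= c s IH /andP[cs us]; case: ifP => [/eqP ->//|_]; exact: IH.
Qed.

Lemma lower_antisym a b s : uniq s -> a \in lower b s -> b \notin lower a s.
Proof.
elim: s => //= c s IH /andP[cs us]; case: (eqVneq b c) => [->|bc].
  move=> as_; case: ifP => [/eqP E|_]; first by rewrite -E as_ in cs.
  by apply: contra cs; exact: lower_sub.
case: (eqVneq a c) => [->|ac]; last exact: IH.
by move=> /lower_sub; rewrite (negbTE cs).
Qed.

(* the loop around the copies of row a seen from the gaps v of the lower rows *)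
Definition jump s R a v : G :=
  let q := transport (lower a s) R v in (q^-1 * R a (v a) * q)%g.

Lemma transport_raise s R v a : uniq s -> a \in s ->
  transport s R (raise v a) = (transport s R v * jump s R a v)%g.
Proof.
rewrite /jump; elim: s => //= c s IH /andP[cs us]; rewrite inE.
case: (eqVneq a c) cs => [-> /= as_ _|ac cs /= as_].
  rewrite {1}/raise eqxx /= (qprodS (R c)).
  have -> : transport s R (raise v c) = transport s R v.
    apply: transport_ext => // b bs; rewrite /raise; case: eqVneq => [ba|_]; last by rewrite addr0.
    by rewrite -ba bs in as_.
  by rewrite !mulgA mulgK.
by rewrite IH// {1}/raise eq_sym (negbTE ac) addr0 !mulgA.
Qed.

Lemma jump_raise s R v a b : b != a -> b \notin lower a s ->
  jump s R a (raise v b) = jump s R a v.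
Proof.
move=> ba bl; rewrite /jump.
have -> : transport (lower a s) R (raise v b) = transport (lower a s) R v.
  apply: transport_ext => // c cs; rewrite /raise; case: eqVneq => [E|_]; last by rewrite addr0.
  by rewrite -E cs in bl.
by rewrite /raise eq_sym (negbTE ba) addr0.
Qed.

(* the vertical gauge and back *)
Variable M : row -> vec.
Definition lab a m : vec := fun b => M a b + m.

Fixpoint build s rho : rep :=
  if s is a :: s' then fun b m => if b == a then
    let q := transport s' (build s' rho) (lab a m) in (q * rho a m * q^-1)%g
    else build s' rho b m
  else fun _ _ => 1%g.

Definition extract s R : rep := fun a m =>
  let q := transport (lower a s) R (lab a m) in (q^-1 * R a m * q)%g.

Lemma build_lower s rho a b m : uniq s -> b \in lower a s ->
  build s rho b m = build (lower a s) rho b m.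
Proof.
elim: s => //= c s IH /andP[cs us].
case: (eqVneq a c) => [_ bs|ac bl]; first by case: eqVneq bs cs => // -> ->.
have bs := lower_sub bl.
by case: eqVneq bs cs bl => [-> ->//|_ _ _ bl]; exact: IH.
Qed.

Lemma build_head s rho a m : uniq s -> a \in s -> build s rho a m =
  let q := transport (lower a s) (build s rho) (lab a m) in (q * rho a m * q^-1)%g.
Proof.
move=> us as_; rewrite (@transport_ext _ (build s rho) (build (lower a s) rho) _ (lab a m))//; last first.
  by move=> b bl; apply/funext => k; exact: build_lower.
elim: s us as_ => //= c s IH /andP[cs us]; rewrite inE.
by case: (eqVneq a c) => /= [->//|ac as_]; exact: IH.
Qed.

Lemma buildK s rho a m : uniq s -> a \in s -> extract s (build s rho) a m = rho a m.
Proof.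
move=> us as_; rewrite /extract (build_head rho m us as_)/=.
by rewrite !mulgA mulVg mul1g mulgVK.
Qed.

Lemma extractK s R a m : uniq s -> a \in s -> build s (extract s R) a m = R a m.
Proof.
move=> us as_.
have H : forall t, uniq t -> {in t, forall b, lower b t = lower b s} ->
    {in t, forall b, build t (extract s R) b = R b}.
  elim=> //= c t IH /andP[ct ut] lt.
  have lt' : {in t, forall b, lower b t = lower b s}.
    move=> b bt; rewrite -lt ?inE ?bt ?orbT//.
    by case: eqVneq bt ct => // -> ->.
  move=> b; rewrite inE => bt; apply/funext => k.
  case: (eqVneq b c) bt => [-> _|_ /= bt]; last by rewrite IH.
  have := lt c (mem_head _ _); rewrite eqxx => E.
  rewrite (@transport_ext t _ R _ (lab c k))//; last by move=> d dt; exact: IH.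
  by rewrite /extract -E /= !mulgA mulgV mul1g mulgK.
by rewrite H.
Qed.

End Rows.

Section Development.
Variable n : nat.
Notation row := 'I_n.
Notation vec := (row -> int).
Notation rep := (row -> int -> sl2).
Implicit Types (a b : row) (s t w : seq row) (v : vec) (R rho : rep).

Section Develop.
Variables (s : seq row) (R : rep) (l : int * int).
Hypotheses (us : uniq s) (als : forall a, a \in s) (hR : forall a m, half_turn (R a m)).
Hypothesis l0 : l != 0.

Definition dev v : int * int := act (transport s R v)^-1%g l.

Lemma dev_raise v a : dev (raise v a) = act (jump s R a v)^-1%g (dev v).
Proof. by rewrite /dev transport_raise// invgM actM. Qed.

Lemma dev_neq0 v : dev v != 0. Proof. exact: act_neq0. Qed.

Lemma half_turn_jump a v : half_turn (jump s R a v).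
Proof. by rewrite /jump -[X in half_turn (_ * X)%g]invgK; exact: half_turn_conj. Qed.

Definition incr v a : Prop := [/\ (dev v).2 != 0, (dev (raise v a)).2 != 0 &
  slope (dev v) < slope (dev (raise v a))].

Lemma incr_square v a b : a != b -> incr v b -> incr (raise v b) a ->
  incr v a /\ incr (raise v a) b.
Proof.
move=> ab [f1 f2 lt1] [_ f3 lt2]; rewrite /incr raiseC.
have [bla|bla] := boolP (b \in lower a s); last first.
  rewrite eq_sym in ab; have E := jump_raise R v ab bla.
  have ht : half_turn (jump s R a v)^-1%g by apply: half_turn_inv; exact: half_turn_jump.
  rewrite dev_raise E in f3 lt2.
  have [f4 /andP[lt3 lt4]] := turn_lt ht f2 f3 lt2 (dev_neq0 v) (fun _ => or_introl lt1).
  rewrite -dev_raise in f4 lt3 lt4; rewrite (dev_raise (raise v b)) E.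
  by do ![split=> //]; exact: lt_trans lt3.
have alb : a \notin lower b s by exact: lower_antisym.
have E := jump_raise R v ab alb.
have ht : half_turn (jump s R b v)^-1%g by apply: half_turn_inv; exact: half_turn_jump.
rewrite dev_raise in f2 lt1 lt2.
have E3 : act (jump s R b v)^-1%g (dev (raise (raise v b) a)) = - dev (raise v a).
  by rewrite raiseC dev_raise E ht.
have [] := turn_lt ht f1 f2 lt1 (dev_neq0 (raise (raise v b) a)) (fun _ => or_intror lt2).
rewrite E3 slopeN /= oppr_eq0 => f4 /andP[lt3 lt4].
by do ![split=> //]; exact: lt_trans lt2.
Qed.

Fixpoint incr_path v w : Prop :=
  if w is a :: w' then incr v a /\ incr_path (raise v a) w' else True.
Definition raises v w : vec := foldl (@raise n) v w.

Lemma raisesE v w b : raises v w b = v b + (count_mem b w)%:Z.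
Proof.
rewrite /raises; elim: w v => [|a w IH] v /=; first by rewrite addr0.
by rewrite IH /raise PoszD addrA [b == a]eq_sym.
Qed.

Lemma incr_path_cat v w w' :
  incr_path v (w ++ w') <-> incr_path v w /\ incr_path (raises v w) w'.
Proof.
elim: w v => [|a w IH] v /=; first by split => [|[]].
by split=> [[h /IH[]]|[[h1 h2] h3]]; do ?split=> //; apply/IH.
Qed.

Lemma incr_path_front v u a w : incr_path v (u ++ a :: w) -> incr_path v (a :: u ++ w).
Proof.
elim: u v => // b u IH v /= [vb /IH[vba vp]].
case: (eqVneq a b) vba vp => [-> //|ab vba vp].
by have [va vab] := incr_square ab vb vba; rewrite raiseC.
Qed.

Lemma incr_path_perm v w w' : perm_eq w w' -> incr_path v w -> incr_path v w'.
Proof.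
elim: w' v w => [|a w' IH] v w; first by move=> /perm_nilP ->.
move=> pw; have : a \in w by rewrite (perm_mem pw) mem_head.
move=> /splitPr aw; case: aw pw => w1 w2; rewrite -cat1s perm_catCA perm_cons => pw.
by move=> /incr_path_front/=[va vp]; split=> //; exact: IH pw vp.
Qed.

Lemma raises_to v v' : (forall b, v b <= v' b) -> exists w, raises v w = v'.
Proof.
move=> vv'; have [k] : exists k, k = (\sum_b `|v' b - v b|)%N by eexists.
elim: k v vv' => [|k IH] v vv' E.
  exists [::]; apply/funext => b /=.
  have : (`|v' b - v b| <= 0)%N by rewrite E (bigD1 b)//= leq_addr.
  by have := vv' b; lia.
have [b vb] : exists b, v b < v' b.
  apply: contrapT => /forallNP H; have : (k.+1 <= 0)%N; last by [].
  by rewrite E big1// => b _; have := H b; have := vv' b; lia.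
have [|//|w Hw] := IH (raise v b); last by exists (b :: w).
  by move=> c; rewrite /raise; case: eqVneq => [->|_]; have := vv' c; lia.
apply/eqP; rewrite -eqSS E (bigD1 b)//= [in X in _ == X](bigD1 b)//=.
rewrite -addSn; apply/eqP; congr (_ + _)%N; first by rewrite /raise eqxx; lia.
by apply: eq_bigr => c cb; rewrite /raise (negbTE cb) addr0.
Qed.

(* along one increasing path, hence along all of them *)
Lemma incr_all v a : (exists v1 w, [/\ incr_path v1 w, forall b, v1 b <= v b &
  forall b, raise v a b <= raises v1 w b]) -> incr v a.
Proof.
move=> [v1 [w [ip le1 le2]]].
have [w1 E1] := raises_to le1; have [w2 E2] := raises_to le2.
have E : raises v1 (w1 ++ a :: w2) = raises v1 w.
  by rewrite -E2 /raises foldl_cat/= -/(raises v1 w1) E1.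
have /incr_path_perm/(_ ip) : perm_eq w (w1 ++ a :: w2).
  apply/allP => b _; apply/eqP; have := congr1 (fun f => f b) E.
  by rewrite !raisesE; lia.
by move=> /incr_path_cat[_ /=[]]; rewrite E1.
Qed.

Lemma incr_mono : (forall v a, incr v a) -> forall v v', (forall b, v b <= v' b) ->
  slope (dev v) <= slope (dev v').
Proof.
move=> inc v v' /raises_to[w <-]; elim: w v => //= a w IH v.
by have [_ _ /ltW/le_trans] := inc v a; apply; exact: IH.
Qed.
End Develop.

Lemma half_turn_build (M : row -> vec) s rho a m : uniq s -> a \in s -> (forall a m, half_turn (rho a m)) ->
  half_turn (build M s rho a m).
Proof. by move=> us as_ h; rewrite build_head//; exact: half_turn_conj. Qed.
End Development.

Section Period.
Variables (G : groupType) (n : nat).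
Notation row := 'I_n.
Notation vec := (row -> int).
Notation rep := (row -> int -> G).
Variable g : G.
Implicit Types (s : seq row) (v : vec) (rho R : rep) (M : row -> vec).

Definition equivariant rho : Prop := forall a m, rho a (m + 1) = (g * rho a m * g^-1)%g.
Definition shift1 v : vec := fun b => v b + 1.

Lemma qprod_conj (f : int -> G) k m : (forall j, f (j + 1) = (k * f j * k^-1)%g) ->
  qprod f (m + 1) = (f 0 * k * qprod f m * k^-1)%g.
Proof.
move=> fk; pose t m := (k^-1 * (f 0)^-1 * qprod f (m + 1) * k)%g.
have tS j : t (j + 1) = (t j * f j)%g.
  by rewrite /t (qprodS _ (j + 1)) fk !mulgA !mulgVK.
have := qprod_uniq tS m; rewrite /t /= mul1g mulgVK mulVg mul1g => <-.
by rewrite !mulgA !mulgK mulgV mul1g.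
Qed.

Lemma transport_period s M rho : uniq s -> equivariant rho ->
  exists c, forall v, transport s (build M s rho) (shift1 v) =
    (c * g * transport s (build M s rho) v * g^-1)%g.
Proof.
move=> us er; elim: s us => [_|a s IH us0].
  by exists 1%g => v /=; rewrite mul1g mulg1 mulgV.
have /andP[as_ us] := us0; have [c cP] := IH us.
set R := build M s rho in cP *; set R' := build M (a :: s) rho.
have E v : transport s R' v = transport s R v.
  apply: transport_ext => // b bs; apply/funext => m; rewrite /R' /=.
  by case: eqVneq bs as_ => // -> ->.
pose f m := (transport s R (lab M a m) * rho a m * (transport s R (lab M a m))^-1)%g.
have fE : R' a = f by apply/funext => m; rewrite /R' /= eqxx.
have fS m : f (m + 1) = ((c * g) * f m * (c * g)^-1)%g.
  rewrite /f; have -> : lab M a (m + 1) = shift1 (lab M a m).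
    by apply/funext => b; rewrite /lab /shift1 addrA.
  by rewrite cP er !invgM invgK !mulgA !mulgVK.
have S v : transport (a :: s) R' v = (qprod f (v a) * transport s R v)%g.
  by rewrite -fE -E.
exists (f 0 * c)%g => v; rewrite !S (qprod_conj _ fS) cP !invgM !mulgA.
by rewrite !mulgVK.
Qed.

Lemma extract_equivariant s M M' rho : uniq s -> (forall a, a \in s) -> equivariant rho ->
  equivariant (extract M' s (build M s rho)).
Proof.
move=> us als er a m; rewrite /extract.
set R := build M s rho.
have uL : uniq (lower a s).
  elim: s us {als R} => //= b s IH /andP[_ us]; case: ifP => // _; exact: IH.
have E v : transport (lower a s) R v = transport (lower a s) (build M (lower a s) rho) v.
  by apply: transport_ext => // b bs; apply/funext => k; exact: build_lower.
have [c cP] := transport_period M uL er.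
have Sh M0 k : lab M0 a (k + 1) = shift1 (lab M0 a k).
  by apply/funext => b; rewrite /lab /shift1 addrA.
rewrite /R !build_head// -/R /= !E !Sh !cP er !invgM !invgK !mulgA.
by rewrite !mulgVK.
Qed.
End Period.

Section Locations.
Variable (R : realType) (n : nat).
Notation row := 'I_n.
Notation vec := (row -> int).
Notation config := (row -> R * R).
Definition loc : Type := (R *l (R *l nat))%type.
Implicit Types (X : config) (a b : row) (x : loc) (m : int).

Definition tie X b : (R *l nat)%type := (- (X b).2, nat_of_ord b).
Definition copy X b m : loc := ((X b).1 + 2 * m%:~R, tie X b).
Definition cnt X b x : int :=
  let d := (x.1 - (X b).1) / 2 in
  if (tie X b < x.2)%O then Num.floor d + 1 else Num.ceil d.

Lemma lt_locE (x y : R) (s t : (R *l nat)%type) :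
  ((x, s) < (y, t) :> loc)%O = (x <= y) && ((y <= x) ==> (s < t)%O).
Proof. exact: (@ltxi_pair _ _ _ R (R *l nat)%type). Qed.
Lemma le_locE (x y : R) (s t : (R *l nat)%type) :
  ((x, s) <= (y, t) :> loc)%O = (x <= y) && ((y <= x) ==> (s <= t)%O).
Proof. exact: (@lexi_pair _ _ _ R (R *l nat)%type). Qed.

Lemma cntP X b x m : (m < cnt X b x) = (copy X b m < x)%O.
Proof.
case: x => x t; rewrite /cnt /copy lt_locE.
have d_ge (k : R) : ((X b).1 + 2 * k <= x) = (k <= (x - (X b).1) / 2).
  by apply/idP/idP => ?; lra.
have d_le (k : R) : (x <= (X b).1 + 2 * k) = ((x - (X b).1) / 2 <= k).
  by apply/idP/idP => ?; lra.
rewrite [(x, t).1]/fst [(x, t).2]/snd; case: (tie X b < t)%O.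
  by rewrite implybT andbT d_ge ltzD1 floor_ge_int.
rewrite implybF d_ge d_le -ceil_le_int -ltNge.
apply/idP/idP; last by case/andP.
by move=> h; rewrite h andbT; apply: ltW; rewrite ltNge -ceil_le_int -ltNge.
Qed.

Lemma int_ltP (p q : int) : (forall k, (k < p) = (k < q)) -> p = q.
Proof. by move=> h; have := h p; have := h q; rewrite !ltxx => h1 h2; lia. Qed.

Definition gaps X x : vec := fun b => cnt X b x.
Definition mat X a : vec := gaps X (copy X a 0).

Lemma copy_ltD X b k a m d : (copy X b (k + d) < copy X a (m + d))%O = (copy X b k < copy X a m)%O.
Proof.
rewrite /copy !lt_locE !rmorphD.
have -> : ((X b).1 + 2 * (k%:~R + d%:~R) <= (X a).1 + 2 * (m%:~R + d%:~R))%R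
        = ((X b).1 + 2 * k%:~R <= (X a).1 + 2 * m%:~R) by apply/idP/idP => ?; lra.
by have -> : ((X a).1 + 2 * (m%:~R + d%:~R) <= (X b).1 + 2 * (k%:~R + d%:~R))%R
        = ((X a).1 + 2 * m%:~R <= (X b).1 + 2 * k%:~R) by apply/idP/idP => ?; lra.
Qed.

Lemma gaps_copy X a m : gaps X (copy X a m) = lab (mat X) a m.
Proof.
apply/funext => b; rewrite /lab /mat /gaps; apply: int_ltP => k.
have -> : (k < cnt X b (copy X a 0) + m) = (k - m < cnt X b (copy X a 0)) by lia.
by rewrite !cntP -(copy_ltD X b (k - m) a 0 m) subrK add0r.
Qed.

Lemma gaps_mono X x x' b : (x <= x')%O -> gaps X x b <= gaps X x' b.
Proof.
move=> xx'; rewrite leNgt cntP; apply/negP => h.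
by have := lt_le_trans h xx'; rewrite -cntP ltxx.
Qed.

Lemma mat_diag X a : mat X a a = 0.
Proof.
by rewrite /mat /gaps /cnt /copy/= ltxx mulr0 addr0 subrr mul0r ceil0.
Qed.

Lemma copy_neq X a b m k : a != b -> copy X a m != copy X b k.
Proof.
by move=> ab; apply/eqP => -[_ _ /val_inj E]; rewrite E eqxx in ab.
Qed.

Lemma gaps_step X x x' : (x <= x')%O -> gaps X x <> gaps X x' ->
  exists a m, (x <= copy X a m < x')%O /\ gaps X x' = raise (lab (mat X) a m) a.
Proof.
move=> xx' ne.
pose P b := gaps X x b < gaps X x' b.
pose top b := copy X b (gaps X x' b - 1).
have top_lt b : (top b < x')%O by rewrite -cntP -/(gaps X x' b); lia.
have top_ge b : P b -> (x <= top b)%O.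
  by rewrite /P leNgt -cntP -/(gaps X x b) => ?; lia.
have [b0 Pb0] : exists b, P b.
  apply: contrapT => /forallNP h; apply: ne; apply/funext => b.
  by have := gaps_mono X b xx'; have := h b; rewrite /P; lia.
have := @extremumP _ _ (fun x y : loc => (y <= x)%O) b0 P top.
case=> //.
- by move=> ? ? ? h1 h2; exact: le_trans h2 h1.
- by move=> ? ?; exact: le_total.
move=> a Pa amax; exists a, (gaps X x' a - 1); split.
  by rewrite top_ge//= top_lt.
rewrite -gaps_copy -/(top a); apply/funext => b; rewrite /raise.
case: (eqVneq b a) => [->|ba].
  by rewrite /top gaps_copy /lab mat_diag; lia.
rewrite addr0; apply/eqP; rewrite eq_le; apply/andP; split; last first.
  by apply: gaps_mono; exact: ltW.
rewrite leNgt; apply/negP => h.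
have lt_ab : (top a < top b)%O.
  rewrite lt_neqAle copy_neq 1?eq_sym ?ba//=.
  apply: (@le_trans _ _ (copy X b (gaps X (top a) b))).
    by rewrite leNgt -cntP ltxx.
  rewrite leNgt -cntP -/(gaps X _ _) gaps_copy /lab mat_diag.
  by rewrite add0r -leNgt; lia.
have Pb : P b.
  have : ~~ (top b < x)%O by rewrite -leNgt; exact: le_trans (top_ge _ Pa) (ltW lt_ab).
  by rewrite -cntP -/(gaps X x b) /P; lia.
by have := amax b Pb; rewrite leNgt lt_ab.
Qed.
End Locations.

Section Frames.
Variable (R : realType) (n : nat).
Notation row := 'I_n.
Notation vec := (row -> int).
Notation rep := (row -> int -> sl2).
Notation config := (row -> R * R).
Notation state := (rep * (int * int))%type.
Implicit Types (X Y : config) (a b : row) (x : loc R) (m : int) (v : vec) (rho : rep).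
Implicit Types (st : state) (s : seq row).

Definition sigma X : seq row := sort (fun a b => (tie X a <= tie X b)%O) (enum 'I_n).

Lemma sigma_uniq X : uniq (sigma X).
Proof. by rewrite sort_uniq enum_uniq. Qed.
Lemma mem_sigma X a : a \in sigma X.
Proof. by rewrite mem_sort mem_enum. Qed.

Definition top : loc R := (0, (- 2, 0%N)).
Definition gauge X st : rep := build (mat X) (sigma X) st.1.
Definition base X st : int * int := act (transport (sigma X) (gauge X st) (gaps X top)) st.2.
Definition pos X st v : int * int := dev (sigma X) (gauge X st) (base X st) v.

Definition step X Y st : state :=
  (extract (mat Y) (sigma X) (gauge X st), pos X st (gaps Y top)).

Lemma pos_top X st : pos X st (gaps X top) = st.2.
Proof. by rewrite /pos /dev /base actVK. Qed.

Lemma posE X st v : pos X st v =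
  act ((transport (sigma X) (gauge X st) v)^-1 *
       transport (sigma X) (gauge X st) (gaps X top))%g st.2.
Proof. by rewrite actM. Qed.

Record frame X st : Prop := Frame {
  frame_turn : forall a m, half_turn (st.1 a m);
  frame_neq0 : st.2 != 0;
  frame_incr : forall v a, incr (sigma X) (gauge X st) (base X st) v a;
  frame_equi : equivariant (trans n) st.1;
  frame_period : forall v, same (pos X st (shift1 v)) (act (trans n) (pos X st v)) }.

Lemma base_neq0 X st : st.2 != 0 -> base X st != 0.
Proof. exact: act_neq0. Qed.

Lemma half_turn_gauge X st a m : (forall a m, half_turn (st.1 a m)) ->
  half_turn (gauge X st a m).
Proof. by apply: half_turn_build; [exact: sigma_uniq|exact: mem_sigma]. Qed.

(** Moving the rows horizontally at fixed heights: *)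
Section Horizontal.
Variables (X Y : config) (st : state).
Hypothesis XY : forall a, (Y a).2 = (X a).2.

Lemma sigma_horizontal : sigma Y = sigma X.
Proof. by rewrite /sigma /tie; under eq_fun2 do rewrite !XY. Qed.

Lemma gauge_horizontal : gauge Y (step X Y st) = gauge X st.
Proof.
rewrite {1}/gauge sigma_horizontal; apply/funext => a; apply/funext => m.
by rewrite extractK//; [exact: sigma_uniq|exact: mem_sigma].
Qed.

Lemma base_horizontal : base Y (step X Y st) = base X st.
Proof. by rewrite {1}/base gauge_horizontal sigma_horizontal /= /pos /dev actKV. Qed.

Lemma pos_horizontal v : pos Y (step X Y st) v = pos X st v.
Proof. by rewrite /pos gauge_horizontal sigma_horizontal base_horizontal. Qed.

Lemma frame_horizontal : frame X st -> frame Y (step X Y st).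
Proof.
move=> [ht n0 inc eqv per]; split.
- move=> a m; rewrite /step/= /extract; rewrite -[X in half_turn (_ * X)%g]invgK.
  exact/half_turn_conj/half_turn_gauge.
- exact/act_neq0/base_neq0.
- by move=> v a; rewrite gauge_horizontal sigma_horizontal base_horizontal; exact: inc.
- by apply: extract_equivariant => //; [exact: sigma_uniq|exact: mem_sigma].
- by move=> v; rewrite !pos_horizontal.
Qed.
End Horizontal.

(** The holonomy between two places on the top boundary does not depend on the
    order in which the rows are crossed. *)
Section Holonomy.
Variables (X : config) (rho : rep).
Let Q s v := transport s (build (mat X) s rho) v.
Lemma jump_build s a m : uniq s -> a \in s ->
  jump s (build (mat X) s rho) a (lab (mat X) a m) = rho a m.
Proof.
move=> us as_; rewrite /jump {2}/lab mat_diag add0r -[RHS](buildK (mat X) rho m us as_).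
by rewrite /extract.
Qed.

Lemma gaps_ind (P : loc R -> loc R -> Prop) :
  (forall x x', gaps X x = gaps X x' -> P x x') ->
  (forall x a m x', (x <= copy X a m)%O -> (copy X a m < x')%O ->
     gaps X x' = raise (lab (mat X) a m) a -> P x (copy X a m) -> P x x') ->
  forall x x', (x <= x')%O -> P x x'.
Proof.
move=> P0 PS x x' xx'.
have [k] : exists k, k = (\sum_b `|gaps X x' b - gaps X x b|)%N by eexists.
elim: k x' xx' => [|k IH] x' xx' E.
  apply: P0; apply/funext => b.
  have : (`|gaps X x' b - gaps X x b| <= 0)%N by rewrite E (bigD1 b)//= leq_addr.
  by have := gaps_mono X b xx'; lia.
have [e|ne] := pselect (gaps X x = gaps X x'); first exact: P0.
have [a [m [/andP[xa ax'] e]]] := gaps_step xx' ne.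
apply: (PS _ a m) => //; apply: IH => //.
apply/eqP; rewrite -eqSS E (bigD1 a)//= [in X in _ == X](bigD1 a)//=.
have := gaps_mono X a xa; rewrite gaps_copy e /raise eqxx => ge.
rewrite -addSn; apply/eqP; congr (_ + _)%N; first lia.
by apply: eq_bigr => c ca; rewrite (negbTE ca) addr0.
Qed.

Variables (s s' : seq row).
Hypotheses (us : uniq s) (als : forall a, a \in s).
Hypotheses (us' : uniq s') (als' : forall a, a \in s').

Lemma holonomy_indep x x' :
  ((Q s (gaps X x))^-1 * Q s (gaps X x') = (Q s' (gaps X x))^-1 * Q s' (gaps X x'))%g.
Proof.
have raiseQ t a m : uniq t -> a \in t ->
    (Q t (raise (lab (mat X) a m) a) = Q t (lab (mat X) a m) * rho a m)%g.
  by move=> ut alt; rewrite /Q transport_raise// jump_build.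
have H : forall x x', (x <= x')%O -> ((Q s (gaps X x))^-1 * Q s (gaps X x') =
    (Q s' (gaps X x))^-1 * Q s' (gaps X x'))%g.
  apply: gaps_ind => [y y' ->|y a m y' _ _ ->]; first by rewrite !mulVg.
  by rewrite gaps_copy => IH; rewrite !raiseQ// !mulgA IH.
have [xx'|/ltW x'x] := leP x x'; first exact: H.
by apply: invg_inj; rewrite !invgM !invgK; exact: H.
Qed.
End Holonomy.

Lemma pos_step X st a m :
  pos X st (raise (lab (mat X) a m) a) = act (st.1 a m)^-1%g (pos X st (lab (mat X) a m)).
Proof.
rewrite /pos (dev_raise _ _ (sigma_uniq X) (mem_sigma X)).
by rewrite jump_build ?sigma_uniq ?mem_sigma.
Qed.

(** Criterion for a frame: the staircase of the places on the top boundary is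
    increasing. *)
Lemma incr_staircase X st : (forall a m, half_turn (st.1 a m)) -> st.2 != 0 ->
  (forall a m, incr (sigma X) (gauge X st) (base X st) (lab (mat X) a m) a) ->
  forall v a, incr (sigma X) (gauge X st) (base X st) v a.
Proof.
move=> ht n0 stair v a; apply: incr_all.
- exact: sigma_uniq.
- exact: mem_sigma.
- by move=> b m; exact: half_turn_gauge.
- exact: base_neq0.
pose S := \sum_b `|(X b).1 + 2 * (v b + 1)%:~R|.
have S_ge b : `|(X b).1 + 2 * (v b + 1)%:~R| <= S.
  by rewrite /S (bigD1 b)//= lerDl sumr_ge0.
pose S' := \sum_b `|(X b).1 + 2 * (v b)%:~R|.
have S'_ge b : `|(X b).1 + 2 * (v b)%:~R| <= S'.
  by rewrite /S' (bigD1 b)//= lerDl sumr_ge0.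
have S0 : 0 <= S by apply: sumr_ge0.
have S'0 : 0 <= S' by apply: sumr_ge0.
pose x : loc R := (- S' - 1, top.2); pose x' : loc R := (S + 1, top.2).
have xx' : (x <= x')%O.
  rewrite /x /x' le_locE; apply/andP; split; first lra.
  by rewrite lexx implybT.
have le1 b : gaps X x b <= v b.
  rewrite leNgt cntP /copy /x lt_locE; apply/negP => /andP[h _].
  by have := S'_ge b; rewrite ler_norml; lra.
have le2 b : v b + 1 < gaps X x' b.
  rewrite cntP /copy /x' lt_locE.
  have := S_ge b; rewrite ler_norml => /andP[_ h].
  apply/andP; split; first lra.
  by apply/implyP => h'; exfalso; lra.
have [w [Ew ip]] : exists w, raises (gaps X x) w = gaps X x' /\
    incr_path (sigma X) (gauge X st) (base X st) (gaps X x) w.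
  move: xx'; clear le1 le2; move: x x'; clear -stair.
  apply: (gaps_ind (X := X)) => [y y' ->|y b m y' _ _ ->]; first by exists [::].
  rewrite gaps_copy => -[w [Ew ip]]; exists (w ++ [:: b]).
  split; first by rewrite /raises foldl_cat -/(raises _ w) Ew.
  by apply/incr_path_cat; split=> //; rewrite Ew /=.
exists (gaps X x), w; split => // b; rewrite Ew /raise.
by have := le2 b; case: eqVneq => _; lia.
Qed.

Lemma gaps_shift X (x : R) t : gaps X (x + 2, t) = shift1 (gaps X (x, t)).
Proof.
apply/funext => b; rewrite /shift1 /gaps; apply: int_ltP => k.
have -> : (k < cnt X b (x, t) + 1) = (k - 1 < cnt X b (x, t)) by lia.
rewrite !cntP /copy !lt_locE rmorphB.
by congr (_ && (_ ==> _)); apply/idP/idP => ?; lra.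
Qed.

Lemma period_one X st v0 : equivariant (trans n) st.1 ->
  same (pos X st (shift1 v0)) (act (trans n) (pos X st v0)) ->
  forall v, same (pos X st (shift1 v)) (act (trans n) (pos X st v)).
Proof.
move=> eqv per0; have [c cP] := transport_period (mat X) (sigma_uniq X) eqv.
have E v : pos X st (shift1 v) = act (trans n)
    (act (transport (sigma X) (gauge X st) v)^-1%g (act (trans n)^-1%g (act c^-1%g (base X st)))).
  by rewrite /pos /dev /gauge cP !invgM invgK !actM.
have : same (act (trans n)^-1%g (act c^-1%g (base X st))) (base X st).
  move: per0; rewrite E => /(same_act (trans n)^-1%g); rewrite !actVK.
  by move=> /(same_act (transport (sigma X) (gauge X st) v0)); rewrite !actKV.
by move=> H v; rewrite E; apply: same_act; exact: same_act.
Qed.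

(** Moving the rows vertically at fixed abscissas: *)
Section Vertical.
Variables (X Y : config) (st : state).
Hypotheses (matE : mat Y = mat X) (topE : gaps Y top = gaps X top).

Lemma step_vertical : step X Y st = st.
Proof.
rewrite /step topE pos_top matE; case: st => rho al; congr pair.
apply/funext => a; apply/funext => m; apply: buildK; [exact: sigma_uniq|exact: mem_sigma].
Qed.

Lemma pos_vertical x : pos Y st (gaps X x) = pos X st (gaps X x).
Proof.
rewrite !posE topE /gauge matE; congr (act _ _).
by apply: holonomy_indep => *; rewrite ?sigma_uniq ?mem_sigma.
Qed.

Let pos_lab a m : pos Y st (lab (mat X) a m) = pos X st (lab (mat X) a m).
Proof. by rewrite -gaps_copy pos_vertical. Qed.

Lemma frame_vertical : frame X st -> frame Y st.
Proof.
move=> [ht n0 inc eqv per]; split => //.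
  have fold Z v : dev (sigma Z) (gauge Z st) (base Z st) v = pos Z st v by [].
  apply: incr_staircase => // a m.
  have := inc (lab (mat X) a m) a; rewrite /incr !fold !pos_step.
  by rewrite matE pos_lab.
apply: (@period_one _ _ (gaps X top)) => //.
by rewrite /top -gaps_shift !pos_vertical gaps_shift; exact: per.
Qed.
End Vertical.
End Frames.

Section Standard.
Variable (R : realType) (n : nat).
Notation row := 'I_n.
Notation vec := (row -> int).
Notation rep := (row -> int -> sl2).
Notation config := (row -> R * R).
Notation state := (rep * (int * int))%type.
Implicit Types (X Y : config) (a b : row) (x : loc R) (m : int) (v : vec) (rho : rep).
Implicit Types (st : state) (s : seq row).

Let frame_fold X st v : dev (sigma X) (gauge X st) (base X st) v = pos X st v.
Proof. by []. Qed.

Definition rank v : int := \sum_b v b.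

Lemma rank_raise v a : rank (raise v a) = rank v + 1.
Proof.
rewrite /rank /raise big_split/=; congr (_ + _).
rewrite (bigD1 a)//= eqxx big1; first by rewrite addr0.
by move=> b /negbTE ->.
Qed.

Lemma rank_shift v : rank (shift1 v) = rank v + n%:Z.
Proof. by rewrite /rank /shift1 big_split/= sumr_const card_ord natz. Qed.

Lemma lab_shift M a m : lab M a (m + 1) = shift1 (lab M a m) :> vec.
Proof. by apply/funext => b; rewrite /lab /shift1 addrA. Qed.

Definition std X : state :=
  (fun a m => turn (rank (lab (mat X) a m) - rank (gaps X (top R))), (0, 1)).

Lemma pos_std X x :
  same (pos X (std X) (gaps X x)) (rank (gaps X x) - rank (gaps X (top R)), 1).
Proof.
pose P x := same (pos X (std X) (gaps X x)) (rank (gaps X x) - rank (gaps X (top R)), 1).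
have H : forall x x', (x <= x')%O -> P x <-> P x'.
  apply: (gaps_ind (X := X)) => [y y' E|y a m y' _ _ E IH]; first by rewrite /P E.
  rewrite IH /P E gaps_copy pos_step rank_raise.
  set j := _ - _; have -> : rank (lab (mat X) a m) + 1 - rank (gaps X (top R)) = j + 1.
    by rewrite /j; lia.
  have ht := half_turn_turn j.
  rewrite -/j -act_turn; split=> [h|h].
    by rewrite (half_turnV _ ht); apply: same_trans (same_act (turn j) h); right.
  have := same_act (turn j) h; rewrite actKV ht => h'.
  by apply: same_trans h' _; right; rewrite ?opprK.
have Ptop : P (top R) by rewrite /P pos_top subrr; left.
by have [xx|/ltW xx] := leP x (top R); [apply/(H _ _ xx)|apply/(H _ _ xx)].
Qed.

Lemma frame_std X : frame X (std X).
Proof.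
have ht a m : half_turn ((std X).1 a m) by exact: half_turn_turn.
have n0 : (std X).2 != 0 by [].
have eqv : equivariant (trans n) (std X).1.
  move=> a m; rewrite /std/= lab_shift rank_shift addrAC; exact: turn_trans.
split=> //.
  apply: incr_staircase => // a m; rewrite /incr !frame_fold pos_step.
  have := pos_std X (copy X a m); rewrite gaps_copy; set j := _ - _ => h.
  have h' : same (act ((std X).1 a m)^-1%g (pos X (std X) (lab (mat X) a m))) (j + 1, 1).
    apply: same_trans (same_act _ h) _; rewrite (half_turnV _ (ht a m)) act_turn.
    by right.
  rewrite (same_fin h) (same_fin h') (same_slope h) (same_slope h'); split => //.
  by rewrite /slope/= !divr1 ltr_int; lia.
apply: (@period_one _ _ _ _ (gaps X (top R))) => //.
rewrite /top -gaps_shift; apply: same_trans (pos_std _ _) _.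
apply: same_trans (same_act _ (same_sym (pos_std _ _))).
by left; rewrite act_trans/= gaps_shift rank_shift mulr1 addrAC.
Qed.
End Standard.

Section Frames.
Variable (R : realType) (n : nat).
Notation row := 'I_n.
Notation vec := (row -> int).
Notation rep := (row -> int -> sl2).
Notation config := (row -> R * R).
Notation state := (rep * (int * int))%type.
Implicit Types (X Y : config) (a b : row) (x : loc R) (m : int) (v : vec) (rho : rep).
Implicit Types (st : state) (s : seq row).

Section OneFrame.
Variables (X : config) (st : state).
Hypothesis fr : frame X st.

Lemma frame_lt v a : slope (pos X st v) < slope (pos X st (raise v a)).
Proof. by have [] := frame_incr fr v a. Qed.

Lemma frame_finl v a : (pos X st v).2 != 0.
Proof. by have [] := frame_incr fr v a. Qed.

Lemma frame_le v v' : (forall b, v b <= v' b) -> slope (pos X st v) <= slope (pos X st v').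
Proof. exact: (incr_mono (sigma_uniq X) (base_neq0 X (frame_neq0 fr)) (frame_incr fr)). Qed.

Lemma frame_shift (a : row) v (k : int) :
  slope (pos X st (fun b => v b + k)) = slope (pos X st v) + (n%:Z * k)%:~R.
Proof.
have S u : slope (pos X st (shift1 u)) = slope (pos X st u) + n%:Z%:~R.
  by rewrite (same_slope (frame_period fr u)) slope_trans// (frame_finl _ a).
elim/int_rect: k => [|k IH|k IH].
- rewrite mulr0 addr0; congr (slope (pos X st _)).
  by apply/funext => b; rewrite addr0.
- have -> : (fun b => v b + k.+1%:Z) = shift1 (fun b => v b + k%:Z).
    by apply/funext => b; rewrite /shift1; lia.
  rewrite S IH -addrA -rmorphD/=; congr (_ + _%:~R); lia.
- have := S (fun b => v b + - k.+1%:Z).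
  have -> : shift1 (fun b => v b + - k.+1%:Z) = (fun b => v b - k%:Z).
    by apply/funext => b; rewrite /shift1; lia.
  rewrite IH => E; rewrite -[LHS](addrK (n%:Z%:~R)) -E -addrA -rmorphB/=.
  by congr (_ + _%:~R); lia.
Qed.

Lemma frame_top_slope : slope (pos X st (gaps X (top R))) = slope st.2.
Proof. by rewrite pos_top. Qed.

Lemma raise_gaps a m x : (copy X a m < x)%O -> forall b, raise (lab (mat X) a m) a b <= gaps X x b.
Proof.
move=> ax b; have := gaps_mono X b (ltW ax); rewrite gaps_copy /raise.
case: eqVneq => [->|_]; last by rewrite addr0.
by move=> _; move: ax; rewrite -cntP /lab mat_diag /gaps; lia.
Qed.

(* the copy (a, m) is m - gaps X top a periods away from the origin *)
Lemma frame_bracket a m : let k := m - gaps X (top R) a in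
  slope st.2 + (n%:Z * k)%:~R <= slope (pos X st (lab (mat X) a m)) /\
  slope (pos X st (raise (lab (mat X) a m) a)) <= slope st.2 + (n%:Z * (k + 1))%:~R.
Proof.
move=> k; rewrite -frame_top_slope -!(frame_shift a).
have E (j : int) b : gaps X (top R) b + j = gaps X (2 * j%:~R, (top R).2) b.
  rewrite /gaps; apply: int_ltP => i.
  have -> : (i < cnt X b (top R) + j) = (i - j < cnt X b (top R)) by lia.
  rewrite !cntP /copy /top !lt_locE rmorphB.
  by congr (_ && (_ ==> _)); apply/idP/idP => ?; lra.
split; apply: frame_le => b; rewrite E.
  rewrite -gaps_copy; apply: gaps_mono; rewrite leNgt -cntP -/(gaps X _ a) -E /k; lia.
by apply: raise_gaps; rewrite -cntP -/(gaps X _ a) -E /k; lia.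
Qed.

(* rows other than the lowest do not move a place across the copies of the
   lowest one *)
Lemma frame_lowest a v k : lower a (sigma X) = [::] -> k = v a - gaps X (top R) a ->
  slope st.2 + (n%:Z * (k - 1))%:~R <= slope (pos X st v) <= slope st.2 + (n%:Z * (k + 1))%:~R.
Proof.
move=> la kE.
pose D m := gauge X st a m.
have DE u : pos X st (raise u a) = act (D (u a))^-1%g (pos X st u).
  rewrite /pos (dev_raise _ _ (sigma_uniq X) (mem_sigma X)) /jump la /=.
  by rewrite mulg1 invg1 mul1g.
have ht m : half_turn (D m)^-1%g.
  by apply: half_turn_inv; apply: half_turn_gauge; exact: frame_turn fr.
have labE m : lab (mat X) a m a = m by rewrite /lab mat_diag add0r.
have pn0 u : pos X st u != 0 by apply: act_neq0; apply: base_neq0; exact: frame_neq0 fr.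
have fin u := frame_finl u a.
have inc u := frame_lt u a.
apply/andP; split; last first.
  have [_] := frame_bracket a (v a); rewrite -kE; apply: le_trans; rewrite leNgt; apply/negP => h.
  have := fin (raise (lab (mat X) a (v a)) a); have := inc (lab (mat X) a (v a)).
  rewrite !DE labE => ic fn.
  have [] := turn_le (ht (v a)) (fin (lab (mat X) a (v a))) fn ic (pn0 v).
    by move=> _; right; apply: ltW; move: h; rewrite !DE labE.
  move=> _ /andP[_ h2]; move: h; rewrite DE labE => h.
  have h2' : slope (pos X st (raise v a)) <= slope (act (D (v a))^-1%g (pos X st (lab (mat X) a (v a)))).
    by rewrite DE.
  by have := lt_trans (inc v) (le_lt_trans h2' h); rewrite ltxx.
have [h0 _] := frame_bracket a (v a - 1).
have -> : k - 1 = v a - 1 - gaps X (top R) a by rewrite kE; lia.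
apply: le_trans h0 _; rewrite leNgt; apply/negP => h.
pose u : vec := fun b => v b - (b == a)%:Z.
have uv : raise u a = v by apply/funext => b; rewrite /raise /u subrK.
have ua : u a = v a - 1 by rewrite /u eqxx.
have := fin (raise (lab (mat X) a (v a - 1)) a); have := inc (lab (mat X) a (v a - 1)).
rewrite !DE labE => ic fn.
have [] := turn_le (ht (v a - 1)) (fin (lab (mat X) a (v a - 1))) fn ic (pn0 v).
  by move=> _; left; apply: ltW.
have Dv : act (D (u a))^-1%g (pos X st (raise u a)) = - pos X st u by rewrite DE ht.
rewrite uv ua in Dv; rewrite Dv slopeN => _ /andP[h2 _].
have := inc u; rewrite uv => h3.
by have := lt_trans h (le_lt_trans h2 h3); rewrite ltxx.
Qed.
End OneFrame.

(** ping-pong *)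
Section PingPong.
Variables (X : config) (st st0 : state).
Hypotheses (fr : frame X st) (fr0 : frame X st0).

Inductive related : sl2 -> sl2 -> Prop :=
| related1 : related 1%g 1%g
| relatedM a m g g0 of related g g0 : related (st.1 a m * g)%g (st0.1 a m * g0)%g
| relatedV a m g g0 of related g g0 : related ((st.1 a m)^-1 * g)%g ((st0.1 a m)^-1 * g0)%g.

Lemma related_mul g g0 h h0 : related g g0 -> related h h0 -> related (g * h)%g (g0 * h0)%g.
Proof.
move=> rg rh; elim: rg => [|a m k k0 _ IH|a m k k0 _ IH]; rewrite ?mul1g// -!mulgA.
  exact: relatedM.
exact: relatedV.
Qed.

Lemma related_inv g g0 : related g g0 -> related g^-1%g g0^-1%g.
Proof.
elim=> [|a m k k0 _ IH|a m k k0 _ IH]; first by rewrite !invg1; exact: related1.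
  rewrite !invgM; apply: related_mul => //.
  by have := relatedV a m related1; rewrite !mulg1.
rewrite !invgM !invgK; apply: related_mul => //.
by have := relatedM a m related1; rewrite !mulg1.
Qed.

Lemma related_gen a m : related (st.1 a m) (st0.1 a m).
Proof. by have := relatedM a m related1; rewrite !mulg1. Qed.

Implicit Types (w : seq (row * int)).
Definition word_act rho w (p : int * int) : int * int :=
  foldr (fun i => act (rho i.1 i.2)) p w.
Definition reduced w : bool := sorted (fun i j => i != j) w.

Lemma related_word g g0 : related g g0 -> exists w, [/\ reduced w,
  forall p, same (act g p) (word_act st.1 w p) &
  forall p, same (act g0 p) (word_act st0.1 w p)].
Proof.
have gen a m k k0 : related k k0 -> (exists w, [/\ reduced w,
  forall p, same (act k p) (word_act st.1 w p) &
  forall p, same (act k0 p) (word_act st0.1 w p)]) -> exists w, [/\ reduced w,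
  forall p, same (act (st.1 a m) (act k p)) (word_act st.1 w p) &
  forall p, same (act (st0.1 a m) (act k0 p)) (word_act st0.1 w p)].
  move=> _ [[|i w] [red h h0]].
    by exists [:: (a, m)]; split => // p /=; exact: same_act.
  have [E|ne] := eqVneq (a, m) i; last first.
    exists ((a, m) :: i :: w); split => [|p|p]; first by rewrite /reduced/= ne.
      exact: same_act (h p).
    exact: same_act (h0 p).
  exists w; split => [|p|p]; first exact: path_sorted red.
    apply: same_trans (same_act _ (h p)) _; rewrite /= -E /=.
    by right; exact: (frame_turn fr).
  apply: same_trans (same_act _ (h0 p)) _; rewrite /= -E /=.
  by right; exact: (frame_turn fr0).
elim=> [|a m k k0 rk IH|a m k k0 rk IH].
- by exists [::]; split => // p; rewrite act1; left.
- have [w [red h h0]] := gen a m _ _ rk IH.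
  by exists w; split => // p; rewrite actM.
- have [w [red h h0]] := gen a m _ _ rk IH; exists w; split => // p; rewrite actM.
    rewrite half_turnV; last exact: (frame_turn fr).
    by apply: same_trans (h p); right.
  rewrite half_turnV; last exact: (frame_turn fr0).
  by apply: same_trans (h0 p); right.
Qed.
End PingPong.

Lemma copy_total X (i j : row * int) : i != j ->
  (copy X i.1 i.2 < copy X j.1 j.2)%O \/ (copy X j.1 j.2 < copy X i.1 i.2)%O.
Proof.
case: i j => [a m] [b k] /= ne; have : copy X a m != copy X b k.
  have [E|ab] := eqVneq a b; last exact: copy_neq.
  apply: contraNneq ne; rewrite E => -[/addrI].
  have two : (2 : R) != 0 by rewrite pnatr_eq0.
  by move=> /(mulfI two)/intr_inj ->.
by rewrite neq_lt => /orP.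
Qed.

Lemma ping_pong X st i (w : seq (row * int)) : frame X st -> reduced (i :: w) ->
  let q := word_act st.1 (i :: w) st.2 in
  slope (pos X st (lab (mat X) i.1 i.2)) <= slope q <=
  slope (pos X st (raise (lab (mat X) i.1 i.2) i.1)).
Proof.
move=> fr; suff H : reduced (i :: w) -> let q := word_act st.1 (i :: w) st.2 in
    [/\ q != 0, q.2 != 0 & slope (pos X st (lab (mat X) i.1 i.2)) <= slope q <=
    slope (pos X st (raise (lab (mat X) i.1 i.2) i.1))] by move=> /H[].
have main j p : p != 0 -> (p.2 != 0 -> slope p <= slope (pos X st (lab (mat X) j.1 j.2)) \/
      slope (pos X st (raise (lab (mat X) j.1 j.2) j.1)) <= slope p) ->
    let q := act (st.1 j.1 j.2) p in
    [/\ q != 0, q.2 != 0 & slope (pos X st (lab (mat X) j.1 j.2)) <= slope q <=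
    slope (pos X st (raise (lab (mat X) j.1 j.2) j.1))].
  move=> p0; rewrite pos_step => out q; have ht := frame_turn fr j.1 j.2.
  have := frame_lt fr (lab (mat X) j.1 j.2) j.1.
  have := frame_finl fr (raise (lab (mat X) j.1 j.2) j.1) j.1.
  rewrite pos_step => fn lt.
  have [] := turn_le (half_turn_inv ht) (frame_finl fr _ j.1) fn lt p0 out.
  rewrite (half_turnV p ht) slopeN /= oppr_eq0 => f2 lts; split => //.
  exact: act_neq0.
elim: w i => [|j w IH] i red; apply: main; rewrite -?/(word_act _ _ _).
- exact: frame_neq0 fr.
- move=> _; rewrite -(frame_top_slope X st).
  have [ti|it] := leP (top R) (copy X i.1 i.2); [left|right]; apply: frame_le => // b.
    by rewrite -gaps_copy; exact: gaps_mono.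
  exact: raise_gaps.
- by have [] := IH j (path_sorted red).
move=> _; have [_ _ /andP[h1 h2]] := IH j (path_sorted red).
have ne : i != j by case/andP: red.
have [ij|ji] := copy_total X ne; [right; apply: le_trans h1|left; apply: le_trans h2 _].
  by apply: frame_le => // b; rewrite -(gaps_copy X j.1); exact: raise_gaps.
by apply: frame_le => // b; rewrite -(gaps_copy X i.1); exact: raise_gaps.
Qed.

(** The displacement of the origin by a word hardly depends on the frame. *)
Lemma related_slope X st st0 g g0 : frame X st -> frame X st0 -> related st st0 g g0 ->
  `|(slope (act g st.2) - slope st.2) - (slope (act g0 st0.2) - slope st0.2)| <= n%:R.
Proof.
move=> fr fr0 /(related_word fr fr0)[w [red h h0]].
rewrite (same_slope (h _)) (same_slope (h0 _)).
case: w red {h h0} => [|i w] red; first by rewrite /= !subrr normr0.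
have /andP[a1 a2] := ping_pong fr red; have /andP[b1 b2] := ping_pong fr0 red.
have [c1 c2] := frame_bracket fr i.1 i.2; have [d1 d2] := frame_bracket fr0 i.1 i.2.
move: a1 a2 b1 b2 c1 c2 d1 d2; set k := i.2 - _.
have -> : (n%:Z * (k + 1))%:~R = (n%:Z * k)%:~R + n%:R :> rat by rewrite mulrDr mulr1 rmorphD.
set u := slope (word_act _ _ _); set u0 := slope (word_act _ _ _).
move: (slope (pos _ _ _)) (slope (pos _ _ _)) (slope (pos _ _ _)) (slope (pos _ _ _)).
move: (slope _) (slope _) => *; rewrite ler_norml; apply/andP; split; lra.
Qed.

(** ** Runs *)
Section Runs.
Implicit Types (Ys Zs : seq config).

Fixpoint run X Ys st : state := if Ys is Y :: Ys' then run Y Ys' (step X Y st) else st.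

Lemma run_cat X Ys Zs st : run X (Ys ++ Zs) st = run (last X Ys) Zs (run X Ys st).
Proof. by elim: Ys X st => //= Y Ys IH X st; rewrite IH. Qed.

Definition move X Y : Prop := (forall a, (Y a).2 = (X a).2) \/
  (mat Y = mat X /\ gaps Y (top R) = gaps X (top R)).

Fixpoint moves X Ys : Prop := if Ys is Y :: Ys' then move X Y /\ moves Y Ys' else True.

Lemma moves_cat X Ys Zs : moves X (Ys ++ Zs) <-> moves X Ys /\ moves (last X Ys) Zs.
Proof.
elim: Ys X => [|Y Ys IH] X /=; first by split=> [|[]].
by split=> [[? /IH[? ?]]|[[? ?] ?]]; do ?split => //; apply/IH.
Qed.

Lemma frame_step X Y st : move X Y -> frame X st -> frame Y (step X Y st).
Proof.
case=> [h|[h1 h2]] fr; first exact: frame_horizontal.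
by rewrite step_vertical//; exact: frame_vertical fr.
Qed.

Lemma frame_run X Ys st : moves X Ys -> frame X st -> frame (last X Ys) (run X Ys st).
Proof.
elim: Ys X st => //= Y Ys IH X st [m ms] fr; apply: IH => //.
exact: frame_step.
Qed.

Definition twist X Ys : rat := slope (run X Ys (std X)).2.

Section Related.
Variables (st st0 : state).
Local Notation rel := (related st st0).

Let rel_qprod f f0 : (forall m, rel (f m) (f0 m)) -> forall m, rel (qprod f m) (qprod f0 m).
Proof.
move=> h; have pos k : rel (qpos f k) (qpos f0 k).
  by elim: k => [|k IH] /=; [exact: related1|exact: related_mul].
have neg k : rel (qneg f k) (qneg f0 k).
  elim: k => [|k IH] /=; first exact: related1.
  by apply: related_mul => //; exact: related_inv.
by case=> k; [exact: pos|exact: neg].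
Qed.

Let rel_transport s S S0 v : (forall a m, rel (S a m) (S0 a m)) ->
  rel (transport s S v) (transport s S0 v).
Proof.
move=> h; elim: s => [|a s IH] /=; first exact: related1.
by apply: related_mul => //; exact: rel_qprod.
Qed.

Let rel_build M s S S0 : (forall a m, rel (S a m) (S0 a m)) ->
  forall a m, rel (build M s S a m) (build M s S0 a m).
Proof.
move=> h; elim: s => [|b s IH] a m /=; first exact: related1.
case: eqP => // _; apply: related_mul; first apply: related_mul => //.
  exact: rel_transport.
by apply: related_inv; exact: rel_transport.
Qed.

Let rel_extract M s S S0 : (forall a m, rel (S a m) (S0 a m)) ->
  forall a m, rel (extract M s S a m) (extract M s S0 a m).
Proof.
move=> h a m; apply: related_mul; first apply: related_mul => //.
  by apply: related_inv; exact: rel_transport.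
exact: rel_transport.
Qed.

Definition related_state (t t0 : state) : Prop := (forall a m, rel (t.1 a m) (t0.1 a m)) /\
  exists g g0, [/\ rel g g0, t.2 = act g st.2 & t0.2 = act g0 st0.2].

Lemma related_step X Y t t0 : related_state t t0 -> related_state (step X Y t) (step X Y t0).
Proof.
move=> [h [g [g0 [hg E E0]]]]; split=> /= [a m|].
  by apply: rel_extract => a' m'; exact: rel_build.
rewrite !posE E E0 -!actM; eexists; eexists; split; [|reflexivity|reflexivity].
have Q v : rel (transport (sigma X) (gauge X t) v) (transport (sigma X) (gauge X t0) v).
  by apply: rel_transport => a' m'; exact: rel_build.
by apply: related_mul => //; apply: related_mul => //; exact: related_inv.
Qed.

Lemma related_run X Ys t t0 : related_state t t0 -> related_state (run X Ys t) (run X Ys t0).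
Proof. by elim: Ys X t t0 => //= Y Ys IH X t t0 h; apply: IH; exact: related_step. Qed.

Lemma related_refl : related_state st st0.
Proof.
split=> [a m|]; first exact: related_gen.
by exists 1%g, 1%g; rewrite !act1; split => //; exact: related1.
Qed.
End Related.

(** The twist is a quasi-cocycle. *)
Lemma twist_cat X Ys Zs : moves X (Ys ++ Zs) ->
  `|twist X (Ys ++ Zs) - twist X Ys - twist (last X Ys) Zs| <= n%:R.
Proof.
move=> /moves_cat[mY mZ]; rewrite /twist run_cat.
have fr := frame_run mY (frame_std X); have fr0 := frame_std (last X Ys).
have [_ [g [g0 [rg -> ->]]]] :=
  related_run (last X Ys) Zs (related_refl (run X Ys (std X)) (std (last X Ys))).
have := related_slope fr fr0 rg.
by rewrite [slope (std _).2]/slope/= mul0r subr0.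
Qed.

Lemma twist_horizontal X Y a : (forall a, (Y a).2 = (X a).2) -> lower a (sigma X) = [::] ->
  `|twist X [:: Y] - (n%:Z * (gaps Y (top R) a - gaps X (top R) a))%:~R| <= n%:R.
Proof.
move=> XY la; rewrite /twist/=.
have /andP[] := frame_lowest (frame_std X) (v := gaps Y (top R)) la erefl.
rewrite [slope (std _).2]/slope/= mul0r add0r.
set k := _ - _; rewrite mulrBr mulrDr mulr1 rmorphB rmorphD add0r => h1 h2.
by rewrite ler_norml; apply/andP; split; lra.
Qed.

Lemma slope_step_bound X Y st (k : nat) : (0 < n)%N -> frame X st ->
  (forall a, `|gaps Y (top R) a - gaps X (top R) a| <= k%:Z) ->
  `|slope (step X Y st).2 - slope st.2| <= (n * k)%:R.
Proof.
move=> n0 fr h; pose a := Ordinal n0; rewrite /= -(frame_top_slope X st).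
have E : (n * k)%:R = (n%:Z * k%:Z)%:~R :> rat by rewrite -PoszM -pmulrn.
rewrite ler_norml; apply/andP; split.
  rewrite E -rmorphN/= -mulrN lerBrDl -(frame_shift fr a).
  by apply: frame_le => // b; have := h b; rewrite ler_norml; lia.
rewrite E lerBlDl -(frame_shift fr a).
by apply: frame_le => // b; have := h b; rewrite ler_norml; lia.
Qed.
End Runs.
End Frames.

Section Transition.
Variable (R : realType) (n : nat).
Notation row := 'I_n.
Notation vec := (row -> int).
Notation rep := (row -> int -> sl2).
Notation config := (row -> R * R).
Notation state := (rep * (int * int))%type.
Implicit Types (X Y : config) (a b : row) (x : loc R) (m : int) (v : vec) (rho : rep).
Implicit Types (st : state) (s : seq row) (z : R * R).

Definition atp z : loc R := (z.1, (- z.2, 0%N)).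
Definition is_copy X z : Prop := exists a m, z = ((X a).1 + 2 * m%:~R, (X a).2).
Definition low X z : seq row := [seq a <- sigma X | (X a).2 < z.2].

(* parallel transport of the flat connection near z, in the gauge where it is
   trivial outside the vertical rays that lie above the copies *)
Definition trans_near X st z z' : sl2 :=
  ((transport (low X z) (gauge X st) (gaps X (atp z)))^-1 *
   transport (low X z) (gauge X st) (gaps X (atp z')))%g.

Definition stack X z : seq row := [seq a <- sigma X |
  ((X a).2 < z.2) && ((X a).1 + 2 * (cnt X a (atp z))%:~R == z.1)].
Definition ray X rho z z' : sl2 :=
  if z.1 < z'.1 then foldr (fun a g => rho a (cnt X a (atp z)) * g)%g 1%g (stack X z) else 1%g.

Lemma cnt_mid X b (x : R) t m : m%:~R < (x - (X b).1) / 2 -> (x - (X b).1) / 2 < (m + 1)%:~R ->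
  cnt X b (x, t) = m + 1.
Proof.
move=> h1 h2; rewrite /cnt [(x, t).1]/fst [(x, t).2]/snd; case: ifP => _.
  by congr (_ + _); apply: floor_def; rewrite ltW.
by apply: ceil_def; rewrite addrK h1 ltW.
Qed.

Lemma cnt_notie X b (x : R) t m : ~~ (tie X b < t)%O -> (m - 1)%:~R < (x - (X b).1) / 2 ->
  (x - (X b).1) / 2 <= m%:~R -> cnt X b (x, t) = m.
Proof.
move=> nt h1 h2; rewrite /cnt [(x, t).1]/fst [(x, t).2]/snd (negbTE nt).
by apply: ceil_def; rewrite h1.
Qed.

Lemma tie_low X b z : (X b).2 < z.2 -> ~~ (tie X b < (atp z).2)%O.
Proof.
move=> h; rewrite /tie /atp [(_, _).2]/snd (@ltxi_pair _ _ _ R nat).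
by rewrite lerN2 leNgt h.
Qed.

Lemma tie_le_height X a b : (tie X a <= tie X b)%O -> (X b).2 <= (X a).2.
Proof. by rewrite /tie (@lexi_pair _ _ _ R nat) lerN2 => /andP[]. Qed.

Lemma near_forall (T : Type) (z : set_system T) {zF : Filter z} (P : row -> T -> Prop) :
  (forall a, \forall z' \near z, P a z') -> \forall z' \near z, forall a, P a z'.
Proof.
move=> h; have : \forall z' \near z, forall a, a \in enum 'I_n -> P a z'.
  elim: (enum 'I_n) => [|b s IH]; first by apply: nearW => z' a; rewrite in_nil.
  near=> z'; move=> a; rewrite inE => /orP[/eqP ->|].
    by near: z'; exact: h.
  by move: a; near: z'; exact: IH.
by apply: filterS => z' hz a; apply: hz; rewrite mem_enum.
Unshelve. all: by end_near. Qed.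

Lemma sigma_sorted X : sorted (fun a b => (tie X a <= tie X b)%O) (sigma X).
Proof. by apply: sort_sorted => a b; exact: le_total. Qed.

(* rows crossed by the vertical line through z *)
Lemma cnt_near X z a : (X a).2 < z.2 -> \forall z' \near z,
  [/\ (X a).2 < z'.2 & cnt X a (atp z') = cnt X a (atp z) +
    ((z.1 < z'.1) && ((X a).1 + 2 * (cnt X a (atp z))%:~R == z.1))%:Z].
Proof.
move=> az; set d := (z.1 - (X a).1) / 2; pose m := Num.ceil d.
have m1 : (m - 1)%:~R < d by rewrite ltNge -ceil_le_int -ltNge -/m; lia.
have m2 : d <= m%:~R by rewrite -ceil_le_int.
have E : cnt X a (atp z) = m by apply: cnt_notie => //; exact: tie_low.
have c1 : (fun z' : R * R => z'.1) @ z --> z.1 by exact: cvg_fst.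
have c2 : (fun z' : R * R => z'.2) @ z --> z.2 by exact: cvg_snd.
have n2 : \forall z' \near z, (X a).2 < z'.2 by exact: cvgr_gt c2 _ az.
have n1 : \forall z' \near z, (X a).1 + 2 * (m - 1)%:~R < z'.1.
  have lo : (X a).1 + 2 * (m - 1)%:~R < z.1 by rewrite /d in m1; lra.
  exact: cvgr_gt c1 _ lo.
rewrite E; have [dm|dm] := eqVneq ((X a).1 + 2 * m%:~R) z.1.
  have n3 : \forall z' \near z, z'.1 < (X a).1 + 2 * (m + 1)%:~R.
    have hi : z.1 < (X a).1 + 2 * (m + 1)%:~R by rewrite -dm rmorphD/=; lra.
    exact: cvgr_lt c1 _ hi.
  near=> z'; have h2 : (X a).2 < z'.2 by near: z'.
  have h1 : (X a).1 + 2 * (m - 1)%:~R < z'.1 by near: z'.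
  have h3 : z'.1 < (X a).1 + 2 * (m + 1)%:~R by near: z'.
  split => //; rewrite andbT; have [lt|ge] := ltP z.1 z'.1.
    by apply: cnt_mid; lra.
  by rewrite addr0; apply: cnt_notie; [exact: tie_low|lra|lra].
have n3 : \forall z' \near z, z'.1 < (X a).1 + 2 * m%:~R.
  have hi : z.1 < (X a).1 + 2 * m%:~R by rewrite lt_neqAle eq_sym dm; rewrite /d in m2; lra.
  exact: cvgr_lt c1 _ hi.
near=> z'; have h2 : (X a).2 < z'.2 by near: z'.
have h1 : (X a).1 + 2 * (m - 1)%:~R < z'.1 by near: z'.
have h3 : z'.1 < (X a).1 + 2 * m%:~R by near: z'.
split => //; rewrite andbF addr0.
by apply: cnt_notie; [exact: tie_low|lra|lra].
Unshelve. all: by end_near. Qed.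

Lemma trans_nearE X st z : \forall z' \near z, trans_near X st z z' = ray X st.1 z z'.
Proof.
have : \forall z' \near z, forall a, (X a).2 < z.2 -> cnt X a (atp z') = cnt X a (atp z) +
    ((z.1 < z'.1) && ((X a).1 + 2 * (cnt X a (atp z))%:~R == z.1))%:Z.
  apply: (near_forall (z := nbhs z)) => a; have [az|az] := ltP (X a).2 z.2; last first.
    by near=> z'.
  by apply: filterS (cnt_near az) => z' [_ h] _.
apply: filterS => z' hz; rewrite /trans_near /ray /low /stack.
pose G := gauge X st; rewrite -/G.
pose p a := (X a).2 < z.2; pose q a := (X a).1 + 2 * (cnt X a (atp z))%:~R == z.1.
have main s t : sigma X = s ++ t ->
  ((transport [seq a <- t | p a] G (gaps X (atp z)))^-1 *
   transport [seq a <- t | p a] G (gaps X (atp z')))%g =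
  if z.1 < z'.1 then foldr (fun a g => st.1 a (cnt X a (atp z)) * g)%g 1%g
     [seq a <- t | p a && q a] else 1%g.
  elim: t s => [|a t IH] s sE /=; first by rewrite mulVg; case: ifP.
  have {}IH := IH (rcons s a); rewrite cat_rcons in IH; have {}IH := IH sE.
  have [pa|//] := boolP (p a); rewrite /= invgM mulgA -(mulgA _ _^-1)%g.
  have hza := hz a pa; rewrite -/(q a) in hza.
  rewrite {2}/gaps {2}/gaps hza.
  case: (ltP z.1 z'.1) hza IH => [lt hza IH|ge hza IH]; last first.
    by rewrite addr0 mulVg mulg1.
  have [qa|nqa] := boolP (q a); last by rewrite addr0 mulVg mulg1 IH.
  rewrite /= qprodS mulKg -IH; set m := cnt X a (atp z).
  set Q := transport _ G (gaps X (atp z)).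
  suff -> : G a m = (Q * st.1 a m * Q^-1)%g by rewrite !mulgA mulVg mul1g.
  have us := sigma_uniq X.
  have lowE : lower a (sigma X) = t.
    move: us; rewrite sE; elim: (s) => [|b s' IHs] /=; first by rewrite eqxx.
    rewrite mem_cat inE => /andP[nb us']; rewrite IHs//.
    by case: (eqVneq a b) nb => [->|//]; rewrite /= orbT.
  rewrite /G /gauge (build_head _ _ _ us (mem_sigma X a)) lowE -/(gauge X st) -/G /=.
  have tlow b : b \in t -> p b.
    have := sigma_sorted X; rewrite sE => /cat_sorted2[_ /=].
    rewrite (path_sortedE (fun _ _ _ => @le_trans _ _ _ _ _)).
    by move=> /andP[/allP h _] /h /tie_le_height hab; exact: le_lt_trans hab pa.
  suff -> : transport t G (lab (mat X) a m) = Q.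
    by [].
  rewrite /Q; have -> : [seq b <- t | p b] = t by apply/all_filterP/allP.
  apply: transport_ext => // b bt; rewrite -gaps_copy /gaps.
  have nt1 : ~~ (tie X b < (atp z).2)%O by exact/tie_low/tlow.
  have nt2 : ~~ (tie X b < tie X a)%O.
    have := sigma_sorted X; rewrite sE => /cat_sorted2[_ /=].
    rewrite (path_sortedE (fun _ _ _ => @le_trans _ _ _ _ _)).
    by move=> /andP[/allP h _]; rewrite -leNgt; exact: h.
  by rewrite /cnt /copy [(_, _).2]/snd [(_, _).1]/fst (negbTE nt1) (negbTE nt2) (eqP qa).
exact: (main [::]).
Unshelve. all: by end_near. Qed.
End Transition.

Lemma locally_constant (R : realType) (T : Type) (f : R -> T) :
  (forall s, \forall s' \near s, f s' = f s) -> forall s t, f s = f t.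
Proof.
move=> lc s t.
have cR : connected [set: R] by apply/connected_intervalP => ? ? ? ? ? ?.
pose B := [set u | f u = f s].
have oB : open B.
  by rewrite openE => u ufs; have := lc u; apply: filterS => v fv; rewrite /B/= fv.
have oC : open (~` B).
  by rewrite openE => u ufs; have := lc u; apply: filterS => v fv; rewrite /B/= fv.
have : B = setT.
  apply: cR; first by exists s.
    by exists B => //; rewrite setTI.
  by exists B; rewrite ?setTI// -(setCK B); exact: open_closedC.
by move=> /(congr1 (fun A => A t)) E; have : B t by rewrite E.
Qed.

Lemma sort_eq_in (T : eqType) (r r' : rel T) (s : seq T) : total r -> total r' ->
  transitive r' -> antisymmetric r' -> {in s &, r =2 r'} -> sort r s = sort r' s.
Proof.
move=> tr tr' trr' ar' rr'; apply: (sorted_eq trr' ar').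
- rewrite -(@eq_in_sorted _ (mem s) r r'); first exact: sort_sorted.
    by move=> a b as_ bs; exact: rr'.
  by apply/allP => a; rewrite mem_sort.
- exact: sort_sorted.
- by rewrite perm_sort perm_sym perm_sort.
Qed.

Section Elementary.
Variable (R : realType) (n : nat).
Notation row := 'I_n.
Notation vec := (row -> int).
Notation rep := (row -> int -> sl2).
Notation config := (row -> R * R).
Notation state := (rep * (int * int))%type.
Implicit Types (X Y : config) (a b : row) (x : loc R) (m : int) (v : vec) (rho : rep).
Implicit Types (st : state) (s : seq row) (z p : R * R) (e : R * R -> R * R).

Record elementary e e' : Prop := Elementary {
  elemK : cancel e e';
  elemVK : cancel e' e;
  elem_cont : continuous e;
  elem_contV : continuous e';
  elem_period : forall p, e (p.1 + 2, p.2) = ((e p).1 + 2, (e p).2);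
  elem_out : forall p, 2^-1 <= `|p.2| -> e p = p;
  elem_disp : exists C, forall p, `|(e p).1 - p.1| <= C;
  elem_dir : ((forall p, (e p).2 = p.2) /\
              (forall p q, p.2 = q.2 -> p.1 < q.1 -> (e p).1 < (e q).1)) \/
             ((forall p, (e p).1 = p.1) /\
              (forall p q, p.1 = q.1 -> p.2 < q.2 -> (e p).2 < (e q).2)) }.

Definition in_band X : Prop := forall a, `|(X a).2| <= 2^-1.

Lemma elem_periodz e e' p m : elementary e e' ->
  e (p.1 + 2 * m%:~R, p.2) = ((e p).1 + 2 * m%:~R, (e p).2).
Proof.
move=> E; have S (k : nat) : k.+1%:Z%:~R = k%:Z%:~R + 1 :> R by rewrite -!pmulrn -natr1.
elim/int_rect: m => [|k IH|k IH].
- by rewrite !mulr0 !addr0; case: p => ? ? /=; case: (e _).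
- have -> : p.1 + 2 * k.+1%:Z%:~R = p.1 + 2 * k%:Z%:~R + 2 by rewrite S; ring.
  by rewrite (elem_period E (_, _)) IH /= S; congr pair; ring.
- have := elem_period E (p.1 + 2 * (- k.+1%:Z)%:~R, p.2); rewrite /= !rmorphN/= S.
  have -> : p.1 + 2 * - (k%:Z%:~R + 1) + 2 = p.1 + 2 * (- k%:Z)%:~R.
    by rewrite rmorphN/=; ring.
  rewrite IH !rmorphN/= => -[h1 h2]; rewrite [LHS]surjective_pairing -h2; congr pair.
  by rewrite -[LHS](addrK 2) -h1; ring.
Qed.

Lemma in_band_elem e e' X : elementary e e' -> in_band X -> in_band (e \o X).
Proof.
move=> E bX a /=; have := bX a; rewrite !ler_norml; set p := X a => /andP[h1 h2].
case: (elem_dir E) => [[-> _]|[_ mono]]; first by rewrite h1 h2.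
have half0 : 0 < 2^-1 :> R by rewrite invr_gt0.
have out1 : e (p.1, - 2^-1) = (p.1, - 2^-1).
  by apply: (elem_out E); rewrite /= normrN ger0_norm ?lexx //; exact: ltW.
have out2 : e (p.1, 2^-1) = (p.1, 2^-1).
  by apply: (elem_out E); rewrite /= ger0_norm ?lexx //; exact: ltW.
apply/andP; split.
  move: h1; rewrite le_eqVlt => /orP[/eqP h|h]; last first.
    by have := mono (p.1, - 2^-1) p erefl h; rewrite out1 => /ltW.
  have -> : p = (p.1, - 2^-1) by rewrite h -surjective_pairing.
  by rewrite out1.
move: h2; rewrite le_eqVlt => /orP[/eqP h|h]; last first.
  by have := mono p (p.1, 2^-1) erefl h; rewrite out2 => /ltW.
have -> : p = (p.1, 2^-1) by rewrite -h -surjective_pairing.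
by rewrite out2.
Qed.

Lemma copy_elem e e' X z : elementary e e' -> is_copy X (e' z) -> is_copy (e \o X) z.
Proof.
move=> E [a [m h]]; exists a, m; rewrite -(elemVK E z) h.
by rewrite (elem_periodz _ _ E).
Qed.

Section VerticalMaps.
Variables (e e' : R * R -> R * R) (X : config).
Hypotheses (E : elementary e e') (bX : in_band X).
Hypothesis e1 : forall p, (e p).1 = p.1.
Hypothesis e2 : forall p q, p.1 = q.1 -> p.2 < q.2 -> (e p).2 < (e q).2.

Let e2E p q : p.1 = q.1 -> ((e p).2 < (e q).2) = (p.2 < q.2).
Proof.
move=> pq; case: (ltgtP p.2 q.2) => [h|h|h]; first exact: e2.
  by apply/negbTE; rewrite -leNgt; apply/ltW/e2.
have -> : p = q by rewrite [p]surjective_pairing pq h -surjective_pairing.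
by rewrite ltxx.
Qed.

Let e2_eq p q : p.1 = q.1 -> ((e p).2 == (e q).2) = (p.2 == q.2).
Proof.
by move=> pq; rewrite !eq_le !leNgt !e2E//.
Qed.

Let e1V z : (e' z).1 = z.1.
Proof. by rewrite -{2}(elemVK E z) e1. Qed.

Let tie_vert a b m : (X b).1 + 2 * m%:~R = (X a).1 ->
  (tie (e \o X) b < tie (e \o X) a)%O = (tie X b < tie X a)%O.
Proof.
move=> h; rewrite /tie !(@ltxi_pair _ _ _ R nat) /= !lerN2 !leNgt.
have Eb : (e (X b)).2 = (e ((X b).1 + 2 * m%:~R, (X b).2)).2 by rewrite (elem_periodz _ _ E).
by rewrite !Eb !e2E ?h.
Qed.

Lemma mat_vertical : mat (e \o X) = mat X.
Proof.
apply/funext => a; apply/funext => b; rewrite /mat /gaps; apply: int_ltP => k.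
rewrite !cntP /copy !lt_locE /= !e1 mulr0 addr0.
case: (ltgtP ((X b).1 + 2 * k%:~R) (X a).1) => //= h.
by rewrite (tie_vert h).
Qed.

Lemma gaps_high Y (u y : R) : in_band Y -> 2^-1 < y ->
  gaps Y (atp (u, y)) = (fun b => Num.ceil ((u - (Y b).1) / 2)).
Proof.
move=> bY hy; apply/funext => b; rewrite /gaps /cnt /atp [(_, _).1]/fst [(_, _).2]/snd.
have -> : (tie Y b < (- y, 0%N) :> (R *l nat)%type)%O = false.
  apply/negbTE/(@tie_low _ _ _ _ (u, y)); apply: le_lt_trans hy.
  by have := bY b; rewrite ler_norml => /andP[].
by [].
Qed.

Lemma topE : top R = atp (0, 2). Proof. by []. Qed.

Lemma gaps_high_vertical (u y : R) : 2^-1 < y -> gaps (e \o X) (atp (u, y)) = gaps X (atp (u, y)).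
Proof.
move=> hy; rewrite !gaps_high//; last exact: in_band_elem E bX.
by apply/funext => b /=; rewrite e1.
Qed.

Lemma half_lt2 : 2^-1 < 2 :> R. Proof. lra. Qed.

Lemma move_vertical : move X (e \o X).
Proof. by right; split; [exact: mat_vertical|rewrite topE gaps_high_vertical//; exact: half_lt2]. Qed.

Let cnt_low Y z a : (Y a).2 < z.2 -> cnt Y a (atp z) = Num.ceil ((z.1 - (Y a).1) / 2).
Proof. by move=> /tie_low h; rewrite /cnt (negbTE h). Qed.

Lemma ray_vertical rho z z' : ray X rho (e' z) (e' z') = ray (e \o X) rho z z'.
Proof.
rewrite /ray !e1V; case: ifP => // _.
have lowE a : (X a).1 + 2 * (Num.ceil ((z.1 - (X a).1) / 2))%:~R = z.1 ->
    ((e (X a)).2 < z.2) = ((X a).2 < (e' z).2).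
  move=> h; rewrite -{1}(elemVK E z).
  have -> : (e (X a)).2 = (e ((X a).1 + 2 * (Num.ceil ((z.1 - (X a).1) / 2))%:~R, (X a).2)).2.
    by rewrite (elem_periodz _ _ E).
  by rewrite e2E// h e1V.
have predE a : ((e (X a)).2 < z.2) && ((X a).1 + 2 * (cnt (e \o X) a (atp z))%:~R == z.1) =
    ((X a).2 < (e' z).2) && ((X a).1 + 2 * (cnt X a (atp (e' z)))%:~R == z.1).
  apply/andP/andP => -[h1 /eqP h2].
    rewrite cnt_low// e1 in h2; have h3 := h1; rewrite lowE// in h3.
    by rewrite h3 cnt_low// e1V h2.
  rewrite cnt_low// e1V in h2; have h3 := h1; rewrite -lowE// in h3.
  by rewrite h3 cnt_low//= e1 h2.
have stackE : stack X (e' z) = stack (e \o X) z.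
  rewrite /stack /sigma !filter_sort; try by [move=> ? ?; exact: le_total|
    move=> ? ? ?; exact: le_trans].
  have -> : [seq a <- enum 'I_n | ((X a).2 < (e' z).2) &&
        ((X a).1 + 2 * (cnt X a (atp (e' z)))%:~R == (e' z).1)] =
      [seq a <- enum 'I_n | (((e \o X) a).2 < z.2) &&
        (((e \o X) a).1 + 2 * (cnt (e \o X) a (atp z))%:~R == z.1)].
    by apply: eq_filter => a /=; rewrite e1 predE e1V.
  apply: sort_eq_in; try by [move=> ? ?; exact: le_total|move=> ? ? ?; exact: le_trans|
    move=> a b /le_anti [_ /val_inj]].
  move=> a b; rewrite !mem_filter /= !e1 => /andP[/andP[h1 /eqP h2] _].
  move=> /andP[/andP[h3 /eqP h4] _]; rewrite !leNgt.
  set k := cnt _ a _ in h2; set l := cnt _ b _ in h4.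
  rewrite (@tie_vert a b (l - k))//.
  by rewrite rmorphB/= mulrBr addrA h4 -h2 addrK.
rewrite stackE; have : {in stack (e \o X) z, forall a, cnt X a (atp (e' z)) = cnt (e \o X) a (atp z)}.
  move=> a; have h := predE a; rewrite /stack mem_filter /= e1 => /andP[h1 _].
  have := h1; rewrite h => /andP[h2 _]; case/andP: h1 => h1 _.
  by rewrite !cnt_low//= e1 e1V.
elim: (stack _ z) => //= a s IH h; rewrite h ?mem_head// IH// => b bs; apply: h.
by rewrite inE bs orbT.
Qed.

Lemma trans_near_vertical st z : \forall z' \near z,
  trans_near X st (e' z) (e' z') = trans_near (e \o X) st z z'.
Proof.
have h1 : \forall z' \near z, trans_near X st (e' z) (e' z') = ray X st.1 (e' z) (e' z').
  exact: (elem_contV E (trans_nearE X st (e' z))).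
have h2 := trans_nearE (e \o X) st z.
near=> z'; have -> : trans_near X st (e' z) (e' z') = ray X st.1 (e' z) (e' z') by near: z'.
by rewrite ray_vertical; symmetry; near: z'.
Unshelve. all: by end_near. Qed.
End VerticalMaps.
End Elementary.

Section Elementary.
Variable (R : realType) (n : nat).
Notation row := 'I_n.
Notation vec := (row -> int).
Notation rep := (row -> int -> sl2).
Notation config := (row -> R * R).
Notation state := (rep * (int * int))%type.
Implicit Types (X Y : config) (a b : row) (x : loc R) (m : int) (v : vec) (rho : rep).
Implicit Types (st : state) (s : seq row) (z p : R * R) (e : R * R -> R * R).

Lemma transport_cat_eq s t (G : rep) v v' : {in t, forall a, v a = v' a} ->
  ((transport (t ++ s) G v)^-1 * transport (t ++ s) G v' =
   (transport s G v)^-1 * transport s G v')%g.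
Proof.
elim: t => //= a t IH h; rewrite -IH => [|b bt]; last by apply: h; rewrite inE bt orbT.
by rewrite (h a) ?mem_head// invgM -!mulgA mulKg.
Qed.

Lemma low_cat X z z' : z.2 <= z'.2 ->
  low X z' = [seq a <- sigma X | z.2 <= (X a).2 < z'.2] ++ low X z.
Proof.
move=> zz'; rewrite /low; have : sorted (fun a b => (X b).2 <= (X a).2) (sigma X).
  by apply: sub_sorted (sigma_sorted X) => a b; exact: tie_le_height.
elim: (sigma X) => //= a s IH pa; have so := path_sorted pa; rewrite IH//.
have [az|za] := ltP (X a).2 z.2.
  rewrite (lt_le_trans az zz') /=.
  have all_low b : b \in s -> (X b).2 < z.2.
    move: pa; rewrite (path_sortedE (fun _ _ _ h1 h2 => le_trans h2 h1)) => /andP[/allP h _].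
    by move=> /h /le_lt_trans; exact.
  have -> : [seq b <- s | z.2 <= (X b).2 < z'.2] = [::].
    apply/eqP; rewrite -size_eq0 size_filter -leqn0 leqNgt -has_count; apply/hasPn => b bs.
    by rewrite leNgt all_low.
  by [].
by case: ifP.
Qed.

Section HorizontalMaps.
Variables (e e' : R * R -> R * R) (X : config) (st : state).
Hypotheses (E : elementary e e') (bX : in_band X).
Hypothesis e1 : forall p, (e p).2 = p.2.
Hypothesis e2 : forall p q, p.2 = q.2 -> p.1 < q.1 -> (e p).1 < (e q).1.
Let Y : config := e \o X.
Let G := gauge X st.

Let e2E p q : p.2 = q.2 -> ((e p).1 < (e q).1) = (p.1 < q.1).
Proof.
move=> pq; case: (ltgtP p.1 q.1) => [h|h|h]; first exact: e2.
  by apply/negbTE; rewrite -leNgt; apply/ltW/e2.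
have -> : p = q by rewrite [p]surjective_pairing h pq -surjective_pairing.
by rewrite ltxx.
Qed.

Let e1V z : (e' z).2 = z.2.
Proof. by rewrite -{2}(elemVK E z) e1. Qed.

Let sigmaY : sigma Y = sigma X.
Proof. by apply: sigma_horizontal => a; rewrite /Y/= e1. Qed.

Let lowY z : low Y z = low X (e' z).
Proof. by rewrite /low sigmaY e1V; apply: eq_filter => a; rewrite /Y/= e1. Qed.

Lemma move_horizontal : move X Y.
Proof. by left=> a; rewrite /Y/= e1. Qed.

Definition kappa z : sl2 := ((transport (low Y z) G (gaps Y (atp z)))^-1 *
  transport (low Y z) G (gaps X (atp (e' z))))%g.

Let cnt_row z a : ~ is_copy Y z -> (X a).2 = z.2 -> \forall z' \near z,
  cnt Y a (atp z') = cnt X a (atp (e' z')).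
Proof.
move=> nz az; set d := (z.1 - (Y a).1) / 2; pose m := Num.floor d.
have hd1 : m%:~R <= d by rewrite -floor_ge_int.
have hd2 : d < (m + 1)%:~R by rewrite -floor_lt_int -/m ltzD1.
have nd : m%:~R != d.
  apply/eqP => dE; apply: nz; exists a, m; rewrite dE /d /Y/= e1 az.
  by rewrite [LHS]surjective_pairing; congr pair; field.
have h1 : (Y a).1 + 2 * m%:~R < z.1.
  by have : m%:~R < d by [rewrite lt_neqAle nd]; rewrite /d; lra.
have h2 : z.1 < (Y a).1 + 2 * (m + 1)%:~R by rewrite /d in hd2; lra.
have copyE k : (e ((X a).1 + 2 * k%:~R, (X a).2)).1 = (Y a).1 + 2 * k%:~R.
  by rewrite (elem_periodz _ _ E).
have h3 : (X a).1 + 2 * m%:~R < (e' z).1.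
  by rewrite -(@e2E ((X a).1 + 2 * m%:~R, (X a).2) (e' z)) ?e1V// copyE (elemVK E).
have h4 : (e' z).1 < (X a).1 + 2 * (m + 1)%:~R.
  by rewrite -(@e2E (e' z) ((X a).1 + 2 * (m + 1)%:~R, (X a).2)) ?e1V// copyE (elemVK E).
have c1 : (fun z' : R * R => z'.1) @ z --> z.1 by exact: cvg_fst.
have c2 : (fun z' : R * R => (e' z').1) @ z --> (e' z).1.
  have cf : continuous (@fst R R) by move=> p; exact: cvg_fst.
  exact: (@continuous_comp _ _ _ e' (@fst R R) z (@elem_contV _ _ _ E z) (@cf _)).
have n1 : \forall z' \near z, (Y a).1 + 2 * m%:~R < z'.1 by exact: cvgr_gt c1 _ h1.
have n2 : \forall z' \near z, z'.1 < (Y a).1 + 2 * (m + 1)%:~R by exact: cvgr_lt c1 _ h2.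
have n3 : \forall z' \near z, (X a).1 + 2 * m%:~R < (e' z').1 by exact: cvgr_gt c2 _ h3.
have n4 : \forall z' \near z, (e' z').1 < (X a).1 + 2 * (m + 1)%:~R by exact: cvgr_lt c2 _ h4.
near=> z'.
have g1 : (Y a).1 + 2 * m%:~R < z'.1 by near: z'.
have g2 : z'.1 < (Y a).1 + 2 * (m + 1)%:~R by near: z'.
have g3 : (X a).1 + 2 * m%:~R < (e' z').1 by near: z'.
have g4 : (e' z').1 < (X a).1 + 2 * (m + 1)%:~R by near: z'.
rewrite /atp (@cnt_mid _ _ _ _ _ _ m) ?(@cnt_mid _ _ X _ _ _ m)//; lra.
Unshelve. all: by end_near. Qed.

Let cnt_between z a : ~ is_copy Y z -> \forall z' \near z,
  ((z.2 <= (X a).2 < z'.2) || (z'.2 <= (X a).2 < z.2)) ->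
  cnt Y a (atp z') = cnt X a (atp (e' z')).
Proof.
move=> nz; have c2 : (fun z' : R * R => z'.2) @ z --> z.2 by exact: cvg_snd.
case: (ltgtP (X a).2 z.2) => az.
- have n1 : \forall z' \near z, (X a).2 < z'.2 by exact: cvgr_gt c2 _ az.
  near=> z'; rewrite /= andbT leNgt.
  by have -> : (X a).2 < z'.2 by near: z'.
- have n1 : \forall z' \near z, z'.2 < (X a).2 by exact: cvgr_lt c2 _ az.
  near=> z'; rewrite /= andbF orbF ltNge.
  by rewrite ltW//; near: z'.
- by apply: filterS (cnt_row nz az) => z'.
Unshelve. all: by end_near. Qed.

Lemma trans_near_horizontal z : ~ is_copy Y z -> \forall z' \near z,
  (kappa z * trans_near X st (e' z) (e' z') =
   trans_near Y (step X Y st) z z' * kappa z')%g.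
Proof.
move=> nz; have : \forall z' \near z, forall a,
    ((z.2 <= (X a).2 < z'.2) || (z'.2 <= (X a).2 < z.2)) ->
    cnt Y a (atp z') = cnt X a (atp (e' z')).
  by apply: (near_forall (z := nbhs z)) => a; exact: cnt_between.
apply: filterS => z' h; rewrite /kappa /trans_near -!lowY.
have -> : gauge Y (step X Y st) = G by apply: gauge_horizontal => a; rewrite /Y/= e1.
rewrite -/G -!mulgA mulVKg; congr (_ * _)%g.
rewrite mulgA; set Q := fun s v => transport s G v.
have main : forall u u' : R * R, u.2 <= u'.2 -> (forall a, u.2 <= (X a).2 < u'.2 ->
    cnt Y a (atp z') = cnt X a (atp (e' z'))) ->
   ((Q (low Y u') (gaps Y (atp z')))^-1 * Q (low Y u') (gaps X (atp (e' z'))) =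
    (Q (low Y u) (gaps Y (atp z')))^-1 * Q (low Y u) (gaps X (atp (e' z'))))%g.
  move=> u u' uu' h'; rewrite (low_cat _ uu'); apply: transport_cat_eq => a.
  by rewrite mem_filter {1 2}/Y /= !e1 => /andP[h1 _]; exact: h'.
apply: (mulgI (Q (low Y z) (gaps Y (atp z')))^-1%g); rewrite -/(Q _ _) !mulgA mulVg mul1g.
have [zz'|/ltW z'z] := leP z.2 z'.2.
  by rewrite (main z z')// => a ha; apply: h; rewrite ha.
by rewrite -(main z' z)// => a ha; apply: h; rewrite ha orbT.
Qed.
End HorizontalMaps.

Section Chains.
Implicit Types es : seq ((R * R -> R * R) * (R * R -> R * R)).

Fixpoint traj X es : seq config :=
  if es is e :: es' then (e.1 \o X) :: traj (e.1 \o X) es' else [::].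
Fixpoint fwd es (p : R * R) : R * R := if es is e :: es' then fwd es' (e.1 p) else p.
Fixpoint bwd es (p : R * R) : R * R := if es is e :: es' then e.2 (bwd es' p) else p.
Fixpoint chain es : Prop :=
  if es is e :: es' then elementary e.1 e.2 /\ chain es' else True.

Lemma fwdK es : chain es -> cancel (fwd es) (bwd es).
Proof. by elim: es => //= e es IH [E /IH h] p; rewrite h (elemK E). Qed.
Lemma bwdK es : chain es -> cancel (bwd es) (fwd es).
Proof. by elim: es => //= e es IH [E /IH h] p; rewrite (elemVK E) h. Qed.

Lemma bwd_continuous es : chain es -> continuous (bwd es).
Proof.
elim: es => [_ ?|e es IH [E c] p /=]; first exact: cvg_id.
by apply: (@continuous_comp _ _ _ (bwd es) e.2); [exact: IH|exact: (elem_contV E)].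
Qed.

Lemma fwd_continuous es : chain es -> continuous (fwd es).
Proof.
elim: es => [_ ?|e es IH [E c] p /=]; first exact: cvg_id.
by apply: (@continuous_comp _ _ _ e.1 (fwd es)); [exact: (elem_cont E)|exact: IH].
Qed.

Lemma last_traj X es : last X (traj X es) = fwd es \o X.
Proof. by elim: es X => //= e es IH X; rewrite IH. Qed.

Lemma traj_cat X es es' : traj X (es ++ es') = traj X es ++ traj (fwd es \o X) es'.
Proof. by elim: es X => //= e es IH X; rewrite IH. Qed.

Lemma chain_cat es es' : chain (es ++ es') <-> chain es /\ chain es'.
Proof.
elim: es => [|e es IH] /=; first by split=> [|[]].
by split=> [[? /IH[]]|[[? ?] ?]]; do ?split=> //; apply/IH.
Qed.

Lemma fwd_cat es es' p : fwd (es ++ es') p = fwd es' (fwd es p).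
Proof. by elim: es p => //= e es IH p; rewrite IH. Qed.
Lemma bwd_cat es es' p : bwd (es ++ es') p = bwd es (bwd es' p).
Proof. by elim: es => //= e es IH; rewrite IH. Qed.

Lemma fwd_band X es : chain es -> in_band X -> in_band (fwd es \o X).
Proof.
elim: es X => //= e es IH X [E c] bX; exact: IH c (in_band_elem E bX).
Qed.

Lemma bwd_out es p : chain es -> 2^-1 <= `|p.2| -> bwd es p = p.
Proof.
by elim: es => //= e es IH [E c] h; rewrite IH// -{1}(elem_out E h) (elemK E).
Qed.

Lemma moves_traj X es : chain es -> in_band X -> moves X (traj X es).
Proof.
elim: es X => //= e es IH X [E c] bX; split; last exact: IH (in_band_elem E bX).
case: (elem_dir E) => [[h1 h2]|[h1 h2]]; first by left=> a /=; rewrite h1.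
exact: (move_vertical E bX h1 h2).
Qed.

Lemma copy_chain X es z : chain es -> is_copy X (bwd es z) -> is_copy (fwd es \o X) z.
Proof.
elim: es X z => //= e es IH X z [E c] h.
exact: (IH (e.1 \o X) z c (copy_elem E h)).
Qed.

Lemma gauge_chain X es st : chain es -> in_band X -> exists k : R * R -> sl2,
  [/\ forall z, ~ is_copy (fwd es \o X) z -> \forall z' \near z,
      (k z * trans_near X st (bwd es z) (bwd es z') =
       trans_near (fwd es \o X) (run X (traj X es) st) z z' * k z')%g,
    forall z, z.2 <= - 2^-1 -> k z = 1%g &
    forall z, 2^-1 < z.2 -> pos (fwd es \o X) (run X (traj X es) st) (gaps (fwd es \o X) (atp z)) =
      act (k z) (pos X st (gaps X (atp z)))].
Proof.
elim: es X st => [|e es IH] X st /=.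
  move=> _ bX; exists (fun=> 1%g); split => // z; last by rewrite act1.
  by move=> _; near=> z'; rewrite mul1g mulg1.
move=> [E c] bX; have bY := in_band_elem E bX.
have [k [k1 k2 k3]] := IH (e.1 \o X) (step X (e.1 \o X) st) c bY.
have [k' [k1' k2' k3']] : exists k : R * R -> sl2,
    [/\ forall z, ~ is_copy (e.1 \o X) z -> \forall z' \near z,
      (k z * trans_near X st (e.2 z) (e.2 z') =
       trans_near (e.1 \o X) (step X (e.1 \o X) st) z z' * k z')%g,
    forall z, z.2 <= - 2^-1 -> k z = 1%g &
    forall z, 2^-1 < z.2 -> pos (e.1 \o X) (step X (e.1 \o X) st) (gaps (e.1 \o X) (atp z)) =
      act (k z) (pos X st (gaps X (atp z)))].
  case: (elem_dir E) => [[h1 h2]|[h1 h2]].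
    have XY a : ((e.1 \o X) a).2 = (X a).2 by rewrite /= h1.
    exists (kappa e.1 e.2 X st); split.
    - exact: (trans_near_horizontal st E h1 h2).
    - move=> z hz; rewrite /kappa; have -> : low (e.1 \o X) z = [::].
        rewrite /low; apply/eqP; rewrite -size_eq0 size_filter -leqn0 leqNgt -has_count.
        apply/hasPn => b _; rewrite -leNgt; apply: le_trans hz _.
        by have := bY b; rewrite ler_norml => /andP[].
      by rewrite /= mulVg.
    - move=> z hz; rewrite (pos_horizontal _ XY) /kappa.
      have -> : low (e.1 \o X) z = sigma X.
        rewrite /low (sigma_horizontal XY); apply/all_filterP/allP => b _.
        by apply: le_lt_trans hz; have := bY b; rewrite ler_norml => /andP[].
      have -> : e.2 z = z.
        rewrite -{1}(elem_out E (p := z)) ?(elemK E)//.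
        by apply: ltW; apply: lt_le_trans hz (ler_norm _).
      by rewrite /pos /dev actM actKV.
  have mE := mat_vertical X E h1 h2.
  have tE : gaps (e.1 \o X) (top R) = gaps X (top R).
    by rewrite topE (gaps_high_vertical E bX h1)//; exact: half_lt2.
  exists (fun=> 1%g); rewrite (step_vertical st mE tE); split => // z.
    by move=> _; apply: filterS (trans_near_vertical X E h1 h2 st z) => z' ->; rewrite mul1g mulg1.
  by move=> hz; rewrite act1 [z]surjective_pairing (gaps_high_vertical E bX h1)// pos_vertical.
exists (fun z => k z * k' (bwd es z))%g; split.
- move=> z nz; have nz' : ~ is_copy (e.1 \o X) (bwd es z).
    by move=> h; exact: nz (copy_chain c h).
  have h1 := k1 _ nz.
  have h2 := bwd_continuous c (k1' _ nz').
  near=> z'.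
  have g1 : (k z * trans_near (e.1 \o X) (step X (e.1 \o X) st) (bwd es z) (bwd es z') =
       trans_near (fwd es \o (e.1 \o X)) (run (e.1 \o X) (traj (e.1 \o X) es) (step X (e.1 \o X) st))
         z z' * k z')%g by near: z'.
  have g2 : (k' (bwd es z) * trans_near X st (e.2 (bwd es z)) (e.2 (bwd es z')) =
       trans_near (e.1 \o X) (step X (e.1 \o X) st) (bwd es z) (bwd es z') * k' (bwd es z'))%g.
    by near: z'.
  by rewrite -mulgA g2 mulgA g1 mulgA.
- by move=> z hz; rewrite k2// mul1g bwd_out// ?k2'//; rewrite ler_normr; apply/orP; right; lra.
- move=> z hz; rewrite k3// k3'//; rewrite bwd_out ?actM//.
  by apply: ltW; apply: lt_le_trans hz (ler_norm _).
Unshelve. all: by end_near. Qed.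
End Chains.
End Elementary.

Section Invariance.
Variable (R : realType) (n : nat).
Notation row := 'I_n.
Notation vec := (row -> int).
Notation rep := (row -> int -> sl2).
Notation config := (row -> R * R).
Notation state := (rep * (int * int))%type.
Implicit Types (X Y : config) (a b : row) (x : loc R) (m : int) (v : vec) (rho : rep).
Implicit Types (st : state) (s : seq row) (z p : R * R) (e : R * R -> R * R).
Implicit Types es : seq ((R * R -> R * R) * (R * R -> R * R)).

Lemma line_left_of_zero Y : in_band Y -> \forall u \near (0 : R)^'-,
  gaps Y (atp (u, 1)) = gaps Y (top R) /\ forall y, ~ is_copy Y (u, y).
Proof.
move=> bY; have : \forall u \near (0 : R)^'-, forall b : row,
    (Num.ceil ((0 - (Y b).1) / 2) - 1)%:~R * 2 + (Y b).1 < u.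
  apply: (near_forall (z := (0 : R)^'-)) => b; apply: nbhs_left_gt.
  have : (Num.ceil ((0 - (Y b).1) / 2) - 1)%:~R < (0 - (Y b).1) / 2.
    by rewrite ltNge -ceil_le_int -ltNge ltrBlDr ltrDl.
  lra.
move=> h; near=> u.
have u0 : u < 0 by near: u; exact: nbhs_left_lt.
have hu : forall b : row, (Num.ceil ((0 - (Y b).1) / 2) - 1)%:~R * 2 + (Y b).1 < u by near: u.
have h2 b : (0 - (Y b).1) / 2 <= (Num.ceil ((0 - (Y b).1) / 2))%:~R by rewrite -ceil_le_int.
split=> [|y [b [m [uE _]]]].
  rewrite topE !gaps_high//; [|exact: half_lt2|lra].
  apply/funext => b; apply: ceil_def; have := hu b; have := h2 b.
  by move: (Num.ceil _) => c ? ?; apply/andP; split; lra.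
have := hu b; have := h2 b; rewrite uE; move: (Num.ceil _) => c h3 h4.
have h5 : (c - 1)%:~R < m%:~R :> R by lra.
have h6 : m%:~R < c%:~R :> R by rewrite uE in u0; lra.
by move: h5 h6; rewrite !ltr_int; lia.
Unshelve. all: by end_near. Qed.

Lemma twist_pos X Ys : twist X Ys =
  slope (pos (last X Ys) (run X Ys (std X)) (gaps (last X Ys) (top R))).
Proof. by rewrite pos_top. Qed.

Lemma slope_act_same g (u w : int * int) : same u w -> slope (act g u) = slope (act g w).
Proof. by move=> /(same_act g) /same_slope. Qed.

Lemma twist_unique X X' es es' : in_band X -> in_band X' -> chain es -> chain es' ->
  bwd es =1 bwd es' ->
  (forall z, \forall z' \near z, trans_near X (std X) z z' = trans_near X' (std X') z z') ->
  (forall z, is_copy (fwd es \o X) z <-> is_copy (fwd es' \o X') z) ->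
  (forall z, 2^-1 < z.2 -> same (pos X (std X) (gaps X (atp z))) (pos X' (std X') (gaps X' (atp z)))) ->
  twist X (traj X es) = twist X' (traj X' es').
Proof.
move=> bX bX' c c' bE tE cE pE.
have [k [k1 k2 k3]] := gauge_chain (std X) c bX.
have [k' [k1' k2' k3']] := gauge_chain (std X') c' bX'.
have bY := fwd_band c bX; have bY' := fwd_band c' bX'.
have n1 := line_left_of_zero bY; have n2 := line_left_of_zero bY'.
have [u [[g1 g2] [g3 _]]] : exists u : R,
    (gaps (fwd es \o X) (atp (u, 1)) = gaps (fwd es \o X) (top R) /\
      forall y, ~ is_copy (fwd es \o X) (u, y)) /\
    (gaps (fwd es' \o X') (atp (u, 1)) = gaps (fwd es' \o X') (top R) /\
      forall y, ~ is_copy (fwd es' \o X') (u, y)).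
  exact: (@filter_ex _ _ (at_left_proper_filter 0) _ (filterI n1 n2)).
pose f (s : R) := (k (u, s) * (k' (u, s))^-1)%g.
have line (s : R) (P : R * R -> Prop) : (\forall z \near (u, s), P z) -> \forall t \near s, P (u, t).
  by move=> h; exact: (@cvg_pair R R R (nbhs s) (nbhs u) (nbhs s) _ _ _ (fun=> u) id
    (cvg_cst _) cvg_id P h).
have one Y st (s : R) : \forall t \near s, trans_near Y st (u, s) (u, t) = 1%g.
  apply: filterS (line s _ (trans_nearE Y st (u, s))) => t /= ->.
  by rewrite /ray /= ltxx.
have fE : f (-1) = f 1.
  apply: locally_constant => s.
  have m1 := line s _ (k1 _ (g2 s)).
  have ng : ~ is_copy (fwd es' \o X') (u, s) by move=> /cE; exact: g2.
  have m2 := line s _ (k1' _ ng).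
  have m3 := line s _ (@bwd_continuous _ _ c (u, s) _ (tE (bwd es (u, s)))).
  have m4 := one (fwd es \o X) (run X (traj X es) (std X)) s.
  have m5 := one (fwd es' \o X') (run X' (traj X' es') (std X')) s.
  near=> t.
  have e1 : (k (u, s) * trans_near X (std X) (bwd es (u, s)) (bwd es (u, t)) =
     trans_near (fwd es \o X) (run X (traj X es) (std X)) (u, s) (u, t) * k (u, t))%g by near: t.
  have e2 : (k' (u, s) * trans_near X' (std X') (bwd es' (u, s)) (bwd es' (u, t)) =
     trans_near (fwd es' \o X') (run X' (traj X' es') (std X')) (u, s) (u, t) * k' (u, t))%g by near: t.
  have e3 : trans_near X (std X) (bwd es (u, s)) (bwd es (u, t)) =
     trans_near X' (std X') (bwd es (u, s)) (bwd es (u, t)) by near: t.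
  have e4 : trans_near (fwd es \o X) (run X (traj X es) (std X)) (u, s) (u, t) = 1%g by near: t.
  have e5 : trans_near (fwd es' \o X') (run X' (traj X' es') (std X')) (u, s) (u, t) = 1%g.
    by near: t.
  rewrite e4 mul1g in e1; rewrite e5 mul1g in e2.
  rewrite /f -e1 -e2 e3 -!bE; set T := trans_near _ _ _ _.
  by rewrite invgM mulgA mulgK.
have kE : k (u, 1) = k' (u, 1).
  have f1 : f (-1) = 1%g by rewrite /f k2 ?k2' ?mulgV//=; lra.
  by move: fE; rewrite f1 /f => E; rewrite -[LHS](mulgVK (k' (u, 1))) -E mul1g.
rewrite !twist_pos !last_traj -g1 -g3 k3 ?k3' /=; try lra.
by rewrite kE; apply: slope_act_same; apply: pE => /=; lra.
Unshelve. all: by end_near. Qed.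

Lemma twist_composite X es es' : in_band X -> chain es -> chain es' ->
  fwd es =1 fwd es' -> twist X (traj X es) = twist X (traj X es').
Proof.
move=> bX c c' fE; apply: twist_unique => //.
- by move=> z; rewrite -{1}(bwdK c' z) -fE (fwdK c).
- by move=> z; near=> z'.
- by move=> z; have -> : fwd es \o X = fwd es' \o X by apply/funext => a /=.
- by move=> z _; exact: same_refl.
Unshelve. all: by end_near. Qed.

Section Relabel.
Variables (X X' : config) (k : vec).
Hypothesis X'E : forall a, X' a = ((X a).1 + 2 * (k a)%:~R, (X a).2).

Lemma tie_relabel a : tie X' a = tie X a.
Proof. by rewrite /tie X'E. Qed.

Lemma copy_relabel a m : copy X' a m = copy X a (m + k a).
Proof. by rewrite /copy tie_relabel X'E /= rmorphD/= mulrDr addrAC addrA. Qed.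

Lemma cnt_relabel a x : cnt X' a x = cnt X a x - k a.
Proof.
apply: int_ltP => m; have -> : (m < cnt X a x - k a) = (m + k a < cnt X a x) by lia.
by rewrite !cntP copy_relabel.
Qed.

Lemma rank_relabel x x' : rank (gaps X' x) - rank (gaps X' x') = rank (gaps X x) - rank (gaps X x').
Proof.
rewrite /rank -!sumrB; apply: eq_bigr => a _; rewrite /gaps !cnt_relabel; lia.
Qed.

Lemma std_relabel a m : (std X').1 a m = (std X).1 a (m + k a).
Proof. by rewrite /std /= -!gaps_copy copy_relabel rank_relabel. Qed.

Lemma sigma_relabel : sigma X' = sigma X.
Proof.
have h : forall a, tie X' a = tie X a by exact: tie_relabel.
by rewrite /sigma; congr sort; apply/funext => a; apply/funext => b; rewrite !h.
Qed.

Lemma ray_relabel z z' : ray X' (std X').1 z z' = ray X (std X).1 z z'.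
Proof.
have sE : stack X' z = stack X z.
  rewrite /stack sigma_relabel; apply: eq_filter => a.
  rewrite X'E cnt_relabel /=; congr (_ && (_ == _)).
  by rewrite rmorphB/=; ring.
rewrite /ray sE; case: ifP => // _; elim: (stack X z) => //= a s ->.
by rewrite -[turn _]/((std X').1 a _) std_relabel cnt_relabel subrK.
Qed.

Lemma twist_relabel es : in_band X -> chain es -> twist X' (traj X' es) = twist X (traj X es).
Proof.
move=> bX c; have bX' : in_band X' by move=> a; rewrite X'E; exact: bX.
have per p m : fwd es (p.1 + 2 * m%:~R, p.2) = ((fwd es p).1 + 2 * m%:~R, (fwd es p).2).
  by elim: es c p {bX} => //= e es IH [E c] p; rewrite (elem_periodz _ _ E) (IH c).
apply: twist_unique => //.
- move=> z; near=> z'.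
  have -> : trans_near X (std X) z z' = ray X (std X).1 z z'.
    by near: z'; exact: trans_nearE.
  by rewrite -ray_relabel; near: z'; exact: trans_nearE.
- move=> z; split=> -[a [m h]]; exists a.
    exists (k a + m); rewrite h /= X'E per /=; congr pair.
    by rewrite rmorphD/= mulrDr addrA.
  exists (m - k a); rewrite h /= X'E per /=; congr pair.
  by rewrite rmorphB/=; ring.
- move=> z _; apply: same_trans (pos_std X' _) _.
  by rewrite rank_relabel; apply: same_sym; exact: pos_std.
Unshelve. all: by end_near. Qed.
End Relabel.
End Invariance.

Section Image.
Context d d' (T : measurableType d) (T' : measurableType d') (R : realType).
Variables (m : {measure set T -> \bar R}) (f : T -> T').
Hypothesis mf : measurable_fun [set: T] f.

Definition image_measure of measurable_fun [set: T] f : set T' -> \bar R := pushforward m f.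
Let nu := image_measure mf.
Let nu0 : nu set0 = 0%E. Proof. by rewrite /nu /image_measure /pushforward preimage_set0 measure0. Qed.
Let nu_ge0 A : (0 <= nu A)%E. Proof. exact: measure_ge0. Qed.
Let nu_sigma : semi_sigma_additive nu.
Proof.
move=> F mF tF mUF; rewrite /nu /image_measure /pushforward preimage_bigcup.
apply: measure_semi_sigma_additive.
- by move=> n; rewrite -[X in measurable X]setTI; exact: mf.
- apply/trivIsetP => /= i j _ _ ij; rewrite -preimage_setI.
  by move/trivIsetP : tF => /(_ _ _ _ _ ij) ->//; rewrite preimage_set0.
- by rewrite -preimage_bigcup -[X in measurable X]setTI; exact: mf.
Qed.
HB.instance Definition _ := isMeasure.Build _ _ _ nu nu0 nu_ge0 nu_sigma.
End Image.

Section Area.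
Variable R : realType.
Notation lam := (@lebesgue_measure R).
Notation mR := (measurableTypeR R).
Notation plane := (mR * mR)%type.
Definition area : {measure set plane -> \bar R} := (lam \x lam)%E.
Implicit Types (p q : plane) (A B : set plane).

Lemma measurable_shift (c : R) : measurable_fun [set: mR] (fun x : mR => x + c : mR).
Proof. by apply: measurable_funD => //; exact: measurable_cst. Qed.

Lemma lebesgue_translate (c : R) (A : set mR) : measurable A ->
  lam ((fun x => x + c) @^-1` A) = lam A.
Proof.
move=> mA; symmetry; apply: (lebesgue_measure_unique
  (mu := image_measure lam (measurable_shift c))) => // X [[a b] _ <-].
rewrite /= /image_measure /pushforward.
have -> : (fun x : R => x + c) @^-1` `]a, b]%classic = `]a - c, b - c]%classic.
  by apply/seteqP; split => x /=; rewrite !in_itv /= => /andP[? ?]; apply/andP; split; lra.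
rewrite !lebesgue_measure_itv /= !lte_fin ltrD2r; case: ifP => // _.
by rewrite -!EFinB; congr EFin; ring.
Qed.

Lemma areaX (A B : set mR) : measurable A -> measurable B -> area (A `*` B) = (lam A * lam B)%E.
Proof. exact: product_measure1E. Qed.

Lemma area_swap A : measurable A -> area A = (\int[lam]_y lam (ysection A y))%E.
Proof.
move=> mA; apply: (product_measure_unique (m' := (lam \x^ lam)%E)) => // B C mB mC.
by rewrite /= product_measure2E.
Qed.

Lemma measurable_shear1 (k : R) : measurable_fun [set: plane] (fun p : plane => (p.1 + k * p.2, p.2) : plane).
Proof.
apply: measurable_fun_pair => //; apply: measurable_funD => //.
by apply: measurable_funM => //; exact: measurable_cst.
Qed.

Lemma measurable_shear2 (k : R) : measurable_fun [set: plane] (fun p : plane => (p.1, p.2 + k * p.1) : plane).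
Proof.
apply: measurable_fun_pair => //; apply: measurable_funD => //.
by apply: measurable_funM => //; exact: measurable_cst.
Qed.

Lemma area_shear1 (k : R) A : measurable A -> area ((fun p => (p.1 + k * p.2, p.2)) @^-1` A) = area A.
Proof.
move=> mA; have mB : measurable ((fun p : plane => (p.1 + k * p.2, p.2)) @^-1` A).
  by rewrite -[X in measurable X]setTI; exact: measurable_shear1.
rewrite !area_swap//; apply: eq_integral => y _.
rewrite -[RHS](lebesgue_translate (k * y)); last exact: measurable_ysection.
congr (lam _); apply/seteqP; split => x /=; by rewrite /ysection /= !inE.
Qed.

Lemma area_shear2 (k : R) A : measurable A -> area ((fun p => (p.1, p.2 + k * p.1)) @^-1` A) = area A.
Proof.
move=> mA; have mB : measurable ((fun p : plane => (p.1, p.2 + k * p.1)) @^-1` A).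
  by rewrite -[X in measurable X]setTI; exact: measurable_shear2.
rewrite /area /product_measure1; apply: eq_integral => x _; rewrite /comp.
rewrite -[RHS](lebesgue_translate (k * x)); last exact: measurable_xsection.
congr (lam _); apply/seteqP; split => y /=; by rewrite /xsection /= !inE.
Qed.

Lemma measurable_translate (c : R) : measurable_fun [set: plane] (fun p : plane => (p.1 + c, p.2) : plane).
Proof.
by apply: measurable_fun_pair => //; apply: measurable_funD => //; exact: measurable_cst.
Qed.

Lemma area_translate (c : R) A : measurable A -> area ((fun p => (p.1 + c, p.2)) @^-1` A) = area A.
Proof.
move=> mA; have mB : measurable ((fun p : plane => (p.1 + c, p.2)) @^-1` A).
  by rewrite -[X in measurable X]setTI; exact: measurable_translate.
rewrite !area_swap//; apply: eq_integral => y _.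
rewrite -[RHS](lebesgue_translate c); last exact: measurable_ysection.
congr (lam _); apply/seteqP; split => x /=; by rewrite /ysection /= !inE.
Qed.

Lemma lebesgue_slab (a c r : R) : a != 0 -> 0 <= r ->
  lam [set x | `|a * x + c| <= r] = (2 * r / `|a|)%:E.
Proof.
move=> a0 r0; have na : 0 < `|a| by rewrite normr_gt0.
have -> : [set x | `|a * x + c| <= r] = `[- (c / a) - r / `|a|, - (c / a) + r / `|a|]%classic.
  apply/seteqP; split => x /=; rewrite in_itv /=;
    have -> : (`|a * x + c| <= r) = (`|x - - (c / a)| <= r / `|a|); try by
      rewrite ler_pdivlMr// -normrM; congr (`|_| <= _); field.
  - by rewrite ler_distl.
  - by rewrite -ler_distl.
rewrite lebesgue_measure_itv /= lte_fin; case: ifP => [_|].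
  by rewrite -EFinB; congr EFin; ring.
move=> /negbT; rewrite -leNgt => h.
have : 0 <= r / `|a| by rewrite divr_ge0// ltW.
move: h; set u := r / `|a| => h1 h2; have u0 : u = 0 by lra.
by congr EFin; rewrite -mulrA -/u u0 mulr0.
Qed.

Lemma measurable_slab (a c r : R) : measurable [set x : mR | `|a * x + c| <= r].
Proof.
have mf : measurable_fun [set: mR] (fun x : mR => a * x + c : mR).
  apply: measurable_funD; last exact: measurable_cst.
  by apply: measurable_funM => //; exact: measurable_cst.
have -> : [set x : mR | `|a * x + c| <= r] = (fun x : mR => a * x + c) @^-1` `[- r, r]%classic.
  by apply/seteqP; split => x /=; rewrite in_itv /= ler_norml.
by rewrite -[X in measurable X]setTI; apply: mf => //; exact: measurable_itv.
Qed.

Lemma measurable_slabs (a b c d e f r s : R) : measurable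
  [set p : plane | `|a * p.1 + b * p.2 + e| <= r /\ `|c * p.1 + d * p.2 + f| <= s].
Proof.
have mf (u v w z : R) : measurable [set p : plane | `|u * p.1 + v * p.2 + w| <= z].
  have mg : measurable_fun [set: plane] (fun p : plane => u * p.1 + v * p.2 : mR).
    by apply: measurable_funD; apply: measurable_funM => //; exact: measurable_cst.
  rewrite -[X in measurable X]setTI.
  by have := mg measurableT _ (measurable_slab 1 w z); congr measurable;
    apply/seteqP; split => p /=; rewrite mul1r.
by apply: measurableI; exact: mf.
Qed.

Lemma area_slabs (a b c d e f r s : R) : `|a * d - b * c| = 1 -> 0 <= r -> 0 <= s ->
  area [set p | `|a * p.1 + b * p.2 + e| <= r /\ `|c * p.1 + d * p.2 + f| <= s] =
  (4 * r * s)%:E.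
Proof.
wlog a0 : a b c d e f r s / a != 0 => [hw|] det1 r0 s0.
  have [a0|a0] := eqVneq a 0; last exact: hw.
  have c0 : c != 0.
    by apply: contra_eq_neq det1 => ->; rewrite a0 mul0r mulr0 subr0 normr0 eq_sym oner_neq0.
  have := hw c d a b f e s r c0; rewrite distrC (mulrC c) (mulrC d) => /(_ det1 s0 r0) h.
  rewrite -[RHS]/((4 * r * s)%:E) -mulrA (mulrC r) mulrA -h.
  by congr (area _); apply/seteqP; split => p /= [? ?]; split.
pose D := a * d - b * c; pose g := D / a.
have D0 : D != 0 by rewrite -normr_gt0 /D det1.
have g0 : g != 0 by rewrite /g mulf_neq0// invr_neq0.
pose S : set plane := [set x | `|a * x + e| <= r] `*` [set y | `|g * y + f| <= s].
have mS : measurable S by apply: measurableX; exact: measurable_slab.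
pose S1 := (fun p : plane => (p.1, p.2 + c / g * p.1)) @^-1` S.
have mS1 : measurable S1 by rewrite -[X in measurable X]setTI; exact: measurable_shear2.
have -> : [set p | `|a * p.1 + b * p.2 + e| <= r /\ `|c * p.1 + d * p.2 + f| <= s] =
    (fun p : plane => (p.1 + b / a * p.2, p.2)) @^-1` S1.
  apply/seteqP; split => p; rewrite /S1 /S /=.
    have -> : a * (p.1 + b / a * p.2) + e = a * p.1 + b * p.2 + e by field.
    have -> : g * (p.2 + c / g * (p.1 + b / a * p.2)) + f = c * p.1 + d * p.2 + f.
      by rewrite mulrDr !mulrA (mulrC g c) mulfK// /g /D; field.
    by [].
  have -> : a * (p.1 + b / a * p.2) + e = a * p.1 + b * p.2 + e by field.
  have -> : g * (p.2 + c / g * (p.1 + b / a * p.2)) + f = c * p.1 + d * p.2 + f.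
    by rewrite mulrDr !mulrA (mulrC g c) mulfK// /g /D; field.
  by [].
rewrite area_shear1// area_shear2// areaX; [|exact: measurable_slab..].
rewrite !lebesgue_slab// -EFinM; congr EFin.
have -> : `|g| = `|a|^-1 by rewrite /g normrM normfV /D det1 mul1r.
by rewrite invrK; field; rewrite normr_eq0.
Qed.
End Area.

Section Boxes.
Variable R : realType.
Notation lam := (@lebesgue_measure R).
Notation mR := (measurableTypeR R).
Notation plane := (mR * mR)%type.
Implicit Types (p q u : plane) (A B : set plane) (nu : {measure set plane -> \bar R}).

Definition box (x y s t : R) : set plane :=
  [set p | x < p.1 <= x + s /\ y < p.2 <= y + t].

Lemma boxE x y s t : box x y s t = `]x, x + s]%classic `*` `]y, y + t]%classic.
Proof. by apply/seteqP; split=> p; rewrite /box /= !in_itv /= => -[? ?]; split. Qed.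

Lemma measurable_box x y s t : measurable (box x y s t).
Proof. by rewrite boxE; apply: measurableX; exact: measurable_itv. Qed.

Lemma area_box x y s t : 0 <= s -> 0 <= t -> area R (box x y s t) = (s * t)%:E.
Proof.
move=> s0 t0; rewrite boxE areaX; [|exact: measurable_itv..].
have L (z r : R) : 0 <= r -> lam `]z, z + r]%classic = r%:E.
  move=> r0; rewrite lebesgue_measure_itv /= lte_fin; case: ifP => [_|].
    by rewrite -EFinB; congr EFin; ring.
  by move=> h; congr EFin; lra.
by rewrite !L.
Qed.

Lemma halving_small (s e : R) : 0 <= s -> 0 < e -> exists k, forall j, (k <= j)%N -> s * 2^-1 ^+ j < e.
Proof.
move=> s0 e0; exists (Num.bound (s / e)) => j kj.
have h1 : s / e < (Num.bound (s / e))%:R by apply: archi_boundP; rewrite divr_ge0// ltW.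
have h2 : (Num.bound (s / e))%:R < 2 ^+ j :> R.
  by rewrite -natrX ltr_nat; apply: leq_ltn_trans kj (ltn_expl _ _).
rewrite exprVn ltr_pdivrMr ?exprn_gt0// mulrC -ltr_pdivrMr//.
exact: lt_trans h1 h2.
Qed.

Section Bisection.
Variables (nu : {measure set plane -> \bar R}) (x0 y0 s t c : R).
Hypotheses (s0 : 0 < s) (t0 : 0 < t).
Let S k := s * 2^-1 ^+ k.
Let T k := t * 2^-1 ^+ k.
Let inside k u := [/\ x0 <= u.1, u.1 + S k <= x0 + s, y0 <= u.2 & u.2 + T k <= y0 + t].
Let small k u := (nu (box u.1 u.2 (S k) (T k)) <= (c * (S k * T k))%:E)%E.
Let bad k u := inside k u /\ ~ small k u.

Let SS k : S k = S k.+1 + S k.+1. Proof. by rewrite /S exprS mulrCA; lra. Qed.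
Let TS k : T k = T k.+1 + T k.+1. Proof. by rewrite /T exprS mulrCA; lra. Qed.
Let S0 k : 0 < S k. Proof. by rewrite /S mulr_gt0// exprn_gt0. Qed.
Let T0 k : 0 < T k. Proof. by rewrite /T mulr_gt0// exprn_gt0. Qed.

Let quarter k u : bad k u -> exists u', [/\ bad k.+1 u', u.1 <= u'.1,
  u'.1 + S k.+1 <= u.1 + S k, u.2 <= u'.2 & u'.2 + T k.+1 <= u.2 + T k].
Proof.
move=> [[h1 h2 h3 h4] ns]; have s1 := S0 k.+1; have t1 := T0 k.+1.
have sE := SS k; have tE := TS k.
apply: contrapT => nex.
have good v : v.1 = u.1 \/ v.1 = u.1 + S k.+1 -> v.2 = u.2 \/ v.2 = u.2 + T k.+1 -> small k.+1 v.
  move=> hv1 hv2; apply: contrapT => nsv; apply: nex; exists v.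
  by have [e1|e1] := hv1; have [e2|e2] := hv2; (split; [split => //; split|..]); rewrite ?e1 ?e2; lra.
apply: ns; rewrite /small.
have sub : box u.1 u.2 (S k) (T k) `<=`
   (box u.1 u.2 (S k.+1) (T k.+1) `|` box (u.1 + S k.+1) u.2 (S k.+1) (T k.+1)) `|`
   (box u.1 (u.2 + T k.+1) (S k.+1) (T k.+1) `|`
    box (u.1 + S k.+1) (u.2 + T k.+1) (S k.+1) (T k.+1)).
  move=> p [/andP[p1 p2] /andP[p3 p4]].
  have [a|a] := leP p.1 (u.1 + S k.+1); have [b|b] := leP p.2 (u.2 + T k.+1).
  - by left; left; rewrite /box /=; split; apply/andP; split; lra.
  - by right; left; rewrite /box /=; split; apply/andP; split; lra.
  - by left; right; rewrite /box /=; split; apply/andP; split; lra.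
  - by right; right; rewrite /box /=; split; apply/andP; split; lra.
have mb := measurable_box.
apply: (le_trans (le_measure nu _ _ sub)); rewrite ?inE; first exact: mb.
  by apply: measurableU; apply: measurableU; exact: mb.
have mU x y x' y' : measurable (box x y (S k.+1) (T k.+1) `|` box x' y' (S k.+1) (T k.+1)).
  by apply: measurableU; exact: mb.
apply: (le_trans (measureU2 nu (mU _ _ _ _) (mU _ _ _ _))).
have -> : c * (S k * T k) = (c * (S k.+1 * T k.+1) + c * (S k.+1 * T k.+1)) +
    (c * (S k.+1 * T k.+1) + c * (S k.+1 * T k.+1)) by rewrite sE tE; ring.
rewrite !EFinD; apply: leeD.
  apply: (le_trans (measureU2 nu (mb _ _ _ _) (mb _ _ _ _))); apply: leeD.
    by apply: (good u); left.
  by apply: (good (u.1 + S k.+1, u.2)); [right|left].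
apply: (le_trans (measureU2 nu (mb _ _ _ _) (mb _ _ _ _))); apply: leeD.
  by apply: (good (u.1, u.2 + T k.+1)); [left|right].
by apply: (good (u.1 + S k.+1, u.2 + T k.+1)); right.
Qed.

Lemma bisection : (forall p, x0 <= p.1 <= x0 + s -> y0 <= p.2 <= y0 + t ->
    exists e, 0 < e /\ forall k x y, x0 <= x -> x + S k <= x0 + s -> y0 <= y -> y + T k <= y0 + t ->
      x <= p.1 <= x + S k -> y <= p.2 <= y + T k -> S k < e -> T k < e ->
      (nu (box x y (S k) (T k)) <= (c * (S k * T k))%:E)%E) ->
  (nu (box x0 y0 s t) <= (c * (s * t))%:E)%E.
Proof.
move=> H; apply: contrapT => nle.
have b0 : bad 0 (x0, y0).
  rewrite /bad /inside /small /S /T !expr0 !mulr1 /=; split => //; split; lra.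
pose next k (u : {u | bad k u}) : {u | bad k.+1 u} :=
  let w := cid (quarter (svalP u)) in exist _ (sval w) (let: And5 h _ _ _ _ := svalP w in h).
pose w k : {u | bad k u} := nat_rect (fun k => {u | bad k u}) (exist _ _ b0) next k.
pose u k := sval (w k).
have ub k : bad k (u k) := svalP (w k).
have uS k : [/\ (u k).1 <= (u k.+1).1, (u k.+1).1 + S k.+1 <= (u k).1 + S k,
    (u k).2 <= (u k.+1).2 & (u k.+1).2 + T k.+1 <= (u k).2 + T k].
  by rewrite /u /=; set v := cid _; case: (svalP v).
have mon (f g : nat -> R) : (forall k, 0 < g k) -> (forall k, f k <= f k.+1) ->
    (forall k, f k.+1 + g k.+1 <= f k + g k) -> exists z, forall k, f k <= z <= f k + g k.
  move=> g0 fS gS.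
  have fm j k : (j <= k)%N -> f j <= f k.
    by move=> jk; apply: (homo_leq (r := fun a b => a <= b)) jk; [|exact: le_trans|].
  have gm j k : (j <= k)%N -> f k + g k <= f j + g j.
    move=> jk; apply: (homo_leq (f := fun k => f k + g k) (r := fun a b => b <= a)) jk => //.
    by move=> a b d h1 h2; exact: le_trans h2 h1.
  have nest j k : f j <= f k + g k.
    case/orP: (leq_total j k) => jk.
      by apply: le_trans (fm _ _ jk) _; rewrite lerDl ltW.
    by apply: le_trans (gm _ _ jk); rewrite lerDl ltW.
  exists (sup (range f)) => k; apply/andP; split.
    apply: sup_upper_bound; last by exists k.
    by split; [exists (f 0); exists 0%N|exists (f k + g k) => _ [j _ <-]].
  by apply: ge_sup; [exists (f 0); exists 0%N|move=> _ [j _ <-]].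
have [p1 hp1] := mon (fun k => (u k).1) S S0 (fun k => let: And4 h _ _ _ := uS k in h)
  (fun k => let: And4 _ h _ _ := uS k in h).
have [p2 hp2] := mon (fun k => (u k).2) T T0 (fun k => let: And4 _ _ h _ := uS k in h)
  (fun k => let: And4 _ _ _ h := uS k in h).
have h1 := hp1 0; have h2 := hp2 0; rewrite /u /S /T !expr0 !mulr1 /= in h1 h2.
have [e [e0 He]] := H (p1, p2) h1 h2.
have [k1 hk1] := halving_small (ltW s0) e0; have [k2 hk2] := halving_small (ltW t0) e0.
pose k := maxn k1 k2; have [[g1 g2 g3 g4] ns] := ub k.
apply: ns; apply: He => //.
  by apply: hk1; exact: leq_maxl.
by apply: hk2; exact: leq_maxr.
Qed.
End Bisection.

Definition dist p q : R := Num.max `|q.1 - p.1| `|q.2 - p.2|.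

(** a first-order expansion with determinant one up to sign, at a point of the
    strip and along the strip *)
Definition unimodular_at (F : plane -> plane) p : Prop := exists a b c d : R,
  `|a * d - b * c| = 1 /\ forall e, 0 < e -> \forall q \near (p : R * R), in_strip q ->
    `|(F q).1 - (F p).1 - (a * (q.1 - p.1) + b * (q.2 - p.2))| <= e * dist p q /\
    `|(F q).2 - (F p).2 - (c * (q.1 - p.1) + d * (q.2 - p.2))| <= e * dist p q.

Lemma near_box (P : plane -> Prop) p : (\forall q \near (p : R * R), P q) ->
  exists e : R, 0 < e /\ forall q, `|q.1 - p.1| < e -> `|q.2 - p.2| < e -> P q.
Proof.
move=> /nbhs_ballP [e e0 h]; exists e; split => // q h1 h2; apply: h.
by split => /=; rewrite /ball/= distrC.
Qed.

Lemma small_box (F F' : plane -> plane) p (e M : R) : cancel F' F -> measurable_fun setT F' ->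
  unimodular_at F p -> 0 < e -> 1 <= M ->
  exists r, 0 < r /\ forall x y s t, - 2^-1 <= y -> y + t <= 2^-1 -> 0 < s < r -> 0 < t < r ->
    s <= M * t -> t <= M * s -> x <= p.1 <= x + s -> y <= p.2 <= y + t ->
    (area R (F' @^-1` box x y s t) <= ((1 + e) * (s * t))%:E)%E.
Proof.
move=> FK mF' [a [b [c [d [det1 H]]]]] e0 M1.
pose D := a * d - b * c; pose C := 1 + `|a| + `|b| + `|c| + `|d|.
have C1 : 1 <= C by rewrite /C -!addrA lerDl !addr_ge0.
have CM : 0 < C * M by rewrite mulr_gt0//; lra.
pose h := Num.min (e / 3) 1; have h0 : 0 < h by rewrite lt_min ltr01 andbT divr_gt0.
pose k := h / (2 * (C * M)); have k0 : 0 < k by rewrite /k divr_gt0// mulr_gt0.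
have [r [r0 Hr]] := near_box (H k k0); exists r; split => // x y s t y1 y2 /andP[s0 sr] /andP[t0 tr].
move=> sM tM p1 p2.
pose m := Num.max s t; have m0 : 0 < m by rewrite lt_max s0.
have mMs : m <= M * s by rewrite ge_max tM andbT ler_peMl// ltW.
have mMt : m <= M * t by rewrite ge_max sM ler_peMl// ltW.
have Ck : C * k * M = h / 2 by rewrite /k; field; lra.
pose rs := s / 2 * (1 + h); pose rt := t / 2 * (1 + h).
(* F' pulls the box back into an affine image of a slightly larger box *)
pose cx := x + s / 2 - p.1; pose cy := y + t / 2 - p.2.
pose V : set plane := [set v | `|(D * d) * v.1 + (- (D * b)) * v.2 +
     (- (D * d) * (F p).1 + D * b * (F p).2 - cx)| <= rs /\
   `|(- (D * c)) * v.1 + (D * a) * v.2 + (D * c * (F p).1 - D * a * (F p).2 - cy)| <= rt].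
have D2 : D * D = 1 by rewrite -expr2 -(real_normK (num_real D)) det1 expr1n.
have detV : `|D * d * (D * a) - - (D * b) * (- (D * c))| = 1.
  have -> : D * d * (D * a) - - (D * b) * (- (D * c)) = D * D * (a * d - b * c) by ring.
  by rewrite D2 mul1r.
have normD : `|D| = 1 by [].
have sub : F' @^-1` box x y s t `<=` V.
  move=> v [/andP[v1 v2] /andP[v3 v4]]; set q := F' v in v1 v2 v3 v4.
  have vE : v = F q by rewrite /q FK.
  have q1 : `|q.1 - p.1| < r by rewrite ltr_norml; lra.
  have q2 : `|q.2 - p.2| < r by rewrite ltr_norml; lra.
  have qs : in_strip q by apply/andP; split; lra.
  have [w1 w2] := Hr q q1 q2 qs.
  have dm : dist p q <= m.
    rewrite ge_max; apply/andP; split.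
      by apply: (@le_trans _ _ s); [rewrite ler_norml; lra|rewrite le_max lexx].
    by apply: (@le_trans _ _ t); [rewrite ler_norml; lra|rewrite le_max lexx orbT].
  have km : k * dist p q <= k * m by rewrite ler_wpM2l// ltW.
  have {w1}w1 := le_trans w1 km; have {w2}w2 := le_trans w2 km.
  rewrite -!vE in w1 w2; set W1 := v.1 - _ - _ in w1; set W2 := v.2 - _ - _ in w2.
  have lin (z1 z2 : R) (l : R) : `|z1| + `|z2| <= C -> m <= M * l ->
      `|D * (z1 * W1 + z2 * W2)| <= l * (h / 2).
    move=> hz ml; rewrite normrM normD mul1r.
    apply: (@le_trans _ _ ((`|z1| + `|z2|) * (k * m))).
      rewrite mulrDl (le_trans (ler_normD _ _))// lerD// normrM ler_wpM2l//.
    apply: (@le_trans _ _ (C * (k * m))); first by rewrite ler_wpM2r// mulr_ge0 ?ltW.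
    rewrite -Ck (_ : l * _ = C * k * (M * l)); last by ring.
    by rewrite mulrA ler_wpM2l// mulr_ge0 ?ltW//; lra.
  split.
    have -> : D * d * v.1 + - (D * b) * v.2 + (- (D * d) * (F p).1 + D * b * (F p).2 - cx) =
        (q.1 - p.1) * (D * (a * d - b * c)) - cx + D * (d * W1 + - b * W2).
      by rewrite /W1 /W2; ring.
    rewrite -/D D2 mulr1; apply: (le_trans (ler_normD _ _)).
    have -> : rs = s / 2 + s * (h / 2) by rewrite /rs; field.
    apply: lerD; first by rewrite /cx ler_norml; lra.
    by apply: lin => //; rewrite normrN /C; have := normr_ge0 a; have := normr_ge0 c; lra.
  have -> : - (D * c) * v.1 + D * a * v.2 + (D * c * (F p).1 - D * a * (F p).2 - cy) =
        (q.2 - p.2) * (D * (a * d - b * c)) - cy + D * (- c * W1 + a * W2).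
    by rewrite /W1 /W2; ring.
  rewrite -/D D2 mulr1; apply: (le_trans (ler_normD _ _)).
  have -> : rt = t / 2 + t * (h / 2) by rewrite /rt; field.
  apply: lerD; first by rewrite /cy ler_norml; lra.
  by apply: lin => //; rewrite normrN /C; have := normr_ge0 b; have := normr_ge0 d; lra.
have mV : measurable V by exact: measurable_slabs.
apply: (@le_trans _ _ (area R V)).
  by apply: le_measure => //; rewrite inE//; rewrite -[X in measurable X]setTI; apply: mF' => //;
    exact: measurable_box.
have rs0 : 0 <= rs by rewrite /rs; apply: mulr_ge0; lra.
have rt0 : 0 <= rt by rewrite /rt; apply: mulr_ge0; lra.
rewrite (area_slabs _ _ detV rs0 rt0).
rewrite lee_fin (_ : 4 * rs * rt = (1 + h) ^+ 2 * (s * t)); last by rewrite /rs /rt; field.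
rewrite ler_wpM2r ?mulr_ge0 ?(ltW s0) ?(ltW t0)//.
have hh : h <= e / 3 by rewrite /h ge_min lexx.
have h1 : h <= 1 by rewrite /h ge_min lexx orbT.
have h2 : h * h <= h by rewrite ler_piMr// ltW.
have -> : (1 + h) ^+ 2 = 1 + 2 * h + h * h by ring.
lra.
Qed.
End Boxes.

Section Invariance.
Variable R : realType.
Notation lam := (@lebesgue_measure R).
Notation mR := (measurableTypeR R).
Notation plane := (mR * mR)%type.
Implicit Types (p q u : plane) (A B : set plane) (nu : {measure set plane -> \bar R}).

Lemma open_measurable_plane (U : set (R * R)) : open U -> measurable (U : set plane).
Proof.
move=> oU; pose sq (i : rat * rat * nat) : set plane :=
  `](ratr i.1.1 - i.2.+1%:R^-1 : R), (ratr i.1.1 + i.2.+1%:R^-1)[%classic `*`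
  `](ratr i.1.2 - i.2.+1%:R^-1 : R), (ratr i.1.2 + i.2.+1%:R^-1)[%classic.
have -> : U = \bigcup_i (if `[< sq i `<=` U >] then sq i else set0).
  apply/seteqP; split=> [p Up|p [i _]]; last by case: asboolP => // h /h.
  have [e [e0 he]] := @near_box R U p (open_nbhs_nbhs (conj oU Up)).
  have [k hk] : exists k, k.+1%:R^-1 < e / 2.
    have e2 : 0 < e / 2 by rewrite divr_gt0.
    exists (Num.bound (e / 2)^-1); rewrite invf_plt ?posrE//.
    apply: lt_le_trans (archi_boundP _) _; first by rewrite invr_ge0 ltW.
    by rewrite ler_nat.
  have k0 : 0 < k.+1%:R^-1 :> R by rewrite invr_gt0.
  pose r : R := k.+1%:R^-1; rewrite -/r in hk k0.
  have near (x : R) : exists q : rat, `|x - ratr q| < r.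
    have [q] : exists q : rat, ratr q \in `](x - r), (x + r)[.
      by apply: rat_in_itvoo; rewrite ltrD2l gtrN.
    by rewrite in_itv /= => /andP[? ?]; exists q; rewrite ltr_norml; apply/andP; split; lra.
  have [q1 h1] := near p.1; have [q2 h2] := near p.2; exists (q1, q2, k) => //.
  have -> : `[< sq (q1, q2, k) `<=` U >].
    apply/asboolP => q; rewrite /sq /= -/r !in_itv /= => -[/andP[g1 g2] /andP[g3 g4]].
    by apply: he; rewrite ltr_norml; move: h1 h2; rewrite !ltr_norml => /andP[? ?] /andP[? ?];
      apply/andP; split; lra.
  move: h1 h2; rewrite /sq /= -/r !in_itv /= !ltr_norml => /andP[? ?] /andP[? ?].
  by split; apply/andP; split; lra.
apply: countable_bigcupT_measurable => [|i]; first exact: countableP.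
case: asboolP => // _; apply: measurableX; exact: measurable_itv.
Qed.

Lemma continuous_measurable_plane (F : R * R -> R * R) : continuous F ->
  measurable_fun [set: plane] (F : plane -> plane).
Proof.
move=> cF; apply/measurable_fun_pairP.
have c1 : continuous (@fst R R) by move=> p; exact: cvg_fst.
have c2 : continuous (@snd R R) by move=> p; exact: cvg_snd.
have main (g : R * R -> R) : continuous g -> measurable_fun [set: plane] (g : plane -> mR).
  move=> cg; apply: (measurability _ (RGenOInfty.measurableE R)) => _ [_ [a ->] <-].
  rewrite setTI; apply: open_measurable_plane; apply: open_comp => [p _|]; first exact: cg.
  exact: interval_open.
split; apply: main => p; apply: continuous_comp; [exact: cF|exact: c1|exact: cF|exact: c2].
Qed.

Lemma boxes_generate :
  @measurable _ plane = <<s [set box w.1.1 w.1.2 w.2.1 w.2.2 | w in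
    [set w : (R * R) * (R * R) | 0 <= w.2.1 /\ 0 <= w.2.2]] >>.
Proof.
set G := [set _ | _ in _]; apply/seteqP; split; last first.
  apply: smallest_sub; first by split=> // *; [exact: measurableD|exact: bigcupT_measurable].
  by move=> _ [w _ <-]; exact: measurable_box.
have sG := smallest_sigma_algebra setT G.
have GI A B : <<s G >> A -> <<s G >> B -> <<s G >> (A `&` B).
  exact: (@measurableI _ (g_sigma_algebraType G) A B).
have pre (f : plane -> R) (mf : forall a b, a < b -> <<s G >> (f @^-1` `]a, b]%classic)) (A : set mR) :
    measurable A -> <<s G >> (f @^-1` A).
  move: A; apply: (smallest_sub (X := [set A | <<s G >> (f @^-1` A)])).
    case: sG => s0 sC sU; split=> [|A hA|A hA] /=; first by rewrite preimage_set0.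
      by rewrite setTD preimage_setC -setTD; exact: sC.
    by rewrite preimage_bigcup; exact: sU.
  move=> _ [[a b] /= ab <-]; have [lt|ge] := ltP a b; first exact: mf.
  rewrite set_itv_ge /= ?preimage_set0; first by case: sG.
  by rewrite -leNgt.
rewrite measurable_prod_measurableType.
apply: smallest_sub => // _ [A mA [B mB <-]].
have -> : A `*` B = (fst @^-1` A) `&` (snd @^-1` B) by apply/seteqP; split.
have cover (z : R) : exists n, - n.+1%:R < z <= n.+1%:R.
  exists (Num.bound `|z|); have h : `|z| < (Num.bound `|z|)%:R by exact: archi_boundP.
  have : (Num.bound `|z|)%:R < (Num.bound `|z|).+1%:R :> R by rewrite ltr_nat.
  by move: h; rewrite ltr_norml; lra.
apply: GI.
- apply: pre mA => a b ab.
  have -> : fst @^-1` `]a, b]%classic = \bigcup_n box a (- n.+1%:R) (b - a) (2 * n.+1%:R) :> set plane.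
    apply/seteqP; split=> [p|p [n _ []]] /=; rewrite !in_itv /=; last by lra.
    move=> h; have [n hn] := cover p.2; exists n => //; rewrite /box /=; split; lra.
  by case: sG => _ _; apply => n; apply: sub_sigma_algebra; exists (a, - n.+1%:R, (b - a, 2 * n.+1%:R)) => //=;
    split; [lra|rewrite mulr_ge0].
- apply: pre mB => a b ab.
  have -> : snd @^-1` `]a, b]%classic = \bigcup_n box (- n.+1%:R) a (2 * n.+1%:R) (b - a) :> set plane.
    apply/seteqP; split=> [p|p [n _ []]] /=; rewrite !in_itv /=; last by lra.
    move=> h; have [n hn] := cover p.1; exists n => //; rewrite /box /=; split; lra.
  by case: sG => _ _; apply => n; apply: sub_sigma_algebra; exists (- n.+1%:R, a, (2 * n.+1%:R, b - a)) => //=;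
    split; [rewrite mulr_ge0|lra].
Qed.
End Invariance.

Section Reduction.
Variable R : realType.
Notation mR := (measurableTypeR R).
Notation plane := (mR * mR)%type.
Implicit Types (p q u : plane) (A B : set plane) (nu : {measure set plane -> \bar R}).

Definition band : set plane := box 0 (- 2^-1) 2 1.
Definition turns p : int := Num.ceil (p.1 / 2) - 1.
Definition red p : plane := (p.1 - 2 * (turns p)%:~R, p.2).

Lemma measurable_band : measurable band. Proof. exact: measurable_box. Qed.

Lemma turnsP p : 2 * (turns p)%:~R < p.1 <= 2 * (turns p)%:~R + 2.
Proof.
have h1 : p.1 / 2 <= (Num.ceil (p.1 / 2))%:~R by rewrite -ceil_le_int.
have h2 : (Num.ceil (p.1 / 2) - 1)%:~R < p.1 / 2.
  by rewrite ltNge -ceil_le_int -ltNge ltrBlDr ltrDl.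
rewrite /turns; rewrite rmorphB /= in h2 *; lra.
Qed.

Lemma turns_uniq p k : 2 * k%:~R < p.1 <= 2 * k%:~R + 2 -> turns p = k.
Proof.
move=> /andP[h1 h2]; rewrite /turns (@ceil_def _ _ (k + 1)) ?addrK//.
by rewrite rmorphD/=; apply/andP; split; lra.
Qed.

Lemma bandP p : band p <-> turns p = 0 /\ - 2^-1 < p.2 <= 2^-1.
Proof.
rewrite /band /box /=; have half : - 2^-1 + 1 = 2^-1 :> R by lra.
rewrite half; split=> [[h1 h2]|[h1 h2]]; split => //.
  by apply: turns_uniq; rewrite mulr0; lra.
by have := turnsP p; rewrite h1 mulr0; lra.
Qed.

Lemma red_id p : turns p = 0 -> red p = p.
Proof. by move=> h; rewrite /red h mulr0 subr0 -surjective_pairing. Qed.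

Lemma turns_shift p k : turns (p.1 + 2 * k%:~R, p.2) = turns p + k.
Proof. by apply: turns_uniq => /=; have := turnsP p; rewrite intrD; lra. Qed.

Lemma turns_red p : turns (red p) = 0.
Proof.
have -> : red p = (p.1 + 2 * (- turns p)%:~R, p.2) by rewrite /red rmorphN /= mulrN.
by rewrite turns_shift subrr.
Qed.

Lemma fiber_turns k : [set p | turns p = k] = \bigcup_n box (2 * k%:~R) (- n.+1%:R) 2 (2 * n.+1%:R).
Proof.
apply/seteqP; split=> [p /= <-|p [n _ [h _]]]; last by apply: turns_uniq; exact: h.
exists (Num.bound `|p.2|) => //; split; first exact: turnsP.
have h : `|p.2| < (Num.bound `|p.2|)%:R by exact: archi_boundP.
have : (Num.bound `|p.2|)%:R < (Num.bound `|p.2|).+1%:R :> R by rewrite ltr_nat.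
by move: h; rewrite ltr_norml; lra.
Qed.

Lemma measurable_turns k : measurable [set p | turns p = k].
Proof. by rewrite fiber_turns; apply: bigcupT_measurable => n; exact: measurable_box. Qed.

Lemma red_preimage A : red @^-1` A = \bigcup_(k : int)
  ([set p | turns p = k] `&` (fun p => (p.1 - 2 * k%:~R, p.2)) @^-1` A).
Proof.
apply/seteqP; split=> [p h|p [k _ [h1 h2]]]; first by exists (turns p).
by rewrite /red /= h1.
Qed.

Lemma measurable_red : measurable_fun [set: plane] red.
Proof.
move=> _ A mA; rewrite setTI red_preimage.
apply: countable_bigcupT_measurable => [|k]; first exact: countableP.
apply: measurableI; first exact: measurable_turns.
by rewrite -[X in measurable X]setTI; apply: (measurable_translate (- (2 * k%:~R))).
Qed.

Lemma boxI (x y s t x' y' s' t' : R) : box x y s t `&` box x' y' s' t' =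
  box (Num.max x x') (Num.max y y') (Num.max 0 (Num.min (x + s) (x' + s') - Num.max x x'))
    (Num.max 0 (Num.min (y + t) (y' + t') - Num.max y y')).
Proof.
have main (z a r a' r' : R) : (a < z <= a + r) && (a' < z <= a' + r') =
    (Num.max a a' < z <= Num.max a a' + Num.max 0 (Num.min (a + r) (a' + r') - Num.max a a')).
  rewrite gt_max; set M := Num.max a a'; set N := Num.min _ _.
  have NE : (z <= N) = (z <= a + r) && (z <= a' + r') by rewrite le_min.
  have ME : (M < z) = (a < z) && (a' < z) by rewrite gt_max.
  have [h|h] := leP 0 (N - M).
    have -> : (z <= M + (N - M)) = (z <= N) by congr (_ <= _); ring.
    by rewrite NE -!andbA; congr (_ && _); rewrite andbCA.
  rewrite addr0; apply/idP/idP => /andP[/andP[h1 h2] h3]; last first.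
    have : M < z by rewrite ME h1 h2.
    by lra.
  move: h3 => /andP[h3 h4]; have : M < z by rewrite ME h1 h3.
  have : z <= N by rewrite NE h2 h4.
  by lra.
apply/seteqP; split=> p.
  by move=> [[h1 h2] [h3 h4]]; split; rewrite -main ?h1 ?h2 ?h3 ?h4.
by rewrite /box /= -!main => -[/andP[-> ->] /andP[-> ->]].
Qed.

Section Invariance.
Variables (F F' : R * R -> R * R).
Hypotheses (FK : cancel F F') (F'K : cancel F' F) (cF' : continuous F').
Hypothesis F'per : forall p k, F' (p.1 + 2 * k%:~R, p.2) = ((F' p).1 + 2 * k%:~R, (F' p).2).
Hypothesis Fout : forall p, 2^-1 <= `|p.2| -> F p = p.
Hypothesis F'band : forall p, `|p.2| <= 2^-1 -> `|(F' p).2| <= 2^-1.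
Hypothesis uni : forall p, in_strip p -> unimodular_at F p.

Let mF' := continuous_measurable_plane cF'.
Let nu : {measure set plane -> \bar R} := image_measure (area R) mF'.
Let mphi : measurable_fun [set: plane] (red \o F').
Proof. exact: measurableT_comp measurable_red mF'. Qed.
Let kap : {measure set plane -> \bar R} := image_measure (mrestr (area R) measurable_band) mphi.

Let nu_box x y s t : 0 <= s -> 0 <= t -> - 2^-1 <= y -> y + t <= 2^-1 ->
  (nu (box x y s t) <= (s * t)%:E)%E.
Proof.
rewrite le_eqVlt => /orP[/eqP <-|s0].
  have -> : box x y 0 t = set0 by apply/seteqP; split=> // p [] /=; lra.
  by rewrite measure0 mul0r.
rewrite le_eqVlt => /orP[/eqP <-|t0].
  have -> : box x y s 0 = set0 by apply/seteqP; split=> // p [] /=; lra.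
  by rewrite measure0 mulr0.
move=> y1 y2; apply/lee_addgt0Pr => e e0.
pose d := e / (s * t); have d0 : 0 < d by rewrite divr_gt0// mulr_gt0.
rewrite -EFinD; have -> : s * t + e = (1 + d) * (s * t).
  by rewrite mulrDl mul1r /d mulfVK// gt_eqF// mulr_gt0.
apply: (@bisection R nu x y s t (1 + d)) => //.
move=> p p1 p2; have ps : in_strip p by apply/andP; split; lra.
pose M := 1 + s / t + t / s.
have st0 : 0 < s / t by rewrite divr_gt0.
have ts0 : 0 < t / s by rewrite divr_gt0.
have [|r [r0 hr]] := @small_box R F F' p d M F'K mF' (uni ps) d0; first by rewrite /M; lra.
exists r; split=> // k x' y' h1 h2 h3 h4 h5 h6 h7 h8.
have z0 : 0 < 2^-1 ^+ k :> R by rewrite exprn_gt0.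
have sM : s <= M * t.
  have : s / t * t = s by rewrite mulfVK// gt_eqF.
  have : 0 < t / s * t by rewrite mulr_gt0.
  by rewrite /M !mulrDl mul1r; lra.
have tM : t <= M * s.
  have : t / s * s = t by rewrite mulfVK// gt_eqF.
  have : 0 < s / t * s by rewrite mulr_gt0.
  by rewrite /M !mulrDl mul1r; lra.
apply: hr => //; try by apply/andP; split => //; rewrite mulr_gt0.
- lra.
- lra.
- by rewrite mulrA ler_wpM2r// ltW.
- by rewrite mulrA ler_wpM2r// ltW.
Qed.

Let kap_nu B : measurable B -> B `<=` band -> (kap B <= nu B)%E.
Proof.
move=> mB sB; pose S := F' @^-1` B.
have mS : measurable S by rewrite -[X in measurable X]setTI; exact: mF'.
pose Si i : set plane := \bigcup_(j in [set j : int | pickle j = i]) (S `&` [set p | turns p = j]).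
pose Ki i : set plane := \bigcup_(j in [set j : int | pickle j = i])
  ((fun p => (p.1 + 2 * j%:~R, p.2)) @^-1` (S `&` [set p | turns p = j])).
have cases i : (exists2 j : int, pickle j = i & [set j : int | pickle j = i] = [set j]) \/
    [set j : int | pickle j = i] = set0.
  have [[j hj]|h] := pselect (exists j : int, pickle j = i).
    left; exists j => //; apply/seteqP; split=> [k /= kE|k /= ->//].
    by apply: (pcan_inj pickleK); rewrite kE.
  by right; apply/seteqP; split=> // j hj; apply: h; exists j.
have mSj j : measurable (S `&` [set p | turns p = j]) by apply: measurableI => //; exact: measurable_turns.
have mSi i : measurable (Si i).
  by rewrite /Si; case: (cases i) => [[j _ ->]|->]; rewrite ?bigcup_set1 ?bigcup_set0; [exact: mSj|exact: measurable0].
have mKj j : measurable ((fun p : plane => (p.1 + 2 * j%:~R, p.2)) @^-1` (S `&` [set p | turns p = j])).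
  rewrite -[X in measurable X]setTI; exact: (measurable_translate (2 * j%:~R) measurableT (mSj j)).
have mKi i : measurable (Ki i).
  by rewrite /Ki; case: (cases i) => [[j _ ->]|->]; rewrite ?bigcup_set1 ?bigcup_set0; [exact: mKj|exact: measurable0].
have KS i : area R (Ki i) = area R (Si i).
  rewrite /Ki /Si; case: (cases i) => [[j _ ->]|->]; rewrite ?bigcup_set1 ?bigcup_set0//.
  by rewrite (area_translate _ (mSj j)).
have tS : trivIset setT Si.
  apply/trivIsetP => i j _ _ /eqP ij; apply/seteqP; split=> // p [[k /= ki [_ h]] [l /= lj [_ h']]].
  by apply: ij; rewrite -ki -lj -h -h'.
rewrite /kap /nu /= /image_measure /pushforward /mrestr.
have mK : measurable ((red \o F') @^-1` B `&` band).
  by apply: measurableI; [rewrite -[X in measurable X]setTI; exact: mphi|exact: measurable_band].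
apply: (@le_trans _ _ (\sum_(i <oo) area R (Ki i))%E).
  apply: measure_sigma_subadditive => // p [/= hB /bandP[p0 _]].
  pose j := - turns (F' p); exists (pickle j) => //; exists j => //=.
  have E : F' (p.1 + 2 * j%:~R, p.2) = red (F' p).
    by rewrite F'per /red /j rmorphN /= mulrN.
  by split; [rewrite /S /= E|rewrite turns_shift p0 add0r].
apply: (@le_trans _ _ (\sum_(i <oo) area R (Si i))%E).
  by apply: lee_nneseries => // i _; rewrite KS.
have -> : (\sum_(i <oo) area R (Si i) = \sum_(0 <= i <oo | i \in setT) area R (Si i))%E.
  by apply: eq_eseriesl => i; rewrite in_setT.
rewrite -measure_bigcup//; apply: le_measure; rewrite ?inE//.
  by apply: bigcupT_measurable.
by move=> p [i _ [j _ []]].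
Qed.

Let phi_band p : band p -> band (red (F' p)).
Proof.
move=> /bandP[p0 p2]; apply/bandP; split; first exact: turns_red.
have := F'band (p := p); rewrite !ler_norml => /(_ ltac:(lra)) /andP[h1 h2]; rewrite /red /= h2 andbT.
rewrite lt_neqAle h1 andbT; apply/eqP => h.
have : F (F' p) = F' p by apply: Fout; rewrite -h normrN ger0_norm//; lra.
by rewrite F'K => pE; move: p2; rewrite pE -h ltxx.
Qed.

Let kap_band : kap band = 2%:E.
Proof.
rewrite /kap /= /image_measure /pushforward /mrestr.
have -> : (red \o F') @^-1` band `&` band = band.
  by apply/seteqP; split=> [p []|p bp] //; split => //; exact: phi_band.
by rewrite area_box ?mulr1.
Qed.

Let kap_box x y s t : 0 <= s -> 0 <= t -> 0 <= x -> x + s <= 2 -> - 2^-1 <= y -> y + t <= 2^-1 ->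
  (kap (box x y s t) <= (s * t)%:E)%E.
Proof.
move=> s0 t0 x0 xs y0 yt; have h := nu_box x s0 t0 y0 yt.
have sub : box x y s t `<=` band by move=> p [h1 h2]; rewrite /band /box /=; lra.
have h' := kap_nu (@measurable_box R x y s t) sub.
exact: le_trans h' h.
Qed.

Let kap_box_eq x y s t : 0 <= s -> 0 <= t -> 0 <= x -> x + s <= 2 -> - 2^-1 <= y -> y + t <= 2^-1 ->
  kap (box x y s t) = (s * t)%:E.
Proof.
move=> s0 t0 x0 xs y0 yt; apply/eqP; rewrite eq_le kap_box//=.
have mb := @measurable_box R.
have sub : band `<=` box x y s t `|` ((box 0 (- 2^-1) x 1 `|` box (x + s) (- 2^-1) (2 - (x + s)) 1) `|`
    (box x (- 2^-1) s (y + 2^-1) `|` box x (y + t) s (2^-1 - (y + t)))).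
  move=> p [h1 h2]; rewrite /box /=; have half : - 2^-1 + 1 = 2^-1 :> R by lra.
  have [a|a] := leP p.1 x; first by right; left; left; split; lra.
  have [b|b] := leP p.1 (x + s); last by right; left; right; split; lra.
  have [c|c] := leP p.2 y; first by right; right; left; split; lra.
  have [d|d] := leP p.2 (y + t); last by right; right; right; split; lra.
  by left; split; apply/andP.
have mU A B : measurable A -> measurable B -> (kap (A `|` B) <= kap A + kap B)%E.
  by move=> mA mB; exact: measureU2.
have : (2%:E <= kap (box x y s t) + (((x * 1)%:E + ((2 - (x + s)) * 1)%:E) +
    ((s * (y + 2^-1))%:E + (s * (2^-1 - (y + t)))%:E)))%E.
  rewrite -kap_band; apply: (le_trans (le_measure kap _ _ sub)); rewrite ?inE; [exact: mb|..].
    by do ![apply: measurableU|exact: mb].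
  apply: (le_trans (mU _ _ _ _)); [exact: mb|by do ![apply: measurableU|exact: mb]|apply: leeD => //].
  apply: (le_trans (mU _ _ _ _)); [by do ![apply: measurableU|exact: mb]..|apply: leeD].
    apply: (le_trans (mU _ _ _ _)); [exact: mb..|apply: leeD; apply: kap_box; lra].
  apply: (le_trans (mU _ _ _ _)); [exact: mb..|apply: leeD; apply: kap_box; lra].
rewrite -!EFinD -leeBlDr// -EFinB; congr (_%:E <= _)%E; by field.
Qed.

Lemma red_invariant A : measurable A ->
  area R ((red \o F') @^-1` A `&` band) = area R (A `&` band).
Proof.
pose G := [set box w.1.1 w.1.2 w.2.1 w.2.2 | w in
    [set w : (R * R) * (R * R) | 0 <= w.2.1 /\ 0 <= w.2.2]].
pose kap0 : {measure set plane -> \bar R} := mrestr (area R) measurable_band.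
have mx (a b : R) : 0 <= Num.max 0 (a - b) by rewrite le_max lexx.
apply: (@measure_unique _ R plane G (fun n => box (- n%:R) (- n%:R) (2 * n%:R) (2 * n%:R))
  (@boxes_generate R) _ _ _ kap kap0).
- move=> _ _ [w _ <-] [w' _ <-]; rewrite boxI; eexists (_, _, (_, _)); last reflexivity.
  by split; exact: mx.
- by move=> n; exists (- n%:R, - n%:R, (2 * n%:R, 2 * n%:R)) => //=; rewrite mulr_ge0.
- apply/seteqP; split=> // p _; exists (Num.bound `|p.1| + Num.bound `|p.2|)%N => //.
  have h1 : `|p.1| < (Num.bound `|p.1|)%:R by exact: archi_boundP.
  have h2 : `|p.2| < (Num.bound `|p.2|)%:R by exact: archi_boundP.
  rewrite /box /= natrD; move: h1 h2; rewrite !ltr_norml => /andP[? ?] /andP[? ?].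
  have := ler0n R (Num.bound `|p.1|); have := ler0n R (Num.bound `|p.2|); lra.
- move=> _ [w _ <-].
  have -> : kap (box w.1.1 w.1.2 w.2.1 w.2.2) = kap (box w.1.1 w.1.2 w.2.1 w.2.2 `&` band).
    rewrite /kap /= /image_measure /pushforward /mrestr; congr (area R _).
    by apply/seteqP; split=> p [h1 h2]; [split => //; split => //; exact: phi_band|case: h1].
  pose X := Num.max w.1.1 0; pose Y := Num.max w.1.2 (- 2^-1).
  pose S := Num.max 0 (Num.min (w.1.1 + w.2.1) (0 + 2) - X).
  pose T := Num.max 0 (Num.min (w.1.2 + w.2.2) (- 2^-1 + 1) - Y).
  have S0 : 0 <= S := mx _ _; have T0 : 0 <= T := mx _ _.
  have BI : box w.1.1 w.1.2 w.2.1 w.2.2 `&` band = box X Y S T by rewrite /band boxI.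
  have -> : kap0 (box w.1.1 w.1.2 w.2.1 w.2.2) = (S * T)%:E.
    by have := area_box X Y S0 T0; rewrite -BI.
  rewrite BI.
  have [Sz|Sz] := eqVneq S 0.
    have -> : box X Y S T = set0 by apply/seteqP; split=> // p []; rewrite Sz /=; lra.
    by rewrite measure0 Sz mul0r.
  have [Tz|Tz] := eqVneq T 0.
    have -> : box X Y S T = set0 by apply/seteqP; split=> // p []; rewrite Tz /=; lra.
    by rewrite measure0 Tz mulr0.
  have pos (a b c : R) : Num.max 0 (Num.min a b - c) != 0 -> c + Num.max 0 (Num.min a b - c) <= b.
    by case: (leP 0 (Num.min a b - c)) => [_ _|_]; rewrite ?eqxx// addrC subrK ge_min lexx orbT.
  have X0 : 0 <= X by rewrite /X le_max lexx orbT.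
  have Y0 : - 2^-1 <= Y by rewrite /Y le_max lexx orbT.
  have XS : X + S <= 2 by have := pos _ _ _ Sz; rewrite -/S add0r.
  have YT : Y + T <= 2^-1 by have := pos _ _ _ Tz; rewrite -/T; lra.
  exact: (kap_box_eq S0 T0 X0 XS Y0 YT).
- move=> n; apply: (@le_lt_trans _ _ (kap setT)).
    by apply: le_measure; rewrite ?inE//; exact: measurable_box.
  have -> : kap setT = 2%:E.
    rewrite /kap /= /image_measure /pushforward /mrestr preimage_setT setTI /band.
    by rewrite area_box ?mulr1.
  by rewrite ltry.
Qed.
End Invariance.
End Reduction.

Section Mean.
Context d (T : measurableType d) (R : realType) (P : probability T R).
Implicit Types f g : T -> R.

Definition bounded_measurable f : Prop :=
  measurable_fun setT f /\ exists C, forall w, `|f w| <= C.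
Definition mean f : R := fine (\int[P]_w (f w)%:E)%E.

Lemma bm_integrable f : bounded_measurable f -> P.-integrable setT (EFin \o f).
Proof.
have Poo : (P setT < +oo)%E by rewrite probability_setT ltry.
move=> [mf [C hC]]; apply: measurable_bounded_integrable => //.
exists C; split; first exact: num_real.
by move=> D CD w _; apply: le_trans (hC w) (ltW CD).
Qed.

Lemma meanE f : bounded_measurable f -> (\int[P]_w (f w)%:E)%E = (mean f)%:E.
Proof.
move=> bf; rewrite /mean fineK//.
exact: (integrable_fin_num measurableT (bm_integrable bf)).
Qed.

Lemma bmD f g : bounded_measurable f -> bounded_measurable g -> bounded_measurable (fun w => f w + g w).
Proof.
move=> [mf [C hC]] [mg [D hD]]; split; first exact: measurable_funD.
by exists (C + D) => w; apply: le_trans (ler_normD _ _) (lerD (hC w) (hD w)).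
Qed.

Lemma bmZ k f : bounded_measurable f -> bounded_measurable (fun w => k * f w).
Proof.
move=> [mf [C hC]]; split; first by apply: measurable_funM => //; exact: measurable_cst.
by exists (`|k| * C) => w; rewrite normrM ler_wpM2l.
Qed.

Lemma bm_cst k : bounded_measurable (fun=> k).
Proof. by split; [exact: measurable_cst|exists `|k|]. Qed.

Lemma meanD f g : bounded_measurable f -> bounded_measurable g ->
  mean (fun w => f w + g w) = mean f + mean g.
Proof.
move=> bf bg; apply/EFin_inj; rewrite -meanE; last exact: bmD.
rewrite EFinD -!meanE//; under eq_integral do rewrite EFinD.
by rewrite integralD//; exact: bm_integrable.
Qed.

Lemma meanZ k f : bounded_measurable f -> mean (fun w => k * f w) = k * mean f.
Proof.
move=> bf; apply/EFin_inj; rewrite -meanE; last exact: bmZ.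
rewrite EFinM -meanE//; under eq_integral do rewrite EFinM.
by rewrite integralZl//; exact: bm_integrable.
Qed.

Lemma mean_cst k : mean (fun=> k) = k.
Proof. by rewrite /mean integral_cst//= probability_setT mule1. Qed.

Lemma mean_le f g : bounded_measurable f -> bounded_measurable g -> (forall w, f w <= g w) ->
  mean f <= mean g.
Proof.
move=> bf bg fg; rewrite -lee_fin -!meanE//.
by apply: le_integral => //; [exact: bm_integrable..|move=> w _; rewrite lee_fin].
Qed.

Lemma mean_near f g (e : R) : bounded_measurable f -> bounded_measurable g ->
  (forall w, `|f w - g w| <= e) -> `|mean f - mean g| <= e.
Proof.
move=> bf bg fg; have b1 := bmD bg (bm_cst e); have b2 := bmD bg (bm_cst (- e)).
have h1 := mean_le bf b1; have h2 := mean_le b2 bf.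
rewrite meanD ?mean_cst// in h1; last exact: bm_cst.
rewrite meanD ?mean_cst// in h2; last exact: bm_cst.
rewrite ler_distl; apply/andP; split.
  by apply: h2 => w; have := fg w; rewrite ler_distl => /andP[].
by apply: h1 => w; have := fg w; rewrite ler_distl => /andP[].
Qed.

Lemma bm_sum (I : Type) (s : seq I) (f : I -> T -> R) : (forall i, bounded_measurable (f i)) ->
  bounded_measurable (fun w => \sum_(i <- s) f i w).
Proof.
move=> bf; elim: s => [|i s IH].
  by under eq_fun do rewrite big_nil; exact: bm_cst.
by under eq_fun do rewrite big_cons; exact: bmD.
Qed.

Lemma mean_sum (I : Type) (s : seq I) (f : I -> T -> R) : (forall i, bounded_measurable (f i)) ->
  mean (fun w => \sum_(i <- s) f i w) = \sum_(i <- s) mean (f i).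
Proof.
move=> bf; elim: s => [|i s IH].
  by under eq_fun do rewrite big_nil; rewrite mean_cst big_nil.
under eq_fun do rewrite big_cons.
by rewrite meanD ?IH ?big_cons//; exact: bm_sum.
Qed.

Lemma mean_invariant (th : T -> T) f : measurable_fun setT th ->
  (forall A, measurable A -> P (th @^-1` A) = P A) -> bounded_measurable f ->
  mean (f \o th) = mean f.
Proof.
move=> mth inv bf; rewrite /mean; congr fine.
have mf : measurable_fun setT (EFin \o f) by apply/measurable_EFinP; case: bf.
have bfth : bounded_measurable (f \o th).
  by case: bf => ? [C hC]; split; [exact: measurableT_comp|exists C => w; exact: hC].
have := @integral_pushforward _ _ _ _ R th mth P setT (EFin \o f) mf (bm_integrable bfth) measurableT.
rewrite preimage_setT => <-.
by apply: eq_measure_integral => A mA _; exact: (inv A mA).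
Qed.
End Mean.

Section Sampling.
Variable R : realType.
Notation mR := (measurableTypeR R).
Notation plane := (mR * mR)%type.

Definition one_point : set plane -> \bar R :=
  mscale (2^-1)%:nng (mrestr (area R) (@measurable_band R)).
HB.instance Definition _ := Measure.on one_point.

Let one_pointT : one_point setT = 1%E.
Proof.
have -> : one_point setT = ((2^-1)%:E * area R (setT `&` @band R))%E by [].
by rewrite setTI /band area_box// -EFinM; congr EFin; field.
Qed.
HB.instance Definition _ := Measure_isProbability.Build _ _ _ one_point one_pointT.

Section Cons.
Context d (T : measurableType d) (n : nat).
Definition tcons (w : T * n.-tuple T) : n.+1.-tuple T := [tuple of w.1 :: w.2].
Lemma measurable_tcons : measurable_fun setT tcons.
Proof. exact: measurable_cons. Qed.
HB.instance Definition _ := isMeasurableFun.Build _ _ _ _ tcons measurable_tcons.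
End Cons.

Fixpoint iid n : probability (n.-tuple plane) R :=
  if n is n'.+1 then distribution (one_point \x iid n')%E (@tcons _ plane n')
  else \d_[tuple].

Definition tmap (th : plane -> plane) n (w : n.-tuple plane) : n.-tuple plane := map_tuple th w.

Lemma measurable_tmap th n : measurable_fun setT th -> measurable_fun setT (@tmap th n).
Proof.
move=> mth; apply/measurable_fun_tnthP => i.
have -> : (tnth (T:=plane))^~ i \o @tmap th n = th \o (fun w => tnth w i).
  by apply/funext => w; rewrite /= tnth_map.
by apply: measurableT_comp => //; exact: measurable_tnth.
Qed.

Lemma iid_invariant th n : measurable_fun setT th ->
  (forall A, measurable A -> one_point (th @^-1` A) = one_point A) ->
  forall A, measurable A -> iid n (@tmap th n @^-1` A) = iid n A.
Proof.
move=> mth inv; elim: n => [|n IH] A mA.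
  by congr (_ _); apply/seteqP; split => w; rewrite /preimage /= (tuple0 w) (tuple0 (tmap _ _)).
rewrite /= /distribution /pushforward.
pose g (w : plane * n.-tuple plane) := (th w.1, tmap th w.2).
have mg : measurable_fun setT g.
  apply: measurable_fun_pair; first exact: measurableT_comp.
  by apply: measurableT_comp => //; exact: measurable_tmap.
have mB : measurable (@tcons _ plane n @^-1` A).
  by rewrite -[X in measurable X]setTI; exact: measurable_tcons.
have -> : @tcons _ plane n @^-1` (@tmap th n.+1 @^-1` A) = g @^-1` (@tcons _ plane n @^-1` A).
  apply/seteqP; split => w; rewrite /preimage /=;
  by have -> : tmap th (tcons w) = tcons (g w) by apply: val_inj.
symmetry; apply: (product_measure_unique (m' := image_measure (one_point \x iid n)%E mg)) => // B C mB' mC.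
rewrite /= /image_measure /pushforward.
have -> : g @^-1` (B `*` C) = (th @^-1` B) `*` (@tmap th n @^-1` C) by [].
rewrite product_measure1E; first by congr (_ * _)%E; [exact: inv|exact: IH].
  by rewrite -[X in measurable X]setTI; exact: mth.
by rewrite -[X in measurable X]setTI; exact: measurable_tmap.
Qed.

Lemma integral_iid_cons n (f : n.+1.-tuple plane -> \bar R) : measurable_fun setT f ->
  (forall w, (0 <= f w)%E) ->
  (\int[iid n.+1]_w f w = \int[one_point]_p \int[iid n]_w f (tcons (p, w)))%E.
Proof.
move=> mf f0; rewrite /= ge0_integral_pushforward//.
rewrite preimage_setT fubini_tonelli1//.
by apply: measurableT_comp => //; exact: measurable_tcons.
by move=> x; exact: f0.
Qed.
End Sampling.

Section Fibers.
Context d (T : measurableType d) (R : realType).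

Definition measurable_fibers (K : Type) (u : T -> K) : Prop :=
  forall k, measurable [set w | u w = k].

Lemma fibers_factor (K : countType) (u : T -> K) (f : T -> R) : measurable_fibers u ->
  (forall w w', u w = u w' -> f w = f w') -> measurable_fun setT f.
Proof.
move=> mu uf _ B mB; rewrite setTI.
have -> : f @^-1` B = \bigcup_(k : K) (if `[< exists2 w, u w = k & B (f w) >] then [set w | u w = k] else set0).
  apply/seteqP; split=> [w Bw|w [k _]].
    by exists (u w) => //; rewrite (_ : `[< _ >])//; apply/asboolP; exists w.
  by case: asboolP => // -[w' w'k Bw'] /= wk; rewrite /preimage /= (uf w w')// wk w'k.
apply: countable_bigcupT_measurable => [|k]; first exact: countableP.
by case: asboolP => // _; exact: mu.
Qed.

Lemma fibers_pair (K L : Type) (u : T -> K) (v : T -> L) : measurable_fibers u ->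
  measurable_fibers v -> measurable_fibers (fun w => (u w, v w)).
Proof.
move=> mu mv [k l]; have -> : [set w | (u w, v w) = (k, l)] = [set w | u w = k] `&` [set w | v w = l].
  by apply/seteqP; split=> w /= [-> ->].
exact: measurableI.
Qed.

Lemma fibers_cons (K : Type) (u : T -> K) (v : T -> seq K) : measurable_fibers u ->
  measurable_fibers v -> measurable_fibers (fun w => u w :: v w).
Proof.
move=> mu mv [|k l].
  by rewrite (_ : [set w | _] = set0)//; apply/seteqP; split.
have -> : [set w | u w :: v w = k :: l] = [set w | u w = k] `&` [set w | v w = l].
  by apply/seteqP; split=> w /= [-> ->].
exact: measurableI.
Qed.

Lemma fibers_ffun (I : finType) (K : Type) (u : I -> T -> K) : (forall i, measurable_fibers (u i)) ->
  measurable_fibers (fun w => [ffun i => u i w]).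
Proof.
move=> mu phi; have -> : [set w | [ffun i => u i w] = phi] = \bigcap_(i in [set: I]) [set w | u i w = phi i].
  apply/seteqP; split=> [w /= <- i _ /=|w h]; first by rewrite ffunE.
  by apply/ffunP => i; rewrite ffunE; exact: h.
by apply: fin_bigcap_measurable => [|i _]; [exact: finite_finset|exact: mu].
Qed.

Lemma fibers_bool (b : T -> bool) : measurable_fun setT b -> measurable_fibers b.
Proof.
move=> mb k; rewrite -[X in measurable X]setTI.
by have -> : [set w | b w = k] = b @^-1` [set k] by []; exact: mb.
Qed.

Lemma fibers_floor (g : T -> R) : measurable_fun setT g -> measurable_fibers (fun w => Num.floor (g w)).
Proof.
move=> mg k; have -> : [set w | Num.floor (g w) = k] =
    [set w | (k%:~R <= g w) = true] `&` [set w | (g w < (k + 1)%:~R) = true].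
  apply/seteqP; split=> [w /= <-|w /= [h1 h2]]; last by apply: floor_def; rewrite h1 h2.
  by rewrite -floor_ge_int lexx -floor_lt_int ltzD1 lexx.
by apply: measurableI; apply: fibers_bool; [apply: measurable_fun_ler|apply: measurable_fun_ltr];
  try exact: measurable_cst.
Qed.

Lemma fibers_ceil (g : T -> R) : measurable_fun setT g -> measurable_fibers (fun w => Num.ceil (g w)).
Proof.
move=> mg k; have -> : [set w | Num.ceil (g w) = k] =
    [set w | ((k - 1)%:~R < g w) = true] `&` [set w | (g w <= k%:~R) = true].
  apply/seteqP; split=> [w /= <-|w /= [h1 h2]]; last by apply: ceil_def; rewrite h1 h2.
  by rewrite -ceil_le_int lexx ltNge -ceil_le_int -ltNge ltrBlDr ltrDl.
by apply: measurableI; apply: fibers_bool; [apply: measurable_fun_ltr|apply: measurable_fun_ler];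
  try exact: measurable_cst.
Qed.
End Fibers.

Section Cocycle.
Variables (R : realType) (n : nat).
Hypothesis n0 : (0 < n)%N.
Notation mR := (measurableTypeR R).
Notation plane := (mR * mR)%type.
Notation config := ('I_n -> R * R).
Notation sample := (n.-tuple plane).
Implicit Types (X Y : config) (w : sample) (a b : 'I_n).
Implicit Types es fs : seq ((R * R -> R * R) * (R * R -> R * R)).

Definition clamp (p : plane) : plane := (p.1, Num.max (- 2^-1) (Num.min p.2 2^-1)).

Lemma clamp_band p : `|(clamp p).2| <= 2^-1.
Proof.
have h : - 2^-1 <= 2^-1 :> R by lra.
by rewrite ler_norml /clamp /= le_max lexx /= ge_max h ge_min lexx orbT.
Qed.

Lemma clamp_id p : `|p.2| <= 2^-1 -> clamp p = p.
Proof.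
rewrite ler_norml => /andP[h1 h2]; rewrite [RHS]surjective_pairing /clamp.
by rewrite (min_idPl h2) (max_idPr h1).
Qed.

Lemma measurable_clamp : measurable_fun setT clamp.
Proof.
apply: measurable_fun_pair => //; apply: measurable_maxr; first exact: measurable_cst.
by apply: measurable_minr => //; exact: measurable_cst.
Qed.

Definition cfg w : config := fun a => clamp (tnth w a).

Lemma cfg_band w : in_band (cfg w).
Proof. by move=> a; exact: clamp_band. Qed.

Definition code X := (([ffun ab : 'I_n * 'I_n => (tie X ab.1 <= tie X ab.2)%O],
   [ffun ab : 'I_n * 'I_n => Num.floor (((X ab.1).1 - (X ab.2).1) / 2)]),
  ([ffun ab : 'I_n * 'I_n => Num.ceil (((X ab.1).1 - (X ab.2).1) / 2)],
   [ffun b => Num.ceil ((0 - (X b).1) / 2)])).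

Lemma codeP X Y : in_band X -> in_band Y -> code X = code Y ->
  [/\ sigma X = sigma Y, mat X = mat Y & gaps X (top R) = gaps Y (top R)].
Proof.
move=> bX bY [/ffunP c1 /ffunP c2 /ffunP c3 /ffunP c4]; split.
- rewrite /sigma; congr sort; apply/funext => a; apply/funext => b.
  by have := c1 (a, b); rewrite !ffunE.
- apply/funext => a; apply/funext => b; rewrite /mat /gaps /cnt /copy [(_, _).1]/fst [(_, _).1]/fst
    [(_, _).2]/snd [(_, _).2]/snd !mulr0z !mulr0 !addr0.
  have := c1 (a, b); have := c2 (a, b); have := c3 (a, b); rewrite !ffunE => /= -> -> h.
  by rewrite !ltNge h.
- rewrite topE !gaps_high//; try exact: half_lt2.
  by apply/funext => b; have := c4 b; rewrite !ffunE.
Qed.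

Lemma run_code X Ys X' Ys' st : in_band X -> in_band X' ->
  (forall i, (i < size Ys)%N -> in_band (nth X Ys i)) ->
  (forall i, (i < size Ys')%N -> in_band (nth X' Ys' i)) ->
  code X = code X' -> map code Ys = map code Ys' -> run X Ys st = run X' Ys' st.
Proof.
elim: Ys X X' Ys' st => [|Y Ys IH] X X' [|Y' Ys'] st // bX bX' bY bY' cX cE.
have cY : code Y = code Y' := congr1 (head (code Y)) cE.
have cYs : map code Ys = map code Ys' := congr1 behead cE.
have b0 := bY 0%N isT; have b0' := bY' 0%N isT.
have [h1 h2 h3] := codeP bX bX' cX; have [h4 h5 h6] := codeP b0 b0' cY.
have stE : step X Y st = step X' Y' st by rewrite /step /pos /base /gauge h1 h2 h3 h5 h6.
rewrite /= stE; apply: IH => // i hi; first by have := bY i.+1 hi; rewrite /= (set_nth_default Y).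
by have := bY' i.+1 hi; rewrite /= (set_nth_default Y').
Qed.

Lemma twist_code X Ys X' Ys' : in_band X -> in_band X' ->
  (forall i, (i < size Ys)%N -> in_band (nth X Ys i)) ->
  (forall i, (i < size Ys')%N -> in_band (nth X' Ys' i)) ->
  code X = code X' -> map code Ys = map code Ys' -> twist X Ys = twist X' Ys'.
Proof.
move=> bX bX' bY bY' cX cYs; rewrite /twist.
have -> : std X = std X' by rewrite /std; have [_ -> ->] := codeP bX bX' cX.
by rewrite (run_code _ bX bX' bY bY' cX cYs).
Qed.

Lemma traj_band X es i : chain es -> in_band X -> (i < size (traj X es))%N -> in_band (nth X (traj X es) i).
Proof.
elim: es X i => //= e es IH X i [E c] bX; have bY := in_band_elem E bX.
case: i => //= i hi; rewrite (set_nth_default (e.1 \o X))//; exact: IH.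
Qed.

Lemma fibers_code (G : R * R -> R * R) : continuous G ->
  measurable_fibers (fun w => code (G \o cfg w)).
Proof.
move=> cG; have mG := continuous_measurable_plane cG.
have mX a : measurable_fun setT (fun w => (G \o cfg w) a : plane).
  apply: measurableT_comp => //; apply: measurableT_comp; first exact: measurable_clamp.
  exact: measurable_tnth.
have m1 a : measurable_fun setT (fun w => ((G \o cfg w) a).1 : mR).
  by have := mX a => /measurable_fun_pairP[].
have m2 a : measurable_fun setT (fun w => ((G \o cfg w) a).2 : mR).
  by have := mX a => /measurable_fun_pairP[].
have m3 a b : measurable_fun setT (fun w => (((G \o cfg w) a).1 - ((G \o cfg w) b).1) / 2 : mR).
  by apply: measurable_funM; [apply: measurable_funB; exact: m1|exact: measurable_cst].
apply: fibers_pair; apply: fibers_pair; apply: fibers_ffun => i.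
- apply: fibers_bool.
  have E : (fun w => (tie (G \o cfg w) i.1 <= tie (G \o cfg w) i.2)%O) =
     (fun w => (((G \o cfg w) i.2).2 <= ((G \o cfg w) i.1).2) &&
       (~~ (((G \o cfg w) i.1).2 <= ((G \o cfg w) i.2).2) || (i.1 <= i.2)%N)).
    by apply/funext => w; rewrite /tie (@lexi_pair _ _ _ R nat) !lerN2 implybE leEnat.
  rewrite E; apply: measurable_and; first by apply: measurable_fun_ler; exact: m2.
  apply: measurable_or; last exact: measurable_cst.
  by apply: measurable_neg; apply: measurable_fun_ler; exact: m2.
- by apply: fibers_floor; exact: m3.
- by apply: fibers_ceil; exact: m3.
- apply: fibers_ceil; apply: measurable_funM; last exact: measurable_cst.
  by apply: measurable_funB; [exact: measurable_cst|exact: m1].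
Qed.

Definition cocycle es w : R := ratr (twist (cfg w) (traj (cfg w) es)).

Lemma measurable_cocycle es : chain es -> measurable_fun setT (cocycle es).
Proof.
move=> c; pose u w := (code (cfg w), map code (traj (cfg w) es)).
apply: (fibers_factor (u := u)) => [|w w' E]; last first.
  have h1 : code (cfg w) = code (cfg w') := congr1 fst E.
  have h2 : map code (traj (cfg w) es) = map code (traj (cfg w') es) := congr1 snd E.
  apply: (congr1 ratr); apply: twist_code => //; try exact: cfg_band.
    by move=> i; apply: traj_band => //; exact: cfg_band.
  by move=> i; apply: traj_band => //; exact: cfg_band.
apply: fibers_pair.
  by apply: (@fibers_code id) => p; exact: cvg_id.
have : forall G : R * R -> R * R, continuous G ->
    measurable_fibers (fun w => map code (traj (G \o cfg w) es)).
  elim: es c {u} => [_ G cG|e es IH [E c] G cG] /=.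
    move=> k; have [->|nk] := eqVneq k [::].
      by rewrite (_ : [set _ | _] = setT)//; apply/seteqP; split.
    rewrite (_ : [set _ | _] = set0)//; apply/seteqP; split=> // w /= h.
    by move: nk; rewrite -h eqxx.
  have cG' : continuous (e.1 \o G).
    by move=> p; apply: continuous_comp; [exact: cG|exact: (elem_cont E)].
  by apply: fibers_cons; [exact: (@fibers_code (e.1 \o G) cG')|exact: (IH c (e.1 \o G) cG')].
by move=> /(_ id); apply=> p; exact: cvg_id.
Qed.

Lemma ceil_close (x y : R) (k : nat) : `|x - y| <= k%:R -> `|Num.ceil x - Num.ceil y| <= k.+1%:Z.
Proof.
have h (z : R) : (Num.ceil z - 1)%:~R < z <= (Num.ceil z)%:~R.
  apply/andP; split; last by rewrite -ceil_le_int.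
  by rewrite ltNge -ceil_le_int -ltNge ltrBlDr ltrDl.
have /andP[h1 h2] := h x; have /andP[h3 h4] := h y.
rewrite !ler_norml => /andP[h5 h6]; rewrite -(ler_int R) -[X in _ && X](ler_int R).
have kE : (k.+1%:Z)%:~R = k%:R + 1 :> R by rewrite -pmulrn natr1.
rewrite rmorphN /= kE !intrB; rewrite !intrB /= in h1 h3.
by apply/andP; split; lra.
Qed.

Lemma twist_bounded es : chain es -> exists k : nat, forall X, in_band X ->
  `|twist X (traj X es)| <= k%:R.
Proof.
have main : chain es -> exists k : nat, forall X st, in_band X -> frame X st ->
    `|slope (run X (traj X es) st).2 - slope st.2| <= k%:R.
  elim: es => [_|e es IH [E c]] /=; first by exists 0%N => X st _ _; rewrite subrr normr0.
  have [k hk] := IH c; have [D hD] := elem_disp E.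
  have D0 : 0 <= D by apply: le_trans (hD (0, 0)).
  pose l := (Num.bound D).+1; exists (k + n * l)%N => X st bX fr.
  have bY := in_band_elem E bX.
  have mv : move X (e.1 \o X).
    by have [] := moves_traj (es := [:: e]) (conj E I) bX.
  have fr' := frame_step mv fr.
  have h1 := hk _ _ bY fr'.
  have h2 : `|slope (step X (e.1 \o X) st).2 - slope st.2| <= (n * l)%:R.
    apply: slope_step_bound => // a; rewrite topE !gaps_high//; try exact: half_lt2.
    apply: ceil_close; have := hD (X a); have := archi_boundP D0.
    by move=> h3; rewrite !ler_norml => /andP[h4 h5] /=; apply/andP; split; lra.
  rewrite natrD; move: h1 h2; set u := slope _; set v := slope _; set t := slope _.
  by rewrite !ler_norml => /andP[? ?] /andP[? ?]; apply/andP; split; lra.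
move=> /main[k hk]; exists k => X bX; have := hk X (std X) bX (frame_std X).
by rewrite [slope (std _).2]/slope /= mul0r subr0.
Qed.

Lemma bm_cocycle es : chain es -> bounded_measurable (cocycle es).
Proof.
move=> c; split; first exact: measurable_cocycle.
have [k hk] := twist_bounded c; exists k%:R => w; rewrite /cocycle -ratr_norm -ratr_nat ler_rat.
exact/hk/cfg_band.
Qed.

Lemma cocycle_composite es fs : chain es -> chain fs -> fwd es =1 fwd fs -> cocycle es = cocycle fs.
Proof.
by move=> c c' E; apply/funext => w; rewrite /cocycle (twist_composite (cfg_band w) c c' E).
Qed.

Definition flow es (p : plane) : plane := red (fwd es (clamp p)).

Lemma cocycle_flow es fs w : chain es -> chain fs ->
  cocycle fs (tmap (flow es) w) = ratr (twist (fwd es \o cfg w) (traj (fwd es \o cfg w) fs)).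
Proof.
move=> c c'; rewrite /cocycle; congr (ratr _).
apply: (@twist_relabel _ _ _ _ (fun a => - turns (fwd es (cfg w a)))) => // [a|]; last first.
  exact: fwd_band (cfg_band w).
rewrite /cfg tnth_map clamp_id.
  by rewrite /flow /red rmorphN /= mulrN.
exact: (fwd_band c (cfg_band w) a).
Qed.

Lemma cocycle_cat es fs w : chain es -> chain fs ->
  `|cocycle (es ++ fs) w - cocycle es w - cocycle fs (tmap (flow es) w)| <= n%:R.
Proof.
move=> c c'; rewrite cocycle_flow// /cocycle traj_cat -!rmorphB /= -ratr_norm -ratr_nat ler_rat.
have := @twist_cat R n (cfg w) (traj (cfg w) es) (traj (fwd es \o cfg w) fs).
rewrite last_traj; apply; rewrite -traj_cat; apply: moves_traj; last exact: cfg_band.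
exact/chain_cat.
Qed.

Lemma measurable_flow es : chain es -> measurable_fun setT (flow es).
Proof.
move=> c; apply: measurableT_comp; first exact: measurable_red.
apply: measurableT_comp; last exact: measurable_clamp.
exact: continuous_measurable_plane (fwd_continuous c).
Qed.

Definition preserving es : Prop := forall A : set plane, measurable A ->
  one_point (flow es @^-1` A) = one_point A.

Definition mean_twist es : R := mean (@iid R n) (cocycle es).

Lemma mean_twist_cat es fs : chain es -> chain fs -> preserving es ->
  `|mean_twist (es ++ fs) - (mean_twist es + mean_twist fs)| <= n%:R.
Proof.
move=> c c' pe; have mth := measurable_tmap (n := n) (measurable_flow c).
have inv := iid_invariant (n := n) (measurable_flow c) pe.
have bf := bm_cocycle c'.
rewrite /mean_twist -(mean_invariant mth inv bf).
have bfth : bounded_measurable (cocycle fs \o @tmap R (flow es) n).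
  by case: bf => ? [C hC]; split; [exact: measurableT_comp|exists C => w; exact: hC].
rewrite -meanD//; last exact: bm_cocycle.
apply: mean_near; first by apply: bm_cocycle; exact/chain_cat.
  by apply: bmD => //; exact: bm_cocycle.
by move=> w; rewrite opprD addrA; exact: cocycle_cat.
Qed.
End Cocycle.

Section NearIdentity.
Variable R : realType.
Implicit Types (p q : R * R).

Lemma dist_le_sum p q : dist p q <= `|q.1 - p.1| + `|q.2 - p.2|.
Proof. by rewrite ge_max lerDl lerDr !normr_ge0. Qed.

Lemma lipschitz_continuous (F : R * R -> R * R) (C : R) :
  (forall p q, `|(F q).1 - (F p).1| <= C * (`|q.1 - p.1| + `|q.2 - p.2|) /\
    `|(F q).2 - (F p).2| <= C * (`|q.1 - p.1| + `|q.2 - p.2|)) -> continuous F.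
Proof.
move=> h p; apply/cvgrPdist_lt => e e0.
pose D := 1 + `|C|; have D0 : 0 < D by rewrite /D; have := normr_ge0 C; lra.
pose r := e / (2 * D); have r0 : 0 < r by rewrite divr_gt0// mulr_gt0.
have CD : C <= D by rewrite /D; have := ler_norm C; lra.
have := nbhsx_ballx p r r0; apply: filterS => q [/= h1 h2]; rewrite /ball /= in h1 h2.
have [g1 g2] := h p q; rewrite distrC in h1; rewrite distrC in h2.
have s : C * (`|q.1 - p.1| + `|q.2 - p.2|) < e.
  apply: (@le_lt_trans _ _ (D * (`|q.1 - p.1| + `|q.2 - p.2|))).
    by rewrite ler_wpM2r// addr_ge0.
  rewrite mulrC -ltr_pdivlMr//; have -> : e / D = r + r by rewrite /r; field; lra.
  exact: ltrD.
rewrite /Num.norm /= gt_max; apply/andP; split; rewrite distrC.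
  exact: le_lt_trans g1 s.
exact: le_lt_trans g2 s.
Qed.

Variables F F' : R * R -> R * R.
Hypotheses (FK : cancel F F') (F'K : cancel F' F).
Hypothesis period : forall p, F (p.1 + 2, p.2) = ((F p).1 + 2, (F p).2).
Hypothesis out : forall p, 2^-1 <= `|p.2| -> F p = p.
Hypothesis disp : forall p, `|(F p).1 - p.1| <= 1.
Hypothesis lip : forall p q,
  `|(F q).1 - q.1 - ((F p).1 - p.1)| <= 4^-1 * (`|q.1 - p.1| + `|q.2 - p.2|) /\
  `|(F q).2 - q.2 - ((F p).2 - p.2)| <= 4^-1 * (`|q.1 - p.1| + `|q.2 - p.2|).

Let split_norm (x y : R) : `|x| <= y -> - y <= x /\ x <= y.
Proof. by rewrite ler_norml => /andP[]. Qed.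

Let normP (x : R) : (0 <= x /\ `|x| = x) \/ (x <= 0 /\ `|x| = - x).
Proof. by case: (lerP 0 x) => h; [left; rewrite ger0_norm|right; rewrite ltr0_norm// ltW]. Qed.

Let F_cont : continuous F.
Proof.
apply: (@lipschitz_continuous F 2) => p q; have [h1 h2] := lip p q.
have [a1 a2] := split_norm h1; have [a3 a4] := split_norm h2.
rewrite !ler_norml; case: (normP (q.1 - p.1)) a1 a2 a3 a4 => -[s1 ->];
  case: (normP (q.2 - p.2)) => -[s2 ->] a1 a2 a3 a4; split; apply/andP; split; lra.
Qed.

Let solve p : exists x, (F (x, p.2)).1 = p.1.
Proof.
have ab : p.1 - 1 <= p.1 + 1 by lra.
have c : {within `[p.1 - 1, p.1 + 1], continuous (fun x => (F (x, p.2)).1)}.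
  apply: continuous_subspaceT => x.
  apply: (@continuous_comp _ _ _ (fun x => F (x, p.2)) (@fst R R)); last exact: cvg_fst.
  apply: (@continuous_comp _ _ _ (fun x => (x, p.2)) F); last exact: F_cont.
  exact: (cvg_pair cvg_id (cvg_cst _)).
have [|x _ xE] := @IVT _ _ _ _ p.1 ab c; last by exists x.
have [h1 h2] := split_norm (disp (p.1 - 1, p.2)); have [h3 h4] := split_norm (disp (p.1 + 1, p.2)).
rewrite /= in h1 h2 h3 h4.
rewrite ge_min le_max; apply/andP; split; apply/orP; [left|right]; lra.
Qed.

Let xi p : R := sval (cid (solve p)).
Let xiE p : (F (xi p, p.2)).1 = p.1. Proof. exact: (svalP (cid (solve p))). Qed.

Let row_inj x x' y : (F (x, y)).1 = (F (x', y)).1 -> x = x'.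
Proof.
move=> E; have [h _] := lip (x, y) (x', y); have [a1 a2] := split_norm h; rewrite /= in a1 a2.
rewrite subrr normr0 in a1 a2.
by case: (normP (x' - x)) a1 a2 => -[s ->] a1 a2; lra.
Qed.

Let Hz p : R * R := ((F p).1, p.2).
Let Hz' p : R * R := (xi p, p.2).
Let HzK : cancel Hz Hz'.
Proof.
by move=> p; rewrite /Hz' /= [RHS]surjective_pairing; congr pair; apply: (@row_inj _ _ p.2);
  rewrite (xiE (Hz p)) -surjective_pairing.
Qed.
Let HzVK : cancel Hz' Hz.
Proof. by move=> p; rewrite /Hz /= xiE -surjective_pairing. Qed.

Let Hz_cont : continuous Hz.
Proof.
apply: (@lipschitz_continuous Hz 2) => p q; have [h1 h2] := lip p q.
have [a1 a2] := split_norm h1; rewrite /Hz /= !ler_norml.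
case: (normP (q.1 - p.1)) a1 a2 => -[s1 ->];
  case: (normP (q.2 - p.2)) => -[s2 ->] a1 a2; split; apply/andP; split; lra.
Qed.

Let Hz'_cont : continuous Hz'.
Proof.
apply: (@lipschitz_continuous Hz' 2) => p q; have [h1 _] := lip (Hz' p) (Hz' q).
have [a1 a2] := split_norm h1; rewrite /= !xiE in a1 a2; rewrite /Hz' /= !ler_norml.
case: (normP (q.1 - p.1)) => -[s1 ->]; case: (normP (q.2 - p.2)) a1 a2 => -[s2 ->] a1 a2;
case: (normP (xi q - xi p)) a1 a2 => -[s3 ->] a1 a2; split; apply/andP; split; lra.
Qed.

Let F'_cont : continuous F'.
Proof.
apply: (@lipschitz_continuous F' 4) => p q; have [h1 h2] := lip (F' p) (F' q).
have [a1 a2] := split_norm h1; have [a3 a4] := split_norm h2; rewrite !F'K in a1 a2 a3 a4.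
move: a1 a2 a3 a4; rewrite !ler_norml; set x := (F' p).1; set y := (F' p).2.
set x' := (F' q).1; set y' := (F' q).2.
case: (normP (q.1 - p.1)) => -[s1 ->]; case: (normP (q.2 - p.2)) => -[s2 ->];
case: (normP (x' - x)) => -[s3 ->]; case: (normP (y' - y)) => -[s4 ->];
  move=> a1 a2 a3 a4; split; apply/andP; split; lra.
Qed.

Lemma near_id_chain : exists es, chain es /\ fwd es =1 F.
Proof.
pose V p := F (Hz' p); pose V' p := Hz (F' p).
exists [:: (Hz, Hz'); (V, V')]; split; last by move=> p /=; rewrite /V HzK.
have V1 p : (V p).1 = p.1 by rewrite /V /Hz' xiE.
split; [|split=> //]; apply: Elementary => //=.
- by move=> p; rewrite /Hz /= period.
- by move=> p h; rewrite /Hz out// -surjective_pairing.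
- by exists 1.
- left; split=> // p q pq lt; have [h _] := lip p q; have [a1 a2] := split_norm h.
  rewrite pq subrr normr0 addr0 gtr0_norm in a1 a2; last lra.
  by rewrite /Hz /=; lra.
- by move=> p; rewrite /V /V' FK HzVK.
- by move=> p; rewrite /V /V' HzK F'K.
- by move=> p; apply: (@continuous_comp _ _ _ Hz' F); [exact: Hz'_cont|exact: F_cont].
- by move=> p; apply: (@continuous_comp _ _ _ F' Hz); [exact: F'_cont|exact: Hz_cont].
- move=> p; have E : Hz' (p.1 + 2, p.2) = ((Hz' p).1 + 2, (Hz' p).2).
    rewrite /Hz' /=; congr pair; apply: (@row_inj _ _ p.2).
    by rewrite (xiE (_, _)) (period (xi p, p.2)) /= xiE.
  by rewrite /V E period.
- move=> p h; have E : Hz' p = p.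
    rewrite [RHS]surjective_pairing /Hz'; congr pair; apply: (@row_inj _ _ p.2).
    by rewrite xiE -surjective_pairing out.
  by rewrite /V E out.
- by exists 0 => p; rewrite V1 subrr normr0.
- right; split=> // p q pq lt; have [h1 h2] := lip (Hz' p) (Hz' q).
  have [a1 a2] := split_norm h1; have [a3 a4] := split_norm h2.
  rewrite /= !xiE in a1 a2 a3 a4; rewrite /V.
  rewrite [`|q.2 - p.2|]gtr0_norm in a1 a2 a3 a4; last lra.
  by case: (normP (xi q - xi p)) a1 a2 a3 a4 => -[s3 ->] a1 a2 a3 a4; lra.
Qed.
End NearIdentity.

Section Lifts.
Variable R : realType.
Notation mobius := (mobius R).
Notation strip := (strip R).
Implicit Types (p q : R * R) (x y z : strip) (f g h : mobius -> mobius) (k : int).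
Implicit Types es fs : seq ((R * R -> R * R) * (R * R -> R * R)).

Definition deck k p : R * R := (p.1 + k%:~R, (-1) ^+ `|k|%N * p.2).

Lemma in_stripE p : in_strip p = (`|p.2| <= 2^-1).
Proof. by rewrite ler_norml. Qed.

Lemma norm_deck k p : `|(deck k p).2| = `|p.2|.
Proof. by rewrite /deck /= normrM normrX normrN1 expr1n mul1r. Qed.

Lemma proj_deck x z k : val z = deck k (val x) -> proj x = proj z.
Proof.
have itau m p : iter m (@tau R) p = (p.1 + m%:R, (-1) ^+ m * p.2).
  elim: m => [|m IH]; first by case: p => a b; rewrite /= expr0 addr0 mul1r.
  by rewrite iterS IH /tau/= exprS -natr1 addrA mulN1r mulNr.
case: k => m zE; apply/eqmodP/asboolP.
  by exists m; left; rewrite itau zE.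
exists m.+1; right; rewrite itau zE /deck /= NegzE rmorphN /= -pmulrn subrK ?abszN ?absz_nat.
by rewrite mulrA -exprMn mulrNN mulr1 expr1n mul1r -surjective_pairing.
Qed.

Lemma same_val z z' : proj z = proj z' -> `|(val z).1 - (val z').1| < 1 -> val z = val z'.
Proof.
move=> /proj_eq[k kE]; rewrite kE /= addrC addKr => k1.
have -> : k = 0.
  apply/eqP; rewrite -normr_le0 -ltzD1 add0r; move: k1.
  by rewrite -intr_norm -[1]/(1%:~R) ltr_int.
by rewrite addr0 expr0 mul1r -surjective_pairing.
Qed.

Lemma int_continuous_constant (f : R -> R) : continuous f -> (forall s, exists k : int, f s = k%:~R) ->
  forall s t, f s = f t.
Proof.
move=> cf fi; apply: locally_constant => s; have [k kE] := fi s.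
have cs : {for s, continuous f} by exact: cf.
have h0 : \forall t \near s, `|f s - f t| < 1 by exact: (proj1 (cvgrPdist_lt _ _) cs 1 ltr01).
apply: filterS h0 => t.
have [l lE] := fi t; rewrite kE lE -intrB -intr_norm -[1]/(1%:~R) ltr_int => h.
by congr (_%:~R); lia.
Qed.

Lemma fwd_out es p : chain es -> 2^-1 <= `|p.2| -> fwd es p = p.
Proof. by elim: es => //= e es IH [E c] h; rewrite (elem_out E h) IH. Qed.

Lemma fwd_strip es p : chain es -> in_strip p -> in_strip (fwd es p).
Proof.
rewrite !in_stripE => c h.
by have := @fwd_band R 1 (fun=> p) es c (fun=> h) ord0.
Qed.

Definition lifts h es : Prop := chain es /\
  forall x, exists z, val z = fwd es (val x) /\ h (proj x) = proj z.

Lemma lift_unique h es fs : lifts h es -> lifts h fs -> fwd es =1 fwd fs.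
Proof.
move=> [c Le] [c' Lf] p.
pose f (s : R) := (fwd es (p.1, s)).1 - (fwd fs (p.1, s)).1.
have rel q : in_strip q -> exists k, fwd es q = deck k (fwd fs q).
  move=> sq; have [z [<- hz]] := Le (exist _ q sq); have [z' [<- hz']] := Lf (exist _ q sq).
  by apply: proj_eq; rewrite -hz.
have outs q : ~~ in_strip q -> fwd es q = q /\ fwd fs q = q.
  by rewrite in_stripE -ltNge => /ltW hq; rewrite !fwd_out.
have fi s : exists k : int, f s = k%:~R.
  have [/rel[k kE]|/outs[h1 h2]] := boolP (in_strip (p.1, s)).
    by exists k; rewrite /f kE /= addrC addKr.
  by exists 0; rewrite /f h1 h2 subrr.
have line : continuous (fun s : R => (p.1, s)).
  by move=> s; exact: (cvg_pair (cvg_cst _) cvg_id).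
have cfst : continuous (@fst R R) by move=> q; exact: cvg_fst.
have cont gs : chain gs -> continuous (fun s : R => (fwd gs (p.1, s)).1).
  move=> cg s; apply: (@continuous_comp _ _ _ (fun s => fwd gs (p.1, s)) (@fst R R)); last exact: cfst.
  by apply: (@continuous_comp _ _ _ (fun s => (p.1, s)) (fwd gs)); [exact: line|exact: fwd_continuous].
have cf : continuous f by move=> s; apply: cvgB; exact: cont.
have f0 : f p.2 = 0.
  rewrite (int_continuous_constant cf fi p.2 1) /f !fwd_out ?subrr//= normr1; lra.
have [sp|/outs[-> ->]//] := boolP (in_strip p).
have [k kE] := rel p sp; move: f0; rewrite /f -surjective_pairing kE /= addrC addKr => k0.
have -> : k = 0 by apply/eqP; rewrite -(intr_eq0 R) k0.
by rewrite /deck addr0 expr0 mul1r -surjective_pairing.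
Qed.

Lemma lifts_id : lifts id [::].
Proof. by split=> // x; exists x. Qed.

Lemma lifts_comp f g es fs : lifts f es -> lifts g fs -> lifts (g \o f) (es ++ fs).
Proof.
move=> [c Le] [c' Lf]; split; first exact/chain_cat.
move=> x; have [z [zE hz]] := Le x; have [z' [zE' hz']] := Lf z.
by exists z'; rewrite fwd_cat -zE zE' /= hz.
Qed.

Lemma elementary_inv (e e' : R * R -> R * R) : elementary e e' -> elementary e' e.
Proof.
move=> E; have K := elemK E; have VK := elemVK E.
have inj := can_inj K; split=> //; [exact: (elem_contV E)|exact: (elem_cont E)|..].
- move=> p; apply: inj; rewrite VK -[in LHS](VK p).
  by have := elem_period E (e' p); rewrite /= => ->.
- by move=> p h; rewrite -{1}(elem_out E h) K.
- by have [C hC] := elem_disp E; exists C => p; rewrite distrC -{1}(VK p).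
- case: (elem_dir E) => -[h1 h2]; [left|right].
    have h1' p : (e' p).2 = p.2 by rewrite -{2}(VK p) h1.
    split=> // p q pq lt; case: (ltgtP (e' p).1 (e' q).1) => // h.
      have := h2 (e' q) (e' p); rewrite !h1' !VK => /(_ (esym pq) h) h'.
      by have := lt_trans lt h'; rewrite ltxx.
    have : e' p = e' q by rewrite [LHS]surjective_pairing [RHS]surjective_pairing h !h1' pq.
    by move=> /(can_inj VK) pqE; rewrite pqE ltxx in lt.
  have h1' p : (e' p).1 = p.1 by rewrite -{2}(VK p) h1.
  split=> // p q pq lt; case: (ltgtP (e' p).2 (e' q).2) => // h.
    have := h2 (e' q) (e' p); rewrite !h1' !VK => /(_ (esym pq) h) h'.
    by have := lt_trans lt h'; rewrite ltxx.
  have : e' p = e' q by rewrite [LHS]surjective_pairing [RHS]surjective_pairing h !h1' pq.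
  by move=> /(can_inj VK) pqE; rewrite pqE ltxx in lt.
Qed.

Definition inv_chain es := rev [seq (e.2, e.1) | e <- es].

Lemma inv_chainP es : chain es -> chain (inv_chain es) /\ fwd (inv_chain es) =1 bwd es.
Proof.
elim: es => //= e es IH [E /IH[c h]]; rewrite /inv_chain /= rev_cons -cats1 -/(inv_chain es).
split; first by apply/chain_cat; split=> //=; split=> //; exact: elementary_inv.
by move=> p; rewrite fwd_cat h.
Qed.

Lemma lifts_inv f g es : cancel f g -> lifts f es -> lifts g (inv_chain es).
Proof.
move=> fK [c Le]; have [ci E] := inv_chainP c; split=> // x.
have sq := fwd_strip ci (valP x); pose y : strip := exist (fun p => in_strip p) _ sq.
exists y; split=> //; have [z [zE hz]] := Le y.
have : val z = val x by rewrite zE /y /= E (bwdK c).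
by move=> /val_inj <-; rewrite -hz fK.
Qed.

Lemma diff_expand (u : R * R -> R) p e : differentiable u p -> 0 < e ->
  \forall q \near p, `|u q - u p - ('D_(dir R false) u p * (q.1 - p.1) +
     'D_(dir R true) u p * (q.2 - p.2))| <= e * dist p q.
Proof.
move=> du e0; have [_ h1] := (diff_locallyP _ _).1 du; have h := (eqaddoP _ _ _ _).1 h1 e e0.
rewrite (near_shift (0 : R * R) p) subr0; apply: filterS h => v /=.
have -> : u (v + p) - u p - ('D_(dir R false) u p * ((v + p).1 - p.1) +
    'D_(dir R true) u p * ((v + p).2 - p.2)) = (u \o shift p - (cst (u p) + 'd u p)) v.
  rewrite !fctE /= [in RHS]opprD [in RHS]addrA; congr (_ - _).
  rewrite [X in 'd u p X]dir_decomp linearD !linearZ /= -!deriveE//.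
  by rewrite /GRing.scale /= !addrK mulrC [v.2 * _]mulrC.
have -> : dist p (v + p) = `|v| by rewrite /dist /= !addrK.
by [].
Qed.

Lemma unimodular_lift h es x : smooth_map h -> preserves_omega h -> lifts h es ->
  unimodular_at (fwd es) (val x).
Proof.
move=> sh ph [c Le]; have [F lF] := sh x.
have jF := (preserves_omegaP sh).1 ph x F lF.
have [U [oU Ux sF FU]] := lF; set p := val x in Ux jF *.
have E q : in_strip q -> U q -> exists k, fwd es q = deck k (F q).
  move=> sq Uq; have [a [aE ha]] := FU (exist _ q sq) Uq.
  have [b [bE hb]] := Le (exist _ q sq).
  by rewrite -bE -aE; apply: proj_eq; rewrite -hb.
have [k kp] := E p (valP x) Ux.
have d1 : differentiable (fun q => (F q).1) p by exact: (sF.1 [::]).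
have d2 : differentiable (fun q => (F q).2) p by exact: (sF.2 [::]).
have c1 : {for p, continuous (fun q => (F q).1)} by exact: differentiable_continuous.
have c2 : {for p, continuous (fun q => (fwd es q).1)}.
  have cfst : continuous (@fst R R) by move=> q; exact: cvg_fst.
  by apply: (@continuous_comp _ _ _ (fwd es) (@fst R R)); [exact: fwd_continuous|exact: cfst].
have half : 0 < 2^-1 :> R by [].
have n1 : \forall q \near p, `|(F p).1 - (F q).1| < 2^-1.
  exact: (proj1 (cvgrPdist_lt _ _) c1 _ half).
have n2 : \forall q \near p, `|(fwd es p).1 - (fwd es q).1| < 2^-1.
  exact: (proj1 (cvgrPdist_lt _ _) c2 _ half).
have same : \forall q \near p, in_strip q -> fwd es q = deck k (F q).
  near=> q => sq.
  have Uq : U q by near: q; exact: open_nbhs_nbhs.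
  have g1 : `|(F p).1 - (F q).1| < 2^-1 by near: q; exact: n1.
  have g2 : `|(fwd es p).1 - (fwd es q).1| < 2^-1 by near: q; exact: n2.
  have [k' kq] := E q sq Uq; suff -> : k = k' by [].
  have : `|(k' - k)%:~R| < 1 :> R.
    by rewrite intrB; move: g1 g2; rewrite kp kq /= !ltr_norml; lra.
  by rewrite -intr_norm -[1]/(1%:~R) ltr_int; lia.
pose s : R := (-1) ^+ `|k|%N; have ns : `|s| = 1 by rewrite /s normrX normrN1 expr1n.
have [_ dE] := diff_coord d1 d2.
exists ('D_(dir R false) (fun q => (F q).1) p), ('D_(dir R true) (fun q => (F q).1) p),
  (s * 'D_(dir R false) (fun q => (F q).2) p), (s * 'D_(dir R true) (fun q => (F q).2) p).
split.
  have alg (a b c0 d : R) : `|a * d - c0 * b| = 1 -> `|a * (s * d) - b * (s * c0)| = 1.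
    move=> jd; have -> : a * (s * d) - b * (s * c0) = s * (a * d - c0 * b) by ring.
    by rewrite normrM ns jd mulr1.
  by move: jF; rewrite /jac !dE; exact: alg.
move=> e e0; have m1 := diff_expand d1 e0; have m2 := diff_expand d2 e0.
near=> q => sq.
have qE : in_strip q -> fwd es q = deck k (F q) by near: q.
rewrite (qE sq) kp /deck /= -/s; split.
  have -> : (F q).1 + k%:~R - ((F p).1 + k%:~R) = (F q).1 - (F p).1 by ring.
  by near: q.
have -> : s * (F q).2 - s * (F p).2 - (s * 'D_(dir R false) (fun q0 => (F q0).2) p * (q.1 - p.1) +
     s * 'D_(dir R true) (fun q0 => (F q0).2) p * (q.2 - p.2)) =
  s * ((F q).2 - (F p).2 - ('D_(dir R false) (fun q0 => (F q0).2) p * (q.1 - p.1) +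
     'D_(dir R true) (fun q0 => (F q0).2) p * (q.2 - p.2))) by ring.
by rewrite normrM ns mul1r; near: q.
Unshelve. all: by end_near. Qed.
End Lifts.

Section Derivatives.
Variable R : realType.
Implicit Types (u : R * R -> R) (p v : R * R).

Lemma is_derive_line u p v (t : R) : derivable u (p + t *: v) v ->
  is_derive t 1 (fun s : R => u (p + s *: v)) ('D_v u (p + t *: v)).
Proof.
move=> du; have E : (fun h : R => h^-1 *: (((fun s : R => u (p + s *: v)) \o shift t) (h *: (1 : R)) -
     u (p + t *: v))) = (fun h : R => h^-1 *: ((u \o shift (p + t *: v)) (h *: v) - u (p + t *: v))).
  apply/funext => h /=; congr (_ *: (u _ - _)).
  by rewrite /GRing.scale /= mulr1 -/(GRing.scale _ _) scalerDl addrCA addrA.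
by split; [rewrite /derivable E|rewrite /derive E].
Qed.

Lemma derive_affine u p v c (s k : R) : differentiable u (p + c) ->
  'D_v (fun q => s * u (q + c) + k) p = s * 'D_v u (p + c).
Proof.
move=> du; have E : (fun h : R => h^-1 *: (((fun q => u (q + c)) \o shift p) (h *: v) -
     u (p + c))) = (fun h : R => h^-1 *: ((u \o shift (p + c)) (h *: v) - u (p + c))).
  by apply/funext => h /=; rewrite addrA.
have d1 : derivable (fun q => u (q + c)) p v.
  by rewrite /derivable E; exact: diff_derivable.
have e1 : 'D_v (fun q => u (q + c)) p = 'D_v u (p + c) by rewrite /derive E.
have d2 : derivable (fun q => s * u (q + c)) p v by apply: derivableM => //; exact: derivable_cst.
rewrite (deriveD d2) ?derive_cst ?addr0; last exact: derivable_cst.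
rewrite (deriveM _ d1) ?derive_cst ?scaler0 ?addr0; last exact: derivable_cst.
by rewrite e1.
Qed.

Lemma mvt_local (f : R -> R) (l e : R) : 0 < l ->
  (forall t, 0 <= t <= l -> exists g dg, [/\ is_derive t 1 g dg, `|dg| <= e &
     \forall s \near t, 0 <= s <= l -> f s = g s]) -> `|f l - f 0| <= e * l.
Proof.
move=> l0 H.
have der t : t \in `]0, l[ -> derivable f t 1 /\ `|'D_1 f t| <= e.
  rewrite in_itv /= => /andP[t0 tl]; have [|g [dg [dg1 dge fg]]] := H t; first by rewrite !ltW.
  have n1 : \forall s \near t, g s = f s.
    near=> s; have s0 : 0 < s by near: s; exact: lt_nbhsr.
    have sl : s < l by near: s; exact: lt_nbhsl.
    by symmetry; have : 0 <= s <= l by [rewrite !ltW]; near: s.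
  have dgE : derivable g t 1 by case: dg1.
  split; first exact: near_eq_derivable n1 dgE.
  by rewrite -(@near_eq_derive _ _ _ g f t (1 : R) n1) (@derive_val _ _ _ _ _ _ _ dg1).
have c : {within `[0, l], continuous f}.
  apply/(continuous_within_itvP _ l0); split.
  - by move=> t /der[d _]; apply: differentiable_continuous; apply/derivable1_diffP.
  - have [|g [dg [dg1 dge fg]]] := H 0; first by rewrite lexx ltW.
    have cg : {for 0, continuous g}.
      by apply: differentiable_continuous; apply/derivable1_diffP; case: dg1.
    have -> : f 0 = g 0 by have := nbhs_singleton fg; apply; rewrite lexx ltW.
    have cg' : g x @[x --> 0^'+] --> g 0 by exact: cvg_at_right_filter.
    apply: cvg_trans cg'; apply: near_eq_cvg; near=> s.
    symmetry; have : 0 <= s <= l.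
      by apply/andP; split; apply: ltW; near: s; [exact: nbhs_right_gt|exact: nbhs_right_lt].
    by near: s; apply: cvg_at_right_filter fg; exact: cvg_id.
  - have [|g [dg [dg1 dge fg]]] := H l; first by rewrite lexx ltW.
    have cg : {for l, continuous g}.
      by apply: differentiable_continuous; apply/derivable1_diffP; case: dg1.
    have -> : f l = g l by have := nbhs_singleton fg; apply; rewrite lexx ltW.
    have cg' : g x @[x --> l^'-] --> g l by exact: cvg_at_left_filter.
    apply: cvg_trans cg'; apply: near_eq_cvg; near=> s.
    symmetry; have : 0 <= s <= l.
      by apply/andP; split; apply: ltW; near: s; [exact: nbhs_left_gt|exact: nbhs_left_lt].
    by near: s; apply: cvg_at_left_filter fg; exact: cvg_id.
have [|s sl ->] := @MVT _ f (fun t => 'D_1 f t) 0 l l0 _ c.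
  by move=> t /der[d _]; exact: derivableP.
by rewrite subr0 normrM (gtr0_norm l0) ler_wpM2r ?(ltW l0)//; have [] := der s sl.
Unshelve. all: by end_near. Qed.
End Derivatives.

Section NearIdentity.
Variable R : realType.
Notation mobius := (mobius R).
Notation strip := (strip R).
Notation diffOmega := (diffOmega R).
Implicit Types (p q : R * R) (x y z : strip) (f g h : mobius -> mobius) (k : int).

Lemma deck_strip k p : in_strip p -> in_strip (deck k p).
Proof. by rewrite !in_stripE norm_deck. Qed.

Definition deck_point k x : strip := exist (fun p => in_strip p) _ (deck_strip k (valP x)).

Lemma proj_deck_point k x : proj (deck_point k x) = proj x.
Proof. by symmetry; exact: (@proj_deck R x (deck_point k x) k). Qed.

Lemma deck_lift k x : local_lift id x (deck k).
Proof.
exists setT; split=> //; [exact: openT| |]; last first.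
  by move=> y _; exists (deck_point k y); rewrite proj_deck_point.
have c1 : continuous (@fst R R) by move=> p; exact: cvg_fst.
have c2 : continuous (@snd R R) by move=> p; exact: cvg_snd.
split.
  exact: (smooth_onD openT (@smooth_linear R setT (@fst R R) c1) (@smooth_cst R setT k%:~R)).
exact: (smooth_onM openT (@smooth_cst R setT ((-1) ^+ `|k|%N)) (@smooth_linear R setT (@snd R R) c2)).
Qed.

Definition close1 (e : R) h x : Prop := exists G, [/\ local_lift h x G,
  `|(G (val x)).1 - (val x).1| < e, `|(G (val x)).2 - (val x).2| < e &
  forall b, `|'D_(dir R b) (fun p => (G p).1) (val x) - (dir R b).1| < e /\
    `|'D_(dir R b) (fun p => (G p).2) (val x) - (dir R b).2| < e].

Definition near_id h : Prop :=
  exists2 e, e < 8^-1 & forall x, 0 <= (val x).1 <= 2 -> close1 e h x.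

Lemma lift_differentiable h x G : local_lift h x G ->
  differentiable (fun p => (G p).1) (val x) /\ differentiable (fun p => (G p).2) (val x).
Proof. by move=> [U [_ Ux [s1 s2] _]]; split; [exact: (s1 [::])|exact: (s2 [::])]. Qed.

Lemma close1_id (e : R) x : 0 < e -> close1 e id x.
Proof.
move=> e0; exists id; split; [exact: local_lift_id|by rewrite subrr normr0..|].
have c1 : continuous (@fst R R) by move=> p; exact: cvg_fst.
have c2 : continuous (@snd R R) by move=> p; exact: cvg_snd.
have D (l : {linear (R * R)%type -> R^o}) v : continuous l -> 'D_v l (val x) = l v.
  by move=> cl; rewrite deriveE ?diff_lin//; exact: linear_differentiable.
by move=> b; rewrite (D (@fst R R) _ c1) (D (@snd R R) _ c2) !subrr normr0.
Qed.

Lemma near_id_open : cinfty_open [set f : diffOmega | near_id (val f)].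
Proof.
move=> f [e e8 hf]; pose d := (8^-1 - e) / 2.
have d0 : 0 < d by rewrite /d divr_gt0// subr_gt0.
exists (`[0, 2]%classic `*` `[- 2^-1, 2^-1]%classic), 1%N, d; split=> //.
  by apply: compact_setX; exact: segment_compact.
move=> g fg; exists (e + d); first by rewrite /d; lra.
move=> x x02; have [|F [G [lF lG FG]]] := fg x.
  by split=> /=; rewrite in_itv //=; exact: (valP x).
have [G1 [lG1 v1 v2 dv]] := hf x x02.
have [k kE] := lift_uniq lF lG1.
pose s : R := (-1) ^+ `|k|%N.
have ns : `|s| = 1 by rewrite /s normrX normrN1 expr1n.
have ss : s * s = 1 by rewrite /s -exprMn mulrNN mulr1 expr1n.
have [z [zG _]] := local_lift_val lG.
have [f1 f2] := lift_differentiable lF; have [g1 g2] := lift_differentiable lG.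
have [h1 h2] := lift_differentiable lG1.
have kx : F (val x) = ((G1 (val x)).1 + k%:~R, s * (G1 (val x)).2).
  by have := nbhs_singleton kE; apply; exact: (valP x).
have Ddeck (l : int) (H : R * R -> R * R) b (c : R) : differentiable (fun p => (H p).1) (val x) ->
    differentiable (fun p => (H p).2) (val x) ->
    'D_(dir R b) (fun p => (H p).1 + c) (val x) = 'D_(dir R b) (fun p => (H p).1) (val x) /\
    'D_(dir R b) (fun p => s * (H p).2) (val x) = s * 'D_(dir R b) (fun p => (H p).2) (val x).
  move=> k1 k2; split.
    have := @derive_affine R (fun p => (H p).1) (val x) (dir R b) 0 1 c.
    rewrite addr0 mul1r => <- //; congr ('D_ _ _ _); apply/funext => p /=.
    by rewrite mul1r addr0.
  have := @derive_affine R (fun p => (H p).2) (val x) (dir R b) 0 s 0.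
  rewrite addr0 => <- //; congr ('D_ _ _ _); apply/funext => p /=.
  by rewrite !addr0.
exists (fun p => deck (- k) (G p)); split.
- exact: (local_lift_comp lG (deck_lift (- k) z) zG).
- have [/(_ [::] isT) [+ _]] := (FG, I); have := FG [::] isT => -[+ _] _.
  rewrite /= kx /deck /= rmorphN /=; move: v1; rewrite !ltr_norml; lra.
- have := FG [::] isT => -[_]; rewrite /= kx /deck /= abszN -/s => h3.
  have -> : s * (G (val x)).2 - (val x).2 =
     ((G1 (val x)).2 - (val x).2) - s * (s * (G1 (val x)).2 - (G (val x)).2).
    by rewrite mulrBr mulrA ss mul1r; ring.
  apply: le_lt_trans (ler_normB _ _) _; rewrite normrM ns mul1r; exact: ltrD.
- move=> b; have [e1 e2] := FG [:: b] isT; rewrite /= in e1 e2.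
  have D1 : 'D_(dir R b) (fun q => (F q).1) (val x) = 'D_(dir R b) (fun q => (G1 q).1) (val x).
    have [<- _] := Ddeck k G1 b k%:~R h1 h2.
    apply: strip_derive => //; first exact: differentiableD.
    by apply: filterS kE => q Fq /Fq ->.
  have D2 : 'D_(dir R b) (fun q => (F q).2) (val x) = s * 'D_(dir R b) (fun q => (G1 q).2) (val x).
    have [_ <-] := Ddeck k G1 b k%:~R h1 h2.
    apply: strip_derive => //; first exact: (differentiableM (differentiable_cst s _)).
    by apply: filterS kE => q Fq /Fq ->.
  have [w1 w2] := dv b; rewrite D1 in e1; rewrite D2 in e2.
  have [E1 E2] := Ddeck k G b (- k)%:~R g1 g2; rewrite /deck /= abszN -/s E1 E2.
  split; first by move: e1 w1; rewrite !ltr_norml; lra.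
  move: e2 w2; set u := 'D_ _ _ _; set v := 'D_ _ _ _ => e2 w2.
  have -> : s * v - (dir R b).2 = (u - (dir R b).2) - s * (s * u - v).
    by rewrite mulrBr mulrA ss mul1r; ring.
  by apply: le_lt_trans (ler_normB _ _) _; rewrite normrM ns mul1r; exact: ltrD.
Qed.

Lemma deck_even m p : deck (2 * m) p = (p.1 + 2 * m%:~R, p.2).
Proof.
rewrite /deck rmorphM /= abszM; congr pair.
by rewrite exprM expr2 mulrNN mulr1 expr1n mul1r.
Qed.

Lemma close1_shift e h x m : close1 e h (deck_point (2 * - m) x) -> close1 e h x.
Proof.
set x0 := deck_point _ x => -[G [lG v1 v2 dv]].
have x0E : val x0 = ((val x).1 + 2 * (- m)%:~R, (val x).2) by rewrite -deck_even.
have x0D : deck (2 * - m) (val x) = val x0 by [].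
have x01 : (val x0).1 = (val x).1 - 2 * m%:~R by rewrite x0E /= rmorphN /= mulrN.
have x02 : (val x0).2 = (val x).2 by rewrite x0E.
have [z [zG _]] := local_lift_val lG.
exists (fun p => deck (2 * m) (G (deck (2 * - m) p))).
have [g1 g2] := lift_differentiable lG.
split.
- have l1 := local_lift_comp (deck_lift (2 * - m) x) lG erefl.
  exact: (local_lift_comp l1 (deck_lift (2 * m) z) zG).
- rewrite x0D deck_even [X in `|X|](_ : _ = (G (val x0)).1 - (val x0).1)//.
  by rewrite x01 /=; ring.
- by rewrite x0D deck_even /= -x02.
move=> b; pose c : R * R := (2 * (- m)%:~R, 0).
have xc : val x + c = val x0 by rewrite x0E /c; case: (val x) => u v; congr pair; rewrite /= addr0.
have [w1 w2] := dv b.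
have -> : (fun p => (deck (2 * m) (G (deck (2 * - m) p))).1) =
    (fun p => 1 * (G (p + c)).1 + 2 * m%:~R).
  apply/funext => p; rewrite !deck_even mul1r /=; congr ((G _).1 + _).
  by rewrite /c; case: p => u v; congr pair; rewrite /= addr0.
have -> : (fun p => (deck (2 * m) (G (deck (2 * - m) p))).2) =
    (fun p => 1 * (G (p + c)).2 + 0).
  apply/funext => p; rewrite !deck_even mul1r addr0 /=; congr ((G _).2).
  by rewrite /c; case: p => u v; congr pair; rewrite /= addr0.
have E1 := @derive_affine R (fun q => (G q).1) (val x) (dir R b) c 1 (2 * m%:~R).
have E2 := @derive_affine R (fun q => (G q).2) (val x) (dir R b) c 1 0.
rewrite xc mul1r in E1; rewrite xc mul1r in E2.
by rewrite (E1 g1) (E2 g2).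
Qed.

Section Lift.
Variable h : mobius -> mobius.
Hypotheses (hd : diff_omega_rel h) (hn : near_id h).

Let all_close : exists2 e, e < 8^-1 & forall x, close1 e h x.
Proof.
have [e e8 H] := hn; exists e => // x; apply: (@close1_shift e h x (Num.floor ((val x).1 / 2))).
apply: H; rewrite [val _](deck_even _ _) /=; set m := Num.floor _.
have h1 : m%:~R <= (val x).1 / 2 by rewrite -floor_ge_int.
have h2 : (val x).1 / 2 < (m + 1)%:~R by rewrite -floor_lt_int ltzD1.
by rewrite rmorphN /=; rewrite rmorphD /= in h2; lra.
Qed.

Let move_small x : exists z, [/\ h (proj x) = proj z, `|(val z).1 - (val x).1| < 8^-1 &
  `|(val z).2 - (val x).2| < 8^-1].
Proof.
have [e e8 H] := all_close; have [G [lG v1 v2 _]] := H x.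
have [z [zG hz]] := local_lift_val lG; exists z; split=> //; rewrite zG; exact: lt_trans e8.
Qed.

Let Ft x : strip := sval (cid (move_small x)).
Let FtP x := svalP (cid (move_small x)).
Let Ft_uniq x z : h (proj x) = proj z -> `|(val z).1 - (val x).1| < 2^-1 -> val z = val (Ft x).
Proof.
move=> hz zx; have [h1 h2 _] := FtP x; apply: same_val; first by rewrite -hz.
by move: zx h2; rewrite !ltr_norml => /andP[? ?] /andP[? ?]; rewrite /Ft; apply/andP; split; lra.
Qed.

Let F p : R * R := if insub p is Some x then val (Ft x) else p.
Let F_in x : F (val x) = val (Ft x). Proof. by rewrite /F valK. Qed.
Let F_out p : ~~ in_strip p -> F p = p. Proof. by move=> np; rewrite /F insubN. Qed.

Let F_id p : 2^-1 <= `|p.2| -> F p = p.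
Proof.
have [sp|np _] := boolP (in_strip p); last exact: F_out.
move=> hp; pose x : strip := exist (fun p => in_strip p) p sp.
have pE : `|(val x).2| = 2^-1 by apply/eqP; rewrite eq_le hp andbT -in_stripE.
rewrite -[p]/(val x) F_in; symmetry; apply: Ft_uniq; last by rewrite subrr normr0.
by have [_ bd _] := hd; exact: bd.
Qed.

Let F_deck k p : in_strip p -> F (deck k p) = deck k (F p).
Proof.
move=> sp; pose x : strip := exist (fun p => in_strip p) p sp.
rewrite -[p]/(val x) -[deck k (val x)]/(val (deck_point k x)) !F_in.
rewrite -[deck k _]/(val (deck_point k (Ft x))); symmetry; have [h1 h2 _] := FtP x.
apply: Ft_uniq; first by rewrite !proj_deck_point.
rewrite /= (_ : _ - _ = (val (Ft x)).1 - (val x).1); last by rewrite /=; ring.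
by apply: lt_trans h2 _; lra.
Qed.

Let F_near x : exists G, [/\ local_lift h x G,
  forall b, `|'D_(dir R b) (fun p => (G p).1) (val x) - (dir R b).1| <= 8^-1 /\
    `|'D_(dir R b) (fun p => (G p).2) (val x) - (dir R b).2| <= 8^-1 &
  \forall q \near val x, in_strip q -> F q = G q].
Proof.
have [e e8 H] := all_close; have [G [lG v1 v2 dv]] := H x; exists G; split=> //.
  by move=> b; have [w1 w2] := dv b; split; apply/ltW; exact: lt_trans e8.
have [g1 _] := lift_differentiable lG.
have c1 : {for val x, continuous (fun q => (G q).1)} by exact: differentiable_continuous.
have e0 : 0 < 8^-1 :> R by [].
have n1 : \forall q \near val x, `|(G (val x)).1 - (G q).1| < 8^-1.
  exact: (proj1 (cvgrPdist_lt _ _) c1 _ e0).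
have n2 : \forall q \near val x, `|(val x).1 - q.1| < 8^-1.
  have cf : {for val x, continuous (@fst R R)} by exact: cvg_fst.
  exact: (proj1 (cvgrPdist_lt _ _) cf _ e0).
have [U [oU Ux sG GU]] := lG.
near=> q => sq.
have Uq : U q by near: q; exact: open_nbhs_nbhs.
have m1 : `|(G (val x)).1 - (G q).1| < 8^-1 by near: q.
have m2 : `|(val x).1 - q.1| < 8^-1 by near: q.
have [z [zE hz]] := GU (exist (fun p => in_strip p) q sq) Uq.
have FqE : F q = val (Ft (exist (fun p => in_strip p) q sq)).
  exact: (F_in (exist (fun p => in_strip p) q sq)).
rewrite FqE -zE; symmetry.
apply: Ft_uniq => //; rewrite zE /=.
have v1' := lt_trans v1 e8.
by move: m1 m2 v1'; rewrite !ltr_norml => /andP[? ?] /andP[? ?] /andP[? ?]; apply/andP; split; lra.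
Unshelve. all: by end_near. Qed.

Let axis b p (l : R) : 0 < l -> in_strip p -> in_strip (p + l *: dir R b) ->
  `|(F (p + l *: dir R b)).1 - (F p).1 - l * (dir R b).1| <= 8^-1 * l /\
  `|(F (p + l *: dir R b)).2 - (F p).2 - l * (dir R b).2| <= 8^-1 * l.
Proof.
move=> l0 s0 sl.
have seg t : 0 <= t <= l -> in_strip (p + t *: dir R b).
  move: s0 sl; rewrite /in_strip /dir; case: b => /=; rewrite /GRing.scale /= ?mulr0 ?addr0 ?mulr1 => //.
  by move=> /andP[? ?] /andP[? ?] /andP[? ?]; apply/andP; split; lra.
have main (pr : R * R -> R) : (forall q (t : R), pr (q + t *: dir R b) = pr q + t * pr (dir R b)) ->
    (forall x, exists G, [/\ differentiable (pr \o G) (val x),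
       `|'D_(dir R b) (pr \o G) (val x) - pr (dir R b)| <= 8^-1 &
       \forall q \near val x, in_strip q -> F q = G q]) ->
    `|pr (F (p + l *: dir R b)) - pr (F p) - l * pr (dir R b)| <= 8^-1 * l.
  move=> prl H; pose f t := pr (F (p + t *: dir R b)) - t * pr (dir R b).
  have -> : pr (F (p + l *: dir R b)) - pr (F p) - l * pr (dir R b) = f l - f 0.
    by rewrite /f scale0r mul0r addr0 subr0 addrAC.
  apply: mvt_local => // t ht; pose x : strip := exist (fun p => in_strip p) _ (seg t ht).
  have [G [dG bG nG]] := H x; rewrite /= in dG bG nG.
  have d1 := is_derive_line (diff_derivable dG).
  have d2 : is_derive t (1 : R) (fun s : R => s * pr (dir R b)) (pr (dir R b)).
    have E : (fun s : R => s * pr (dir R b)) = (pr (dir R b) \*: id).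
      by apply/funext => s; rewrite /= /GRing.scale /= mulrC.
    rewrite E; apply: is_derive_eq; rewrite /GRing.scale /= mulr1//.
  exists (fun s => (pr \o G) (p + s *: dir R b) - s * pr (dir R b)),
    ('D_(dir R b) (pr \o G) (p + t *: dir R b) - pr (dir R b)); split=> //.
    exact: is_deriveB.
  have cl : {for t, continuous (fun s : R => p + s *: dir R b)}.
    by apply: cvgD; [exact: cvg_cst|apply: cvgZr_tmp; exact: cvg_id].
  have ncl : \forall s \near t, in_strip (p + s *: dir R b) -> F (p + s *: dir R b) = G (p + s *: dir R b).
    exact: (cl _ nG).
  apply: filterS ncl => s nGs hs.
  by rewrite /f nGs//; exact (seg s hs).
split; [apply: (main fst)|apply: (main snd)] => //.
- by move=> x; have [G [lG dv nG]] := F_near x; exists G; have [? ?] := lift_differentiable lG;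
    have [? ?] := dv b.
- by move=> x; have [G [lG dv nG]] := F_near x; exists G; have [? ?] := lift_differentiable lG;
    have [? ?] := dv b.
Qed.

Let near_le p q : Prop := `|(F q).1 - q.1 - ((F p).1 - p.1)| <= 8^-1 * (`|q.1 - p.1| + `|q.2 - p.2|) /\
  `|(F q).2 - q.2 - ((F p).2 - p.2)| <= 8^-1 * (`|q.1 - p.1| + `|q.2 - p.2|).

Let near_sym p q : near_le p q -> near_le q p.
Proof.
by rewrite /near_le [`|q.1 - p.1|]distrC [`|q.2 - p.2|]distrC => -[h1 h2]; split; rewrite distrC.
Qed.

Let axis_le b p (l : R) : in_strip p -> in_strip (p + l *: dir R b) -> near_le p (p + l *: dir R b).
Proof.
wlog l0 : p l / 0 <= l => [hw sp sl|sp sl].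
  have [|l0] := leP 0 l; first by move=> l0; exact: hw.
  apply: near_sym; have := hw (p + l *: dir R b) (- l).
  by rewrite scaleNr addrK; apply=> //; rewrite oppr_ge0 ltW.
move: l0; rewrite le_eqVlt => /orP[/eqP <-|l0].
  by rewrite /near_le scale0r addr0 !subrr normr0 addr0 mulr0.
have [h1 h2] := axis l0 sp sl; rewrite /near_le.
have -> : `|(p + l *: dir R b).1 - p.1| + `|(p + l *: dir R b).2 - p.2| = l.
  have e1 : (p + l *: dir R b).1 - p.1 = l * (dir R b).1 by rewrite /= /GRing.scale /=; ring.
  have e2 : (p + l *: dir R b).2 - p.2 = l * (dir R b).2 by rewrite /= /GRing.scale /=; ring.
  rewrite e1 e2 /dir; case: (b); rewrite /= mulr0 mulr1 normr0 ?addr0 ?add0r gtr0_norm//.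
split.
  by apply: le_trans h1; rewrite le_eqVlt; apply/orP; left; apply/eqP; congr `|_|; rewrite /= /GRing.scale /=; ring.
by apply: le_trans h2; rewrite le_eqVlt; apply/orP; left; apply/eqP; congr `|_|; rewrite /= /GRing.scale /=; ring.
Qed.

Let lip_strip p q : in_strip p -> in_strip q ->
  `|(F q).1 - q.1 - ((F p).1 - p.1)| <= 8^-1 * (`|q.1 - p.1| + `|q.2 - p.2|) /\
  `|(F q).2 - q.2 - ((F p).2 - p.2)| <= 8^-1 * (`|q.1 - p.1| + `|q.2 - p.2|).
Proof.
move=> sp sq; pose r : R * R := (q.1, p.2).
have sr : in_strip r by [].
have rE : p + (q.1 - p.1) *: dir R false = r.
  by case: p q {sp sq sr} @r => a b [c d] r; congr pair; rewrite /= /GRing.scale /=; ring.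
have qE : r + (q.2 - p.2) *: dir R true = q.
  by case: p q {sp sq sr rE} @r => a b [c d] r; congr pair; rewrite /r /= /GRing.scale /=; ring.
have [a1 a2] : near_le p r by rewrite -rE; apply: axis_le; rewrite ?rE.
have [b1 b2] : near_le r q by rewrite -[X in near_le _ X]qE; apply: axis_le; rewrite ?qE.
rewrite /r /= !subrr !normr0 ?addr0 ?add0r in a1 a2 b1 b2.
rewrite -/r in a1 a2 b1 b2.
have tri (u v w : R) (s t : R) : `|v - u| <= 8^-1 * s -> `|w - v| <= 8^-1 * t -> `|w - u| <= 8^-1 * (s + t).
  by move=> h1 h2; have := ler_normD (w - v) (v - u); rewrite subrKA; lra.
by split; [exact: tri a1 b1|exact: tri a2 b2].
Qed.

Let lip p q :
  `|(F q).1 - q.1 - ((F p).1 - p.1)| <= 4^-1 * (`|q.1 - p.1| + `|q.2 - p.2|) /\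
  `|(F q).2 - q.2 - ((F p).2 - p.2)| <= 4^-1 * (`|q.1 - p.1| + `|q.2 - p.2|).
Proof.
have weak (u s : R) : 0 <= s -> u <= 8^-1 * s -> u <= 4^-1 * s by move=> ? ?; lra.
have s0 : 0 <= `|q.1 - p.1| + `|q.2 - p.2| by rewrite addr_ge0.
(* a segment that leaves the strip is cut at the boundary, where F is the identity *)
have cross u v : in_strip u -> ~~ in_strip v -> near_le u v.
  move=> su nv; rewrite /near_le (F_out nv) !subrr.
  have cut (c : R) : `|c| = 2^-1 -> `|c - u.2| <= `|v.2 - u.2| ->
      `|0 - ((F u).1 - u.1)| <= 8^-1 * (`|v.1 - u.1| + `|v.2 - u.2|) /\
      `|0 - ((F u).2 - u.2)| <= 8^-1 * (`|v.1 - u.1| + `|v.2 - u.2|).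
    move=> c2 cu; have sc : in_strip (u.1, c) by rewrite in_stripE /= c2.
    have [h1 h2] := lip_strip su sc; rewrite F_id /= ?c2// !subrr normr0 add0r in h1 h2.
    by rewrite !add0r; rewrite ?add0r in h1 h2; have := normr_ge0 (v.1 - u.1); split; lra.
  have su2 := su; rewrite /in_strip in su2; move: su2 => /andP[u1 u2].
  have half : 0 <= 2^-1 :> R by lra.
  move: nv; rewrite /in_strip negb_and -!ltNge => /orP[vb|vt].
    by apply: (cut (- 2^-1)); [rewrite normrN ger0_norm|rewrite !ler0_norm; lra].
  by apply: (cut 2^-1); [rewrite ger0_norm|rewrite !ger0_norm; lra].
have [sp|np] := boolP (in_strip p); have [sq|nq] := boolP (in_strip q).
- by have [h1 h2] := lip_strip sp sq; split; exact: weak.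
- by have [h1 h2] := cross p q sp nq; split; exact: weak.
- by have [h1 h2] := near_sym (cross q p sq np); split; exact: weak.
- by rewrite !F_out// !subrr normr0 mulr_ge0.
Qed.

Let F_disp p : `|(F p).1 - p.1| <= 1.
Proof.
have [sp|np] := boolP (in_strip p); last by rewrite F_out// subrr normr0.
have [_ h1 _] := FtP (exist (fun p => in_strip p) p sp).
have FpE : F p = val (Ft (exist (fun p => in_strip p) p sp)).
  exact: (F_in (exist (fun p => in_strip p) p sp)).
by rewrite FpE; apply/ltW/(lt_trans h1); lra.
Qed.

Let F_period p : F (p.1 + 2, p.2) = ((F p).1 + 2, (F p).2).
Proof.
have dE q : deck 2 q = (q.1 + 2, q.2) by have := deck_even 1 q; rewrite !mulr1.
rewrite -!dE; have [sp|np] := boolP (in_strip p); first exact: F_deck.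
by rewrite !F_out// in_stripE norm_deck -in_stripE.
Qed.

Let F_onto p : exists q, F q = p.
Proof.
have [sp|np] := boolP (in_strip p); last by exists p; exact: F_out.
have [[h' [hK h'K _ _]] _ _] := hd; pose y : strip := exist (fun p => in_strip p) p sp.
pose x := repr (h' (proj y)).
have px : proj x = h' (proj y) by rewrite /proj /x reprK.
have [h1 _ _] := FtP x; have : proj y = proj (Ft x) by rewrite -h1 px h'K.
move=> /proj_eq[k kE]; exists (deck k (val x)).
by rewrite F_deck ?F_in; [rewrite -[RHS]/(val y) kE|exact: valP x].
Qed.

Lemma near_id_lifts : exists es, lifts h es.
Proof.
pose F' p := sval (cid (F_onto p)).
have F'K : cancel F' F by move=> p; exact: (svalP (cid (F_onto p))).
have F_inj : injective F.
  move=> p q E; have [] := lip p q; rewrite E.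
  rewrite (_ : _ - _ - (_ - _) = p.1 - q.1); last by ring.
  rewrite (_ : _ - _ - (_ - _) = p.2 - q.2); last by ring.
  rewrite distrC (distrC p.2) => h1 h2.
  have n1 := normr_ge0 (q.1 - p.1); have n2 := normr_ge0 (q.2 - p.2).
  have z1 : `|q.1 - p.1| = 0 by lra.
  have z2 : `|q.2 - p.2| = 0 by lra.
  rewrite [p]surjective_pairing [q]surjective_pairing.
  by move/normr0_eq0/subr0_eq: z1 => ->; move/normr0_eq0/subr0_eq: z2 => ->.
have FK : cancel F F' by move=> p; apply: F_inj; rewrite F'K.
have [es [c E]] := near_id_chain FK F'K F_period F_id F_disp lip.
exists es; split=> // x; exists (Ft x); rewrite E F_in; split=> //.
by have [] := FtP x.
Qed.
End Lift.
End NearIdentity.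

Section Component.
Variable R : realType.
Notation diffOmega := (diffOmega R).
Implicit Types f g : diffOmega.

Definition liftable f : Prop := exists es, lifts (val f) es.

Lemma val_mul f g : val (f * g)%g = val f \o val g. Proof. by []. Qed.

Lemma val_inv f : cancel (val f) (val f^-1%g).
Proof. by move=> m; have := congr1 (fun h : diffOmega => val h m) (mulVg f). Qed.

Lemma liftable_mul f g : liftable f -> liftable g -> liftable (f * g)%g.
Proof. by move=> [es h] [fs h']; exists (fs ++ es); rewrite val_mul; exact: lifts_comp h' h. Qed.

Lemma liftable_inv f : liftable f -> liftable f^-1%g.
Proof. by move=> [es h]; exists (inv_chain es); apply: lifts_inv h; exact: val_inv. Qed.

Lemma diff_rel f : diff_omega_rel (val f). Proof. exact: set_mem (valP f). Qed.

Let O : set diffOmega := [set f | near_id (val f)].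
Let oO : open O. Proof. exact: near_id_open. Qed.
Let O1 : O 1%g.
Proof.
exists 16^-1; first by rewrite ltf_pV2 ?posrE// ltr_nat.
by move=> x _; exact: close1_id.
Qed.
Let O_liftable f : O f -> liftable f.
Proof. by move=> Of; exact: near_id_lifts (diff_rel f) Of. Qed.

Let nbhs_translate f : \forall g \near f, O (g * f^-1)%g.
Proof.
apply: open_nbhs_nbhs; split; last by rewrite /= mulgV.
have /continuousP := @diff_mulr_continuous R f^-1%g; exact.
Qed.

Lemma component_liftable f : identity_component f -> liftable f.
Proof.
pose L : set diffOmega := [set f | liftable f].
have oL : open L.
  rewrite openE => g Lg; apply: filterS (nbhs_translate g) => k /O_liftable Ok.
  by rewrite /L /= -(mulgVK g k); exact: liftable_mul.
have oC : open (~` L).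
  rewrite openE => g nLg; apply: filterS (nbhs_translate g) => k /O_liftable Ok Lk.
  apply: nLg; have -> : g = ((k * g^-1)^-1 * k)%g by rewrite invgM invgK mulgVK.
  by apply: liftable_mul => //; exact: liftable_inv.
pose C := @identity_component R.
have cC : connected C by exact: component_connected.
have C1 : C 1%g by exact: connected_component_refl.
move=> Cf; have : C `&` L = C.
  apply: cC.
  - by exists 1%g; split => //; apply: O_liftable.
  - by exists L.
  - by exists L => //; rewrite -(setCK L); exact: open_closedC.
by move=> /seteqP[_ /(_ f Cf)[]].
Qed.
End Component.

Section Homogenization.
Variables (R : realType) (G : groupType).
Implicit Types (g h : G).

Lemma archimedean_zero (x C : R) : (forall k : nat, k%:R * `|x| <= C) -> x = 0.
Proof.
move=> h; apply/eqP; rewrite -normr_eq0; apply: contraT => x0.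
have px : 0 < `|x| by rewrite lt_neqAle eq_sym x0 /=.
have C0 : 0 <= C by have := h 0%N; rewrite mul0r.
have := archi_boundP (divr_ge0 C0 (ltW px)); rewrite ltr_pdivrMr//.
by rewrite ltNge h.
Qed.

Variables (phi : G -> R) (D : R).
Hypothesis phiM : forall g h, `|phi (g * h)%g - (phi g + phi h)| <= D.

Let D0 : 0 <= D. Proof. exact: le_trans (phiM 1%g 1%g). Qed.

Let phiX g k : (0 < k)%N -> `|phi (g ^+ k)%g - k%:R * phi g| <= (k%:R - 1) * D.
Proof.
case: k => // k _; elim: k => [|k IH]; first by rewrite expg1 mul1r subrr normr0 subrr mul0r.
have := phiM g (g ^+ k.+1)%g; rewrite -expgS => h.
have -> : phi (g ^+ k.+2)%g - k.+2%:R * phi g = (phi (g ^+ k.+2)%g - (phi g + phi (g ^+ k.+1)%g)) +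
   (phi (g ^+ k.+1)%g - k.+1%:R * phi g) by rewrite -[k.+2%:R]natr1; ring.
apply: le_trans (ler_normD _ _) _; rewrite -[k.+2%:R]natr1; lra.
Qed.

Let cross g (k l : nat) : (0 < k)%N -> (0 < l)%N ->
  (phi (g ^+ k)%g - D) / k%:R <= (phi (g ^+ l)%g + D) / l%:R.
Proof.
move=> k0 l0; have kR : 0 < k%:R :> R by rewrite ltr0n.
have lR : 0 < l%:R :> R by rewrite ltr0n.
rewrite ler_pdivrMr// mulrAC ler_pdivlMr//.
have h1 := phiX (g ^+ k)%g l0; rewrite -expgnA in h1.
have h2 := phiX (g ^+ l)%g k0; rewrite -expgnA mulnC in h2.
have d0 := D0; move: h1 h2; rewrite !ler_norml => /andP[h1 h2] /andP[h3 h4]; lra.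
Qed.

Let hom g : exists m, forall k, (0 < k)%N -> `|k%:R * m - phi (g ^+ k)%g| <= D.
Proof.
pose A : set R := [set z | exists2 k, (0 < k)%N & z = (phi (g ^+ k)%g - D) / k%:R].
have A0 : A !=set0 by exists ((phi (g ^+ 1)%g - D) / 1%:R); exists 1%N.
exists (sup A) => k k0; have kR : 0 < k%:R :> R by rewrite ltr0n.
have up : sup A <= (phi (g ^+ k)%g + D) / k%:R.
  by apply: ge_sup => // _ [l l0 ->]; exact: cross.
have lo : (phi (g ^+ k)%g - D) / k%:R <= sup A.
  apply: sup_upper_bound; last by exists k.
  by split=> //; exists ((phi (g ^+ k)%g + D) / k%:R) => _ [l l0 ->]; exact: cross.
by move: up lo; rewrite ler_pdivlMr// ler_pdivrMr// mulrC ler_distl => ? ?; apply/andP; split; lra.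
Qed.

Lemma homogenization : exists mu, homogeneous_quasimorphism mu /\
  forall g k, (0 < k)%N -> `|k%:R * mu g - phi (g ^+ k)%g| <= D.
Proof.
pose mu g := sval (cid (hom g)); have muP g k k0 := svalP (cid (hom g)) k k0.
have {}muP g k : (0 < k)%N -> `|k%:R * mu g - phi (g ^+ k)%g| <= D by exact: muP.
have D3 := D0.
have close (x : R) C : 0 <= C -> (forall k, (0 < k)%N -> k%:R * `|x| <= C) -> x = 0.
  move=> C0 h; apply: (@archimedean_zero x C) => -[|k]; first by rewrite mul0r.
  exact: h.
have phi1 : `|phi 1%g| <= D.
  have := phiM 1%g 1%g; rewrite mulg1 opprD addrA subrr sub0r normrN//.
have mu1 : mu 1%g = 0.
  apply: (close _ (2 * D)); first lra.
  move=> k k0; rewrite -(ger0_norm (ler0n R k)) -normrM; have := muP 1%g k k0; rewrite expg1n.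
  have := ler_normD (k%:R * mu 1%g - phi 1%g) (phi 1%g); rewrite subrK; lra.
have muX g m : mu (g ^+ m)%g = m%:R * mu g.
  case: m => [|m]; first by rewrite expg0 mu1 mul0r.
  apply/eqP; rewrite -subr_eq0; apply/eqP; apply: (close _ (2 * D)); first lra.
  move=> k k0; rewrite -(ger0_norm (ler0n R k)) -normrM.
  have h1 := muP (g ^+ m.+1)%g k k0.
  have h2 : `|(m.+1 * k)%:R * mu g - phi (g ^+ (m.+1 * k))%g| <= D by apply: muP; rewrite muln_gt0.
  rewrite expgnA natrM in h2.
  have -> : k%:R * (mu (g ^+ m.+1)%g - m.+1%:R * mu g) =
    (k%:R * mu (g ^+ m.+1)%g - phi (g ^+ m.+1 ^+ k)%g) - (m.+1%:R * k%:R * mu g - phi (g ^+ m.+1 ^+ k)%g).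
    by ring.
  by apply: le_trans (ler_normB _ _) _; lra.
have muV g : mu g^-1%g = - mu g.
  apply/eqP; rewrite -addr_eq0; apply/eqP; apply: (close _ (4 * D)); first lra.
  move=> k k0; rewrite -(ger0_norm (ler0n R k)) -normrM.
  have h1 := muP g^-1%g k k0; rewrite expVgn in h1; have h2 := muP g k k0.
  have := phiM (g^-1 ^+ k)%g (g ^+ k)%g; rewrite expVgn mulVg => h3.
  move: h1 h2 h3 phi1; rewrite mulrDr !ler_norml => /andP[? ?] /andP[? ?] /andP[? ?] /andP[? ?].
  by apply/andP; split; lra.
exists mu; split; last exact: muP.
split.
  exists (4 * D); split; first lra.
  move=> g h; have := phiM g h; have := muP (g * h)%g 1%N isT; have := muP g 1%N isT.
  have := muP h 1%N isT; rewrite !expg1 !mul1r !ler_norml.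
  move=> /andP[? ?] /andP[? ?] /andP[? ?] /andP[? ?]; apply/andP; split; lra.
move=> g [m|m] /=; first by rewrite muX pmulrn.
by rewrite muV muX NegzE rmorphN /= mulNr pmulrn.
Qed.
End Homogenization.

Section Moments.
Variable R : realType.
Notation mR := (measurableTypeR R).
Notation plane := (mR * mR)%type.
Notation lam := (@lebesgue_measure R).

Definition depth (y : R) : R := 2^-1 - Num.max (- 2^-1) (Num.min y 2^-1).

Lemma depth_range y : 0 <= depth y <= 1.
Proof.
rewrite /depth; have h : - 2^-1 <= 2^-1 :> R by lra.
have h1 : Num.max (- 2^-1) (Num.min y 2^-1) <= 2^-1 by rewrite ge_max h ge_min lexx orbT.
have h2 : - 2^-1 <= Num.max (- 2^-1) (Num.min y 2^-1) by rewrite le_max lexx.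
by apply/andP; split; lra.
Qed.

Lemma depthE y : - 2^-1 <= y <= 2^-1 -> depth y = 2^-1 - y.
Proof. by move=> /andP[h1 h2]; rewrite /depth (min_idPl h2) (max_idPr h1). Qed.

Lemma measurable_depth : measurable_fun [set: mR] (depth : mR -> mR).
Proof.
apply: measurable_funB; first exact: measurable_cst.
apply: measurable_maxr; first exact: measurable_cst.
by apply: measurable_minr => //; exact: measurable_cst.
Qed.

Let ab : - 2^-1 < 2^-1 :> R. Proof. lra. Qed.

Lemma height_law (A : set mR) : measurable A ->
  one_point (snd @^-1` A : set plane) = uniform_prob ab A.
Proof.
move=> mA.
have mI : measurable (`]- 2^-1, 2^-1]%classic : set mR) by exact: measurable_itv.
have -> : one_point (snd @^-1` A : set plane) = ((2^-1)%:E * area R (snd @^-1` A `&` @band R))%E by [].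
have -> : (snd @^-1` A `&` @band R : set plane) = `]0, 2]%classic `*` (A `&` `]- 2^-1, 2^-1]%classic).
  have half : - 2^-1 + 1 = 2^-1 :> R by lra.
  rewrite /band boxE half add0r.
  by apply/seteqP; split=> [p [h1 [h2 h3]]|p [h1 [h2 h3]]]; split.
have mAI : measurable (A `&` `]- 2^-1, 2^-1]%classic) by exact: measurableI.
have m02 : measurable (`]0, 2]%classic : set mR) by exact: measurable_itv.
rewrite (areaX m02 mAI).
have -> : lam `]0, 2]%classic = 2%:E.
  by rewrite lebesgue_measure_itv /= lte_fin ltr0n /= sube0.
rewrite muleA -EFinM mulVf ?pnatr_eq0// mul1e.
have mi : measurable_fun setT (fun x : R => (\1_A x)%:E : \bar R).
  by apply/measurable_EFinP; exact: measurable_indic.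
have := integral_uniform ab mi (fun x => ltac:(by rewrite lee_fin)).
rewrite integral_indic// setIT => ->.
have -> : (2^-1 - - 2^-1 : R) = 1 by lra.
have mJ : measurable (`[- 2^-1, 2^-1]%classic : set mR) by exact: measurable_itv.
rewrite invr1 mul1e (integral_indic _ mJ mA).
have -> : A `&` `[- 2^-1, 2^-1]%classic =
    (A `&` `]- 2^-1, 2^-1]%classic) `|` (A `&` [set - 2^-1]).
  apply/seteqP; split=> [x [Ax]|x []] /=; rewrite ?in_itv /=.
  - move=> /andP[h1 h2]; move: h1; rewrite le_eqVlt => /orP[/eqP h1|h1]; first by right; split.
    by left; split=> //; apply/andP; split.
  - by move=> [Ax /andP[h1 h2]]; split=> //; apply/andP; split=> //; exact: ltW.
  - by move=> [Ax xE]; split=> //; apply/andP; split; rewrite xE; lra.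
have mA1 : measurable (A `&` [set - 2^-1 : mR]) by exact: measurableI.
apply/eqP; rewrite eq_le; apply/andP; split.
  exact: (le_measure lam (mem_set mAI) (mem_set (measurableU _ _ mAI mA1)) (@subsetUl _ _ _)).
apply: (le_trans (measureU2 _ mAI mA1)).
rewrite -[leRHS]adde0; apply: leeD => //.
rewrite -(lebesgue_measure_set1 (- 2^-1 : R)).
exact: (le_measure lam (mem_set mA1) (mem_set (measurable_set1 _)) (@subIsetr _ _ _)).
Qed.

Lemma integral_height (g : mR -> \bar R) : measurable_fun setT g -> (forall x, (0 <= g x)%E) ->
  (\int[@one_point R]_p g p.2 = \int[lam]_(y in `[(- 2^-1)%R, (2^-1)%R]%classic) g y)%E.
Proof.
move=> mg g0.
have m2 : measurable_fun [set: plane] (snd : plane -> mR) by exact: measurable_snd.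
have := @ge0_integral_pushforward _ _ _ _ R snd m2 (@one_point R) setT g measurableT mg.
rewrite preimage_setT => <-; last by move=> y _.
rewrite (eq_measure_integral (uniform_prob ab)); last by move=> A mA _; exact: height_law.
rewrite integral_uniform//.
have -> : (2^-1 - - 2^-1 : R) = 1 by lra.
by rewrite invr1 mul1e.
Qed.

Lemma integral_depth (s : R) (m : nat) : 0 <= s <= 1 ->
  (\int[lam]_(y in `[(- 2^-1)%R, (2^-1)%R]%classic) (Num.max s (depth y) ^+ m)%:E =
   ((1 + m%:R * s ^+ m.+1) / m.+1%:R)%:E)%E.
Proof.
move=> /andP[s0 s1]; pose c : R := 2^-1 - s.
have c1 : - 2^-1 <= c by rewrite /c; lra.
have c2 : c <= 2^-1 by rewrite /c; lra.
have mg (D : set mR) : measurable_fun D (fun y : mR => (Num.max s (depth y) ^+ m)%:E : \bar R).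
  apply/measurable_funTS/measurable_EFinP; apply: measurable_funX.
  by apply: measurable_maxr; [exact: measurable_cst|exact: measurable_depth].
have low : (\int[lam]_(y in `[(- 2^-1)%R, c]%classic) (Num.max s (depth y) ^+ m)%:E =
    ((1 - s ^+ m.+1) / m.+1%:R)%:E)%E.
  move: c1; rewrite le_eqVlt => /orP[/eqP cE|lt].
    have -> : s = 1 by rewrite /c in cE; lra.
    by rewrite cE set_itv1 integral_set1 expr1n subrr mul0r.
  pose P : {poly R} := (2^-1)%:P - 'X.
  pose F y : R := - ((P ^+ m.+1).[y] / m.+1%:R).
  have PE y : P.[y] = 2^-1 - y by rewrite /P !hornerE.
  rewrite (eq_integral (fun y : mR => ((P ^+ m).[y])%:E)); last first.
    move=> y; rewrite inE /= in_itv /= => /andP[h1 h2]; congr EFin.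
    rewrite depthE; last by apply/andP; split => //; lra.
    by rewrite horner_exp PE max_r//; rewrite /c in h2; lra.
  pose Q : {poly R} := - (m.+1%:R^-1 *: P ^+ m.+1).
  have FQ : F = horner Q by apply/funext => y; rewrite /F /Q !hornerE mulrC.
  have dQ : Q^`() = P ^+ m.
    rewrite /Q derivN derivZ deriv_exp /P derivB derivC derivX sub0r mulN1r mulNrn.
    by rewrite scalerN opprK -(scaler_nat m.+1 (P ^+ m)) scalerA mulVf ?scale1r// pnatr_eq0.
  rewrite (@continuous_FTC2 R (horner (P ^+ m)) F _ _ lt); first last.
  - by move=> y _; rewrite FQ -derivE dQ.
  - rewrite FQ; split; first by move=> y _; exact: derivable_horner.
      by apply: cvg_at_right_filter; exact: continuous_horner.
    by apply: cvg_at_left_filter; exact: continuous_horner.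
  - by apply: continuous_subspaceT => y; exact: continuous_horner.
  rewrite -EFinB; congr EFin; rewrite /F !horner_exp !PE /c.
  have -> : 2^-1 - (2^-1 - s) = s by ring.
  have -> : 2^-1 - - 2^-1 = 1 :> R by lra.
  by rewrite expr1n opprK addrC mulrBl.
have high : (\int[lam]_(y in `]c, (2^-1)%R]%classic) (Num.max s (depth y) ^+ m)%:E = (s ^+ m.+1)%:E)%E.
  rewrite (eq_integral (fun _ : mR => (s ^+ m)%:E)); last first.
    move=> y; rewrite inE /= in_itv /= => /andP[h1 h2]; congr EFin.
    rewrite depthE; last by apply/andP; split => //; lra.
    by rewrite max_l//; rewrite /c in h1; lra.
  rewrite integral_cst//= lebesgue_measure_itv /= lte_fin; case: ltP => h.
    by rewrite -EFinB -EFinM; congr EFin; rewrite /c exprS mulrC; congr (_ * _); ring.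
  have -> : s = 0 by move: h; rewrite /c; lra.
  by rewrite mule0 exprS mul0r.
have -> : `[- 2^-1, 2^-1]%classic = `[- 2^-1, c]%classic `|` `]c, 2^-1]%classic.
  by rewrite -itv_bndbnd_setU// bnd_simp.
rewrite ge0_integral_setU//=; first last.
- apply/disj_setPS => y [] /=; rewrite !in_itv /= => /andP[_ h1] /andP[h2 _].
  by have := lt_le_trans h2 h1; rewrite ltxx.
- by move=> y _; rewrite lee_fin exprn_ge0// le_max s0.
have m0 : m.+1%:R != 0 :> R by rewrite pnatr_eq0.
rewrite low high -EFinD; congr EFin; rewrite -[X in _ + X](mulfK m0) -mulrDl; congr (_ / _).
by rewrite -natr1; ring.
Qed.
End Moments.

Section HeightPolynomials.
Variable R : realType.
Implicit Types (q r : {poly R}) (p : R * R) (s : seq bool).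

Let csnd : continuous (@snd R R). Proof. by move=> p; exact: cvg_snd. Qed.

Lemma smooth_height q : smooth_on setT (fun p : R * R => q.[p.2]).
Proof.
elim/poly_ind: q => [|q c IH].
  have -> : (fun p : R * R => (0 : {poly R}).[p.2]) = cst 0 by apply/funext => p; rewrite hornerC.
  exact: smooth_cst.
have -> : (fun p : R * R => (q * 'X + c%:P).[p.2]) =
    ((fun p : R * R => q.[p.2]) \* (@snd R R)) \+ cst c.
  by apply/funext => p; rewrite !hornerE.
apply: smooth_onD; [exact: openT| |exact: smooth_cst].
apply: smooth_onM; [exact: openT|exact: IH|].
exact: (@smooth_linear R setT (@snd R R) csnd).
Qed.

Lemma derive_height b q : 'D_(dir R b) (fun p : R * R => q.[p.2]) =
  (fun p : R * R => (if b then q^`() else 0).[p.2]).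
Proof.
apply/funext => p; elim/poly_ind: q => [|q c IH].
  have -> : (fun p : R * R => (0 : {poly R}).[p.2]) = cst 0 by apply/funext => x; rewrite hornerC.
  by rewrite derive_cst deriv0 if_same hornerC.
have E : (fun p : R * R => (q * 'X + c%:P).[p.2]) =
    ((fun p : R * R => q.[p.2]) \* (@snd R R)) \+ cst c.
  by apply/funext => x; rewrite !hornerE.
have d1 : derivable (fun p : R * R => q.[p.2]) p (dir R b).
  by apply: diff_derivable; exact: (@smooth_height q [::] p I).
have d2 : differentiable (@snd R R) p by exact: (@smooth_linear R setT (@snd R R) csnd [::] p I).
have d3 := diff_derivable (v := dir R b) d2.
rewrite E (deriveD (derivableM d1 d3)) ?derive_cst ?addr0; last exact: derivable_cst.
have lin (l : {linear (R * R)%type -> R^o}) v : continuous l -> 'D_v l p = l v.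
  by move=> cl; rewrite deriveE ?diff_lin//; exact: linear_differentiable.
rewrite (deriveM d1 d3) IH (lin (@snd R R) _ csnd).
rewrite /GRing.scale /dir; case: b {d1 d3 IH} => /=.
  by rewrite derivD derivM derivX derivC !hornerE; ring.
by rewrite hornerC !mulr0 addr0.
Qed.

Lemma height_bound q : exists B : R, forall y, `|y| <= 1 -> `|q.[y]| <= B.
Proof.
elim/poly_ind: q => [|q c [B hB]]; first by exists 0 => y _; rewrite hornerC normr0.
exists (B + `|c|) => y hy; rewrite !hornerE; apply: le_trans (ler_normD _ _) _.
rewrite lerD2r normrM; have h1 := hB y hy.
have : `|q.[y]| * `|y| <= `|q.[y]| * 1 by rewrite ler_wpM2l.
lra.
Qed.

Lemma partial_height_bound n q : exists B : R, forall s p, (size s <= n)%N -> `|p.2| <= 2^-1 ->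
  `|partial s (fun p : R * R => q.[p.2]) p| <= B.
Proof.
elim: n q => [|n IH] q.
  by have [B hB] := height_bound q; exists B => -[|//] p _ hp; apply: hB; lra.
have [B0 h0] := height_bound q; have [B1 h1] := IH q^`(); have [B2 h2] := IH 0.
exists (Num.max B0 (Num.max B1 B2)) => -[|b s] p hs hp; first by rewrite le_max h0//; lra.
rewrite [partial _ _]/(partial s ('D_(dir R b) (fun p : R * R => q.[p.2]))) derive_height.
by case: b hs => hs; rewrite !le_max ?(h1 s p hs hp) ?(h2 s p hs hp) !orbT.
Qed.

Lemma partial_scale (u : R) s q p : partial s (cst u \* (fun p : R * R => q.[p.2])) p =
  u * partial s (fun p : R * R => q.[p.2]) p.
Proof.
elim: s q => //= b s IH q.
have -> : 'D_(dir R b) (cst u \* (fun p : R * R => q.[p.2])) =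
    cst u \* (fun p : R * R => (if b then q^`() else 0).[p.2]).
  apply/funext => x; rewrite -derive_height.
  have dh : derivable (fun p : R * R => q.[p.2]) x (dir R b).
    by apply: diff_derivable; exact: (@smooth_height q [::]).
  by rewrite (deriveM (derivable_cst u _ _) dh) derive_cst scaler0 addr0.
by rewrite derive_height; exact: IH.
Qed.
End HeightPolynomials.

Section Shears.
Variables (R : realType) (q : {poly R}).
Hypotheses (q_even : forall y, q.[- y] = q.[y]) (q_end : q.[2^-1] = 0).
Notation mobius := (mobius R).
Notation strip := (strip R).
Notation diffOmega := (diffOmega R).
Implicit Types (t : R) (p : R * R) (x y z : strip).

Definition shear t p : R * R := (p.1 + t * q.[p.2], p.2).
Definition shear_point t x : strip := exist (fun p => in_strip p) (shear t (val x)) (valP x).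
Definition shear_map t (m : mobius) : mobius := proj (shear_point t (repr m)).

Lemma shear_mapE t x : shear_map t (proj x) = proj (shear_point t x).
Proof.
have : proj (repr (proj x)) = proj x by rewrite /proj reprK.
move=> /proj_eq[k kE]; rewrite /shear_map; symmetry.
apply: (@proj_deck R _ _ k); rewrite /= [val (repr _)]kE /deck /shear /=.
have -> : q.[(-1) ^+ `|k|%N * (val x).2] = q.[(val x).2].
  by rewrite -signr_odd; case: odd; rewrite ?expr0 ?mul1r ?expr1 ?mulN1r ?q_even.
by congr pair; ring.
Qed.

Lemma shear_lift t x : local_lift (shear_map t) x (shear t).
Proof.
exists setT; split=> //; [exact: openT| |by move=> y _; exists (shear_point t y); rewrite shear_mapE].
have cfst : continuous (@fst R R) by move=> p; exact: cvg_fst.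
have csnd : continuous (@snd R R) by move=> p; exact: cvg_snd.
split; last exact: (@smooth_linear R setT (@snd R R) csnd).
apply: (smooth_onD openT (@smooth_linear R setT (@fst R R) cfst)).
exact: (smooth_onM openT (@smooth_cst R setT t) (smooth_height q)).
Qed.

Lemma shear_mapD s t : shear_map s \o shear_map t = shear_map (s + t).
Proof.
apply/funext => m; rewrite /= {2}/shear_map shear_mapE /shear_map; congr proj.
by apply: val_inj; rewrite /= /shear /=; congr pair; ring.
Qed.

Lemma shear_map0 : shear_map 0 = id.
Proof.
apply/funext => m; rewrite /shear_map -[RHS]reprK; congr proj.
by apply: val_inj; rewrite /= /shear mul0r addr0 -surjective_pairing.
Qed.

Lemma shear_smooth t : smooth_map (shear_map t).
Proof. by move=> x; exists (shear t); exact: shear_lift. Qed.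

Lemma shear_end (y : R) : 2^-1 = `|y| -> q.[y] = 0.
Proof.
by move/esym/eqP; rewrite eqr_norml => /andP[/orP[]/eqP -> _]; rewrite ?q_even q_end.
Qed.

Lemma shear_rel t : diff_omega_rel (shear_map t).
Proof.
have K s u : s + u = 0 -> cancel (shear_map u) (shear_map s).
  by move=> su m; have := congr1 (fun f => f m) (shear_mapD s u); rewrite su shear_map0.
split.
- exists (shear_map (- t)); split; [apply: K; lra|apply: K; lra|exact: shear_smooth..].
- move=> x x2; rewrite shear_mapE; congr proj; apply: val_inj.
  by rewrite /= /shear shear_end// mulr0 addr0 -surjective_pairing.
- apply/(preserves_omegaP (shear_smooth t)) => x F lF; rewrite (jac_lift lF (shear_lift t x)).
  have [d1 d2] := lift_differentiable (shear_lift t x).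
  have [_ dE] := diff_coord d1 d2; rewrite /jac !dE /dxdy /=.
  have csnd : continuous (@snd R R) by move=> p; exact: cvg_snd.
  have cfst : continuous (@fst R R) by move=> p; exact: cvg_fst.
  have lin (l : {linear (R * R)%type -> R^o}) v : continuous l -> 'D_v l (val x) = l v.
    by move=> cl; rewrite deriveE ?diff_lin//; exact: linear_differentiable.
  have D2 b : 'D_(dir R b) (fun p => (shear t p).2) (val x) = (dir R b).2 by exact: (lin (@snd R R)).
  have D1 : 'D_(dir R false) (fun p => (shear t p).1) (val x) = 1.
    have dh : derivable (fun p : R * R => q.[p.2]) (val x) (dir R false).
      by apply: diff_derivable; exact: (@smooth_height R q [::] (val x) I).
    have dc : derivable (fun p : R * R => t * q.[p.2]) (val x) (dir R false).
      by apply: derivableM => //; exact: derivable_cst.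
    have df : derivable (@fst R R) (val x) (dir R false).
      by apply: diff_derivable; exact: (@smooth_linear R setT (@fst R R) cfst [::] (val x) I).
    rewrite (deriveD df dc) (lin (@fst R R) _ cfst).
    rewrite (deriveM (derivable_cst t _ _) dh) derive_cst scaler0 addr0.
    have := congr1 (fun f => f (val x)) (derive_height false q); rewrite /= hornerC => ->.
    by rewrite scaler0 addr0.
  by rewrite (D2 false) (D2 true) D1 /dir /= mul0r subr0 mulr1 normr1.
Qed.

Definition shear_diff t : diffOmega := exist _ (shear_map t) (mem_set (shear_rel t)).

Lemma shear_diff0 : shear_diff 0 = 1%g.
Proof. by apply: val_inj; rewrite /= shear_map0. Qed.

Lemma shear_continuous : continuous (shear_diff : R -> diffOmega).
Proof.
apply/continuousP => A oA; have {}oA : cinfty_open A := oA.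
rewrite openE => t At; have [K [n [e [cK e0 KA]]]] := oA _ At.
have [B hB] := partial_height_bound n q; pose C := `|B| + 1.
have C0 : 0 < C by rewrite /C; have := normr_ge0 B; lra.
apply/nbhs_ballP; exists (e / C); first exact: divr_gt0.
move=> s /= ts; rewrite /ball /= in ts; apply: KA => x Kx.
exists (shear t), (shear s); split; [exact: shear_lift..|move=> l ln].
have sh u v : partial l (fun p => (shear u p).1) v =
    partial l (@fst R R) v + u * partial l (fun p : R * R => q.[p.2]) v.
  have cfst : continuous (@fst R R) by move=> p; exact: cvg_fst.
  have s1 := @smooth_linear R setT (@fst R R) cfst; have s2 := smooth_height q.
  have sc : smooth_on setT (cst u \* (fun p : R * R => q.[p.2])).
    exact: (smooth_onM openT (@smooth_cst R setT u) s2).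
  have := partialD l openT s1 sc (I : setT v) => ->; congr (_ + _).
  by rewrite (partial_scale u l q).
split; last by rewrite subrr normr0.
rewrite !sh; set a := partial l (@fst R R) _; set P := partial l _ _.
have -> : a + t * P - (a + s * P) = (t - s) * P by ring.
rewrite normrM.
have xb : `|(val x).2| <= 2^-1 by rewrite -in_stripE; exact: (valP x).
have hx := hB l (val x) ln xb.
apply: (@le_lt_trans _ _ (`|t - s| * C)).
  by rewrite ler_wpM2l//; apply: le_trans hx _; rewrite /C; have := ler_norm B; lra.
by rewrite -ltr_pdivlMr.
Qed.

Lemma shear_component t : identity_component (shear_diff t).
Proof.
have : range (shear_diff : R -> diffOmega) `<=` @identity_component R.
  apply: connected_component_max => //; first by exists 0 => //; exact: shear_diff0.
  apply: connected_continuous_connected.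
    by apply/connected_intervalP => ? ? ? ? ? ?.
  by apply: continuous_subspaceT => s; exact: shear_continuous.
by apply; exists t.
Qed.

Let cl (y : R) : R := 2^-1 - depth y.
Definition wide_shear t p : R * R := (p.1 + t * q.[cl p.2], p.2).

Lemma cl_band (y : R) : `|cl y| <= 2^-1.
Proof. by have := depth_range y; rewrite /cl ler_norml => /andP[? ?]; apply/andP; split; lra. Qed.

Lemma cl_id (y : R) : `|y| <= 2^-1 -> cl y = y.
Proof. by rewrite ler_norml => h; rewrite /cl depthE//; ring. Qed.

Lemma wide_shear_elementary t : elementary (wide_shear t) (wide_shear (- t)).
Proof.
have ccl : continuous (fun p : R * R => cl p.2).
  move=> p; apply: (@continuous_comp _ _ _ (@snd R R) cl); first exact: cvg_snd.
  apply: cvgB; first exact: cvg_cst.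
  apply: cvgB; first exact: cvg_cst.
  apply: (@continuous_max _ _ (fun=> - 2^-1) (fun y : R => Num.min y 2^-1)); first exact: cvg_cst.
  by apply: (@continuous_min _ _ id (fun=> 2^-1)); [exact: cvg_id|exact: cvg_cst].
have cont s : continuous (wide_shear s).
  have c1 : continuous (fun p : R * R => p.1 + s * q.[cl p.2]).
    move=> p; apply: cvgD; first exact: cvg_fst.
    apply: cvgM; first exact: cvg_cst.
    apply: (@continuous_comp _ _ _ (fun p : R * R => cl p.2) (horner q)); first exact: ccl.
    exact: continuous_horner.
  move=> p; exact: (@cvg_pair (R * R)%type R R (nbhs p)
    (nbhs (p.1 + s * q.[cl p.2])) (nbhs p.2) _ _ _ (fun p => p.1 + s * q.[cl p.2]) snd (c1 p) cvg_snd).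
have K s p : wide_shear (- s) (wide_shear s p) = p.
  by rewrite [RHS]surjective_pairing /wide_shear /=; congr pair; ring.
split.
- exact: K.
- by move=> p; have := K (- t) p; rewrite opprK.
- exact: cont.
- exact: cont.
- by move=> p; rewrite /wide_shear /=; congr pair; ring.
- move=> p hp; rewrite [RHS]surjective_pairing /wide_shear; congr pair.
  rewrite shear_end ?mulr0 ?addr0//; rewrite /cl /depth.
  have half : - 2^-1 <= 2^-1 :> R by lra.
  case: (leP 0 p.2) hp => p0; [rewrite ger0_norm// => hp|rewrite ltr0_norm// => hp].
    by rewrite (min_idPr hp) (max_idPr half) opprB addrCA subrr addr0 ger0_norm.
  have hp' : p.2 <= - 2^-1 by lra.
  rewrite (min_idPl _); last exact: le_trans hp' half.
  by rewrite (max_idPl hp') opprB addrCA subrr addr0 normrN ger0_norm.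
- have [B hB] := height_bound q; exists (`|t| * B) => p.
  by rewrite /wide_shear /= addrC addKr normrM ler_wpM2l//; apply: hB; have := cl_band p.2; lra.
- left; split=> // p p' pp' lt; rewrite /wide_shear /= pp'; lra.
Qed.

Lemma shear_lifts t : lifts (shear_map t) [:: (wide_shear t, wide_shear (- t))].
Proof.
split=> /=; first by split=> //; exact: wide_shear_elementary.
move=> x; exists (shear_point t x); rewrite shear_mapE; split=> //.
by rewrite /= /shear /wide_shear cl_id// -in_stripE; exact: (valP x).
Qed.

Section Twist.
Variable n : nat.
Hypothesis n0 : (0 < n)%N.
Notation plane := (measurableTypeR R * measurableTypeR R)%type.
Notation sample := (n.-tuple plane).

Definition top_depth (w : seq plane) : R := foldl (fun m (p : plane) => Num.max m (depth p.2)) 0 w.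

Lemma foldl_max (s : R) (w : seq plane) : let m := foldl (fun m (p : plane) => Num.max m (depth p.2)) s w in
  [/\ s <= m, {in w, forall p, depth p.2 <= m} & m = s \/ exists2 p, p \in w & m = depth p.2].
Proof.
elim: w s => [|p w IH] s /=; first by split=> //; left.
have [h1 h2 h3] := IH (Num.max s (depth p.2)).
rewrite ge_max in h1; have /andP[h4 h5] := h1; split=> //.
  by move=> p'; rewrite inE => /orP[/eqP ->|/h2].
case: h3 => [->|[p' pw ->]]; last by right; exists p' => //; rewrite inE pw orbT.
by case: (leP s (depth p.2)) => _; [right; exists p => //; rewrite mem_head|left].
Qed.

Lemma lowest_row (X : 'I_n -> R * R) : exists a, lower a (sigma X) = [::] /\
  forall b, (X a).2 <= (X b).2.
Proof.
have : sorted (fun a b => (X b).2 <= (X a).2) (sigma X).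
  by apply: sub_sorted (sigma_sorted X) => a b; exact: tie_le_height.
have us := sigma_uniq X; have ms := mem_sigma X.
case/lastP: (sigma X) us ms => [_ /(_ (Ordinal n0))//|s a] us ms so; exists a; split.
  move: us; rewrite rcons_uniq => /andP[+ _]; elim: s {so ms} => [|b s IH] /=; first by rewrite eqxx.
  by rewrite inE negb_or => /andP[/negbTE -> ?]; exact: IH.
move=> b; have := ms b; rewrite mem_rcons inE => /orP[/eqP ->//|bs].
move: so; rewrite -cats1 => so.
have tr : transitive (fun a b : 'I_n => (X b).2 <= (X a).2) by move=> c d e h1 h2; exact: le_trans h2 h1.
have := so; rewrite (sorted_pairwise tr) pairwise_cat => /and3P[/allrelP h _ _].
by apply: h => //; rewrite inE.
Qed.

Lemma cocycle_shear (k : nat) (w : sample) :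
  `|cocycle [:: (wide_shear k%:R, wide_shear (- k%:R))] w -
    - (k%:R * (n%:R / 2 * q.[2^-1 - top_depth w]))| <= 2 * n%:R.
Proof.
pose X := cfg w; have [a [la amin]] := lowest_row X.
have hX b : (X b).2 = 2^-1 - depth (tnth w b).2 by rewrite /X /cfg /clamp /depth /=; ring.
have depthX b : depth (tnth w b).2 = 2^-1 - (X b).2 by rewrite hX; ring.
have wE : top_depth w = 2^-1 - (X a).2.
  rewrite -depthX; have [h1 h2 h3] := foldl_max 0 w; apply/eqP; rewrite eq_le -/(top_depth w) in h1 h2 h3 *.
  rewrite h2 ?mem_tnth// andbT; case: h3 => [->|[p /tnthP[b ->] ->]].
    by have := depth_range (tnth w a).2 => /andP[].
  by rewrite !depthX; have := amin b; lra.
rewrite wE; have -> : 2^-1 - (2^-1 - (X a).2) = (X a).2 by ring.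
pose Y : 'I_n -> R * R := wide_shear k%:R \o X.
have := @twist_horizontal R n X Y a (fun b => erefl) la.
rewrite -(ler_rat R) ratr_norm rmorphB /= ratr_int ratr_nat.
rewrite -[ratr _]/(cocycle [:: (wide_shear k%:R, wide_shear (- k%:R))] w).
have bX : in_band X := cfg_band w.
have bY : in_band Y by move=> b; exact: bX.
rewrite topE; rewrite !gaps_high//; try exact: half_lt2.
rewrite /Y /= /wide_shear /= cl_id; last exact: bX.
set x := (X a).1; set r := q.[(X a).2].
have h (z : R) : (Num.ceil z)%:~R - 1 < z <= (Num.ceil z)%:~R.
  apply/andP; split; last by rewrite -ceil_le_int.
  by rewrite -[1]/(1%:~R) -intrB ltNge -ceil_le_int -ltNge ltrBlDr ltrDl.
have /andP[h1 h2] := h ((0 - (x + k%:R * r)) / 2); have /andP[h3 h4] := h ((0 - x) / 2).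
rewrite rmorphM rmorphB /=; move: (Num.ceil _)%:~R (Num.ceil _)%:~R h1 h2 h3 h4 => v u h1 h2 h3 h4.
have nR : 0 < n%:R :> R by rewrite ltr0n.
have uv : `|(u - v) - - (k%:R * (r / 2))| <= 1 by rewrite ler_norml; apply/andP; split; lra.
have nuv : `|n%:R * (u - v) - - (k%:R * (n%:R / 2 * r))| <= n%:R.
  have -> : n%:R * (u - v) - - (k%:R * (n%:R / 2 * r)) = n%:R * ((u - v) - - (k%:R * (r / 2))) by field.
  by rewrite normrM gtr0_norm// ger_pMr.
move=> h5; set c := cocycle _ _ in h5 *.
have -> : c - - (k%:R * (n%:R / 2 * r)) = (c - n%:R * (u - v)) + (n%:R * (u - v) - - (k%:R * (n%:R / 2 * r))).
  by ring.
by apply: le_trans (ler_normD _ _) _; rewrite -pmulrn in h5; lra.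
Qed.
End Twist.
End Shears.

Section MeanTwist.
Variable R : realType.
Notation diffOmega := (diffOmega R).
Notation diffOmega0 := (diffOmega0 R).

Lemma lifts_preserving (f : diffOmega) es : lifts (val f) es -> preserving es.
Proof.
move=> lf; have [c _] := lf; have li := lifts_inv (val_inv f) lf.
have [ci invE] := inv_chainP c.
have per p m : fwd es (p.1 + 2 * m%:~R, p.2) = ((fwd es p).1 + 2 * m%:~R, (fwd es p).2).
  by elim: es c p {lf li ci invE} => //= e es IH [E c] p; rewrite (elem_periodz _ _ E) (IH c).
have uni p : in_strip p -> unimodular_at (bwd es) p.
  move=> hp; have [_ _ pi] := diff_rel f^-1%g.
  have si' : smooth_map (val f^-1%g) by have [[? []]] := diff_rel f^-1%g.
  have := unimodular_lift (exist _ p hp) si' pi li.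
  by have -> : fwd (inv_chain es) = bwd es by apply/funext.
have hband p : `|p.2| <= 2^-1 -> `|(fwd es p).2| <= 2^-1.
  by rewrite -!in_stripE; exact: fwd_strip.
have inv := red_invariant (fwdK c) (fwd_continuous c) per (fun p => bwd_out c) hband uni.
have oE (A : set (measurableTypeR R * measurableTypeR R)) :
  one_point A = ((2^-1)%:E * area R (A `&` @band R))%E by [].
move=> A mA; rewrite !oE -(inv A mA); congr (_ * area R _)%E.
have half p : @band R p -> `|p.2| <= 2^-1.
  rewrite /band boxE => -[_] /=; rewrite in_itv /= => /andP[h1 h2].
  by rewrite ler_norml; apply/andP; split; lra.
by apply/seteqP; split=> p [h /[dup] bp /half hp]; split=> //; move: h; rewrite /flow /= clamp_id.
Qed.

Section Points.
Variable n : nat.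
Hypothesis n0 : (0 < n)%N.

Lemma mean_twist_lift (h : mobius R -> mobius R) es fs : lifts h es -> lifts h fs ->
  mean_twist n es = mean_twist n fs.
Proof.
move=> l1 l2; have [c1 _] := l1; have [c2 _] := l2.
by rewrite /mean_twist (cocycle_composite n c1 c2 (lift_unique l1 l2)).
Qed.

Let lift_of (g : diffOmega0) : exists es, lifts (val (val g)) es.
Proof. exact: component_liftable (set_mem (valP g)). Qed.

Definition average_twist (g : diffOmega0) : R := mean_twist n (sval (cid (lift_of g))).

Lemma average_twistE g es : lifts (val (val g)) es -> average_twist g = mean_twist n es.
Proof. by apply: mean_twist_lift; exact: (svalP (cid (lift_of g))). Qed.

Lemma average_twistM g h : `|average_twist (g * h)%g - (average_twist g + average_twist h)| <= n%:R.
Proof.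
have [es le] := lift_of g; have [fs lf] := lift_of h.
have lgh : lifts (val (val (g * h)%g)) (fs ++ es) := lifts_comp lf le.
rewrite (average_twistE lgh) (average_twistE le) (average_twistE lf).
have [ce _] := le; have [cf _] := lf; rewrite [_ es + _]addrC.
exact: mean_twist_cat (lifts_preserving lf).
Qed.
End Points.

Section ShearValues.
Variable q : {poly R}.
Hypotheses (q_even : forall y, q.[- y] = q.[y]) (q_end : q.[2^-1] = 0).

Definition shear0 : diffOmega0 :=
  exist _ (shear_diff q_even q_end 1) (mem_set (shear_component q_even q_end 1)).

Lemma shear0X k : val (val (shear0 ^+ k)%g) = shear_map q k%:R.
Proof.
elim: k => [|k IH]; first by rewrite expg0 shear_map0.
rewrite expgS -[LHS]/(shear_map q 1 \o val (val (shear0 ^+ k)%g)) IH shear_mapD//.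
by rewrite -natr1 addrC.
Qed.
End ShearValues.

Lemma measurable_top_depth n (s : R) : measurable_fun setT
  (fun w : n.-tuple (measurableTypeR R * measurableTypeR R) => foldl (fun m p => Num.max m (depth p.2)) s w).
Proof.
have h (l : seq 'I_n) (g : n.-tuple (measurableTypeR R * measurableTypeR R) -> R) : measurable_fun setT g ->
    measurable_fun setT (fun w => foldl (fun m p => Num.max m (depth p.2)) (g w) [seq tnth w i | i <- l]).
  elim: l g => // i l IH g mg /=; apply: (IH (fun w => Num.max (g w) (depth (tnth w i).2))).
  apply: measurable_maxr => //; apply: (measurableT_comp (@measurable_depth R)).
  by apply: (measurableT_comp measurable_snd); exact: measurable_tnth.
have := h (enum 'I_n) (fun=> s) (measurable_cst _).
by under eq_fun do rewrite map_tnth_enum.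
Qed.

Lemma top_depth_range (w : seq (measurableTypeR R * measurableTypeR R)) : 0 <= top_depth w <= 1.
Proof.
have [h1 _ h3] := foldl_max 0 w; rewrite /top_depth h1 /=.
by case: h3 => [->|[p _ ->]]; [exact: ler01|have := depth_range p.2 => /andP[]].
Qed.

Lemma bm_top_depth n (r : {poly R}) : bounded_measurable
  (fun w : n.-tuple (measurableTypeR R * measurableTypeR R) => r.[top_depth w]).
Proof.
split.
  apply: (@measurableT_comp _ _ _ _ _ _ (horner r)); last exact: measurable_top_depth.
  by apply: continuous_measurable_fun; exact: continuous_horner.
have [B hB] := height_bound r; exists B => w; apply: hB.
by have /andP[h1 h2] := top_depth_range w; rewrite ger0_norm.
Qed.

Lemma twist_quasimorphism n : (0 < n)%N -> exists mu : diffOmega0 -> R,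
  homogeneous_quasimorphism mu /\ forall (q : {poly R}) q_even q_end,
  mu (@shear0 q q_even q_end) = - (n%:R / 2 * mean (iid R n) (fun w => q.[2^-1 - top_depth w])).
Proof.
move=> n0; have [mu [hmu near]] := homogenization (average_twistM n0).
exists mu; split=> // q q_even q_end; set f := shear0 _ _; set m := mean _ _.
apply/eqP; rewrite -subr_eq0 opprK; apply/eqP; apply: (@archimedean_zero _ _ (3 * n%:R)) => -[|k].
  by rewrite mul0r mulr_ge0.
have l : lifts (val (val (f ^+ k.+1)%g)) [:: (wide_shear q k.+1%:R, wide_shear q (- k.+1%:R))].
  by rewrite shear0X; exact: shear_lifts.
have h1 := near f k.+1 isT; rewrite (average_twistE n l) in h1.
have bq : bounded_measurable (fun w : n.-tuple (measurableTypeR R * measurableTypeR R) => q.[2^-1 - top_depth w]).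
  have := bm_top_depth n (q \Po ((2^-1)%:P - 'X)).
  by under eq_fun do rewrite horner_comp !hornerE.
have [c _] := l.
have := @mean_near _ _ R (iid R n) _ _ (2 * n%:R) (bm_cocycle n0 c) (bmZ (- (k.+1%:R * (n%:R / 2))) bq).
rewrite (@meanZ _ _ _ _ _ _ bq) -/m -/(mean_twist n _) => h2.
rewrite -(ger0_norm (ler0n R k.+1)) -normrM.
set M := mean_twist _ _ in h1 h2.
have -> : k.+1%:R * (mu f + n%:R / 2 * m) = (k.+1%:R * mu f - M) + (M - - (k.+1%:R * (n%:R / 2)) * m) by ring.
apply: le_trans (ler_normD _ _) _.
have {}h2 : `|M - - (k.+1%:R * (n%:R / 2)) * m| <= 2 * n%:R.
  by apply: h2 => w; have := cocycle_shear q n0 k.+1 w; rewrite !mulNr !mulrA.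
lra.
Qed.

Lemma top_depth_moment n (j : nat) (s : R) : (0 < j)%N -> 0 <= s <= 1 ->
  (\int[iid R n]_w (foldl (fun m p => Num.max m (depth p.2)) s w ^+ j)%:E =
   ((n%:R + j%:R * s ^+ (n + j)) / (n + j)%:R)%:E)%E.
Proof.
move=> j0; pose F i t (w : i.-tuple (measurableTypeR R * measurableTypeR R)) : \bar R :=
  (foldl (fun m p => Num.max m (depth p.2)) t w ^+ j)%:E.
have mF i t : measurable_fun setT (@F i t).
  by apply/measurable_EFinP; apply: measurable_funX; exact: measurable_top_depth.
elim: n s => [|n IH] s s01.
  rewrite /= integral_dirac//. rewrite /dirac indicE mem_set// mul1e /= add0r add0n mulrC mulKf//.
    by rewrite pnatr_eq0 -lt0n.
  exact: mF.
have F0 w : (0 <= @F n.+1 s w)%E.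
  rewrite lee_fin exprn_ge0//.
  by have [h _ _] := foldl_max s w; case/andP: s01 => s0 _; exact: le_trans h.
rewrite [LHS](integral_iid_cons (mF _ s) F0).
pose g (y : measurableTypeR R) : R := (n%:R + j%:R * Num.max s (depth y) ^+ (n + j)) / (n + j)%:R.
have inner p : (\int[iid R n]_w @F n.+1 s (tcons (p, w)) = (g p.2)%:E)%E.
  apply: (IH (Num.max s (depth p.2))).
  have /andP[d0 d1] := depth_range p.2; case/andP: s01 => s0 s1.
  by rewrite le_max s0 ge_max s1.
rewrite (eq_integral (fun p => (g p.2)%:E)); last by move=> p _; exact: inner.
have mmax i (D : set (measurableTypeR R)) : measurable_fun D (fun y : measurableTypeR R => (Num.max s (depth y) ^+ i)%:E : \bar R).
  apply/measurable_funTS/measurable_EFinP; apply: measurable_funX.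
  by apply: measurable_maxr; [exact: measurable_cst|exact: measurable_depth].
have max0 i y : (0 <= (Num.max s (depth y) ^+ i)%:E :> \bar R)%E.
  by rewrite lee_fin exprn_ge0// le_max; case/andP: s01 => ->.
have nj0 : 0 < (n + j)%:R :> R by rewrite ltr0n addn_gt0 j0 orbT.
have gE y : (g y)%:E = ((n%:R / (n + j)%:R)%:E * (Num.max s (depth y) ^+ 0)%:E +
    (j%:R / (n + j)%:R)%:E * (Num.max s (depth y) ^+ (n + j))%:E)%E.
  by rewrite -!EFinM -EFinD /g expr0 mulr1 mulrDl mulrAC.
have mZ (k : R) i (D : set (measurableTypeR R)) : measurable_fun D (fun y : measurableTypeR R => (k%:E * (Num.max s (depth y) ^+ i)%:E)%E).
  by apply: emeasurable_funM; [exact: measurable_cst|exact: mmax].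
have p0 (i l : nat) : 0 <= i%:R / l%:R :> R by rewrite divr_ge0.
rewrite -[LHS]/(\int[@one_point R]_p (fun y => (g y)%:E) p.2)%E integral_height; first last.
- by move=> y; rewrite gE adde_ge0// mule_ge0// lee_fin.
- by under eq_fun do rewrite gE; exact: emeasurable_funD.
under eq_integral do rewrite gE.
rewrite ge0_integralD//; first last.
- by move=> y _; rewrite mule_ge0// lee_fin.
- by move=> y _; rewrite mule_ge0// lee_fin.
rewrite !ge0_integralZl//; try by rewrite lee_fin.
rewrite !integral_depth// -!EFinM -EFinD; congr EFin; rewrite expr1 addSn -[(n + j).+1%:R]natr1 -[n.+1%:R]natr1.
have : (n + j)%:R + 1 != 0 :> R by rewrite natr1 pnatr_eq0.
move: nj0; rewrite natrD => nj0 nz; set P := s ^+ _.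
by field; rewrite nz lt0r_neq0.
Qed.
End MeanTwist.

Section UnitIntegral.
Variable R : realType.
Implicit Types (r p q : {poly R}).

Definition unit_integral r : R := \sum_(i < size r) r`_i / i.+1%:R.

Lemma unit_integral_wide m r : (size r <= m)%N -> unit_integral r = \sum_(i < m) r`_i / i.+1%:R.
Proof.
move=> rm; rewrite /unit_integral (big_ord_widen m (fun i => r`_i / i.+1%:R) rm) big_mkcond /=.
by apply: eq_bigr => i _; case: ltnP => // ri; rewrite nth_default// mul0r.
Qed.

Lemma unit_integralD p q : unit_integral (p + q) = unit_integral p + unit_integral q.
Proof.
pose m := maxn (size p) (size q).
rewrite (@unit_integral_wide m p) ?leq_maxl// (@unit_integral_wide m q) ?leq_maxr//.
rewrite (@unit_integral_wide m (p + q)) ?size_polyD// -big_split /=.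
by apply: eq_bigr => i _; rewrite coefD mulrDl.
Qed.

Lemma unit_integralZ c p : unit_integral (c *: p) = c * unit_integral p.
Proof.
rewrite (@unit_integral_wide (size p) (c *: p)) ?size_scale_leq// mulr_sumr.
by apply: eq_bigr => i _; rewrite coefZ mulrA.
Qed.

Lemma unit_integral_sum (I : Type) (s : seq I) (f : I -> {poly R}) :
  unit_integral (\sum_(i <- s) f i) = \sum_(i <- s) unit_integral (f i).
Proof.
elim: s => [|i s IH]; first by rewrite !big_nil /unit_integral size_poly0 big_ord0.
by rewrite !big_cons unit_integralD IH.
Qed.

Lemma unit_integral_deriv p : unit_integral p^`() = p.[1] - p.[0].
Proof.
have sp : (size p^`() <= size p)%N.
  by have [->|/lt_size_deriv/ltnW//] := eqVneq p 0; rewrite deriv0.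
rewrite (unit_integral_wide sp) horner_coef0 (horner_coef_wide 1 (leqnSn (size p))).
rewrite big_ord_recl expr0 mulr1 addrAC subrr add0r; apply: eq_bigr => i _.
by rewrite coef_deriv expr1n mulr1 /= -(mulr_natr p`_i.+1 i.+1) mulfK// pnatr_eq0.
Qed.

Lemma primitive_ex r : exists p, p^`() = r.
Proof.
exists (\poly_(i < (size r).+1) (r`_i.-1 / i%:R)); apply/polyP => i.
rewrite coef_deriv coef_poly ltnS /=; case: ltnP => ri.
  by rewrite -(mulr_natr (r`_i / i.+1%:R) i.+1) divfK// pnatr_eq0.
by rewrite mul0rn nth_default.
Qed.

Lemma unit_integral_flip r : unit_integral (r \Po (1 - 'X)) = unit_integral r.
Proof.
have [p <-] := primitive_ex r; rewrite unit_integral_deriv.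
have -> : p^`() \Po (1 - 'X) = (- (p \Po (1 - 'X)))^`().
  by rewrite derivN deriv_comp derivB derivX derivC sub0r mulrN1 opprK.
rewrite unit_integral_deriv !hornerN !horner_comp !hornerE subrr subr0; ring.
Qed.

Lemma positive_unit_integral r : (forall x, 0 <= x <= 1 -> 0 <= r.[x]) -> unit_integral r = 0 -> r = 0.
Proof.
move=> r0; have [p pE] := primitive_ex r; rewrite -pE unit_integral_deriv => p01.
have mono x y : 0 <= x -> x <= y -> y <= 1 -> p.[x] <= p.[y].
  move=> x0; rewrite le_eqVlt => /orP[/eqP ->//|xy y1].
  have hd z : z \in `]x, y[%R -> is_derive z (1 : R) (horner p) p^`().[z] by move=> _; exact: is_derive_poly.
  have hc : {within `[x, y], continuous (horner p)}.
    by apply: continuous_subspaceT => z; exact: continuous_horner.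
  have [z zxy pxy] := MVT xy hd hc.
  rewrite -subr_ge0 pxy mulr_ge0 ?subr_ge0 ?(ltW xy)//.
  rewrite pE; apply: r0; move: zxy; rewrite in_itv /= => /andP[h1 h2].
  by apply/andP; split; lra.
pose d := p - (p.[0])%:P.
have d0 x : 0 <= x <= 1 -> root d x.
  move=> /andP[x0 x1]; have h1 := mono 0 x (lexx _) x0 x1; have h2 := mono x 1 x0 x1 (lexx _).
  by rewrite rootE /d !hornerE subr_eq0; apply/eqP; lra.
have d00 : d = 0.
  apply/eqP; apply: contraT => dn0.
  pose s := [seq (i.+1%:R)^-1 : R | i <- iota 0 (size d)].
  have : (size s < size d)%N.
    apply: max_poly_roots => //.
      apply/allP => x /mapP[i _ ->]; apply: d0; rewrite invr_ge0 ler0n /= invf_le1 ?ltr0n//.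
      by rewrite ler1n.
    rewrite map_inj_uniq ?iota_uniq// => i j /invr_inj/eqP.
    by rewrite eqr_nat => /eqP[].
  by rewrite /s size_map size_iota ltnn.
have -> : p = (p.[0])%:P by apply/eqP; rewrite -subr_eq0 -/d d00.
by rewrite derivC.
Qed.

Lemma even_orthogonal (p : {poly R}) : (forall i, odd i -> p`_i = 0) ->
  (forall g, g \Po (1 - 'X) = g -> g.[0] = 0 -> unit_integral (p * g) = 0) -> p = 0.
Proof.
move=> podd h; pose s := p + (p \Po (1 - 'X)); pose g := s * ('X * (1 - 'X)).
have flip2 : (1 - 'X) \Po (1 - 'X) = 'X :> {poly R}.
  by rewrite comp_polyB comp_polyC comp_polyX opprB addrC subrK.
have sE : s \Po (1 - 'X) = s.
  by rewrite /s comp_polyD -comp_polyA flip2 comp_polyXr addrC.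
have gE : g \Po (1 - 'X) = g.
  by rewrite /g !comp_polyM sE comp_polyX flip2 [(1 - 'X) * _]mulrC.
have g0 : g.[0] = 0 by rewrite /g hornerM hornerM hornerX mul0r mulr0.
have h1 := h g gE g0; have h2 := unit_integral_flip (p * g).
rewrite comp_polyM gE h1 in h2.
have : unit_integral (s * g) = 0 by rewrite /s mulrDl unit_integralD h1 h2 addr0.
move=> /positive_unit_integral => /(_ (fun x => _)) sg0.
have /eqP : s * g = 0.
  apply: sg0 => x /andP[x0 x1]; have X1E : (1 - 'X : {poly R}).[x] = 1 - x by rewrite !hornerE.
  rewrite /g !hornerM hornerX X1E mulrA -expr2 mulr_ge0 ?sqr_ge0//.
  by rewrite mulr_ge0// subr_ge0.
have X1 : 1 - 'X != 0 :> {poly R}.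
  by apply/eqP => /(congr1 (horner^~ 0)); rewrite !hornerE; apply/eqP; rewrite subr0 oner_eq0.
rewrite /g !mulf_eq0 polyX_eq0 (negbTE X1) /= !orbF orbb => /eqP s0.
apply/eqP; apply: contraT => p0.
have /negPf even : ~~ odd (size p).-1.
  by apply/negP => /podd e; move: p0; rewrite -lead_coef_eq0 lead_coefE e eqxx.
have sX : size (1 - 'X : {poly R}) = 2%N.
  by rewrite -opprB size_polyN size_XsubC.
have lX : lead_coef (1 - 'X : {poly R}) = -1 by rewrite -opprB lead_coefN lead_coefXsubC.
have sp : size (p \Po (1 - 'X)) = size p by rewrite size_comp_poly2.
have := congr1 (fun t : {poly R} => t`_(size p).-1) s0.
rewrite /= /s coefD coef0 -{2}sp -!lead_coefE lead_coef_comp ?sX// lX -signr_odd even expr0 mulr1.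
by move/eqP; rewrite -mulr2n mulrn_eq0 /= lead_coef_eq0 (negPf p0).
Qed.
End UnitIntegral.

Section Conclusion.
Variable R : realType.

Lemma mean_top_depth n (r : {poly R}) : (0 < n)%N ->
  mean (iid R n) (fun w => r.[top_depth w]) = n%:R * unit_integral ('X^(n.-1) * r).
Proof.
move=> n0.
have bX i : bounded_measurable (fun w : n.-tuple (measurableTypeR R * measurableTypeR R) => top_depth w ^+ i : R).
  by have := bm_top_depth n ('X^i : {poly R}); under eq_fun do rewrite hornerXn.
have moment i : mean (iid R n) (fun w => top_depth w ^+ i) = n%:R / (n + i)%:R.
  case: i => [|i].
    by under eq_fun do rewrite expr0; rewrite mean_cst addn0 mulfV// pnatr_eq0 -lt0n.
  apply/EFin_inj; rewrite -(meanE _ (bX _)).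
  have := @top_depth_moment R n i.+1 0 isT; rewrite lexx ler01 => /(_ isT) ->.
  by rewrite addnS expr0n /= mulr0 addr0.
under eq_fun do rewrite horner_coef.
rewrite mean_sum; last by move=> i; exact: bmZ.
have sz : (size ('X^(n.-1) * r)%R <= n.-1 + size r)%N.
  by apply: leq_trans (size_polyMleq _ _) _; rewrite size_polyXn.
rewrite (unit_integral_wide sz) big_split_ord /= [X in _ * (X + _)]big1 ?add0r; last first.
  by move=> i _; rewrite coefXnM ltn_ord mul0r.
rewrite mulr_sumr; apply: eq_bigr => i _.
rewrite (@meanZ _ _ _ _ _ _ (bX i)) moment coefXnM ltnNge leq_addr /= addKn mulrCA.
by rewrite -addSn prednK.
Qed.
End Conclusion.

Theorem theorem6p25 (R : realType) :
  exists mu : nat -> diffOmega0 R -> R,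
    (forall n : nat, homogeneous_quasimorphism (mu n)) /\
    linearly_independent mu.
Proof.
pose mu n := sval (cid (@twist_quasimorphism R n.*2.+1 isT)).
have muP n := svalP (cid (@twist_quasimorphism R n.*2.+1 isT)).
exists mu; split=> [n|n a ha k]; first by have [] := muP n.
pose c (i : 'I_n) : R := a i * (i.*2.+1%:R * i.*2.+1%:R).
pose p : {poly R} := \sum_(i < n) c i *: 'X^(i.*2).
have pE (i : nat) : p`_i = \sum_(j < n) c j * (i == j.*2)%:R.
  by rewrite coef_sum; apply: eq_bigr => j _; rewrite coefZ coefXn.
have p0 : p = 0.
  apply: even_orthogonal => [i oi|g gE g0].
    rewrite pE big1// => j _; case: eqP => [ij|_]; last by rewrite mulr0.
    by move: oi; rewrite ij odd_double.
  pose q : {poly R} := g \Po ((2^-1)%:P - 'X).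
  have qE y : q.[y] = g.[2^-1 - y] by rewrite horner_comp !hornerE.
  have q_even y : q.[- y] = q.[y].
    by rewrite !qE -[in LHS]gE horner_comp !hornerE; congr (horner g); field.
  have q_end : q.[2^-1] = 0 by rewrite qE subrr.
  have := ha (shear0 q_even q_end).
  have E (i : 'I_n) : mu i (shear0 q_even q_end) =
      - (2^-1 * (i.*2.+1%:R * i.*2.+1%:R)) * unit_integral ('X^(i.*2) * g).
    have [_ e] := muP i; rewrite [LHS]e; under eq_fun do rewrite qE subKr.
    by rewrite mean_top_depth//=; ring.
  under eq_bigr do rewrite E.
  move=> h; have : - 2^-1 * unit_integral (p * g) = 0.
    rewrite -[RHS]h mulr_suml unit_integral_sum mulr_sumr; apply: eq_bigr => i _.
    by rewrite -scalerAl unit_integralZ /c; ring.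
  by move=> /eqP; rewrite mulf_eq0 oppr_eq0 invr_eq0 pnatr_eq0 /= => /eqP.
have : p`_(k.*2) = c k.
  rewrite pE (bigD1 k)//= eqxx mulr1 big1 ?addr0// => j jk.
  by rewrite (inj_eq double_inj) (inj_eq val_inj) eq_sym (negPf jk) mulr0.
rewrite p0 coef0 => /esym/eqP; rewrite mulf_eq0 mulf_eq0 !pnatr_eq0 /= !orbF.
by move=> /eqP.
Qed.
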